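(* Let $1\le s'<p_i<\infty$ for $i=1,\dots,m$, $\vec P=(p_1,\dots,p_m)$, and $\frac1p=\sum_{i=1}^m\frac1{p_i}$. Let $\Omega\in L^s((S^{n-1})^m)$ be homogeneous of degree zero. Then for $\vec\omega\in A_{\vec P/s'}$, where $\vec P/s'=(p_1/s',\dots,p_m/s')$, we have $$\|\mathcal M_\Omega(\vec f)\|_{L^p(\nu_{\vec\omega})}\le C_{n,m,\vec P,s}\,\|\Omega\|_{L^s((S^{n-1})^m)}\,[\vec\omega]_{A_{\vec P/s'}}^{1/p}\prod_{i=1}^m\big[\omega_i^{1-(\frac{p_i}{s'})'}\big]_{A_\infty}^{1/p_i}\prod_{i=1}^m\|f_i\|_{L^{p_i}(\omega_i)},$$ where $\nu_{\vec\omega}=\prod_{i=1}^m\omega_i^{p/p_i}$.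
   Context: Cubes in $\mathbb R^n$ have sides parallel to the axes. $\vec\omega=(\omega_1,\dots,\omega_m)$ is a vector of weights (nonnegative functions on $\mathbb R^n$), $\vec f=(f_1,\dots,f_m)$ with each $f_i$ locally integrable on $\mathbb R^n$; $L^r(w)$ is taken with respect to $w\,dx$; $r'$ is the conjugate exponent of $r$, and $s>1$ has conjugate exponent $s'$ ($s'=1$ means $s=\infty$). $C_{n,m,\vec P,s}$ is a constant depending only on the indicated parameters. Rough kernel: $\Omega$ is homogeneous of degree zero in the sense that $\Omega(\lambda y_1,\dots,\lambda y_m)=\Omega(y_1,\dots,y_m)$ for all $\lambda>0$ and $y_1,\dots,y_m\in\mathbb R^n$; $\|\Omega\|_{L^s((S^{n-1})^m)}$ is its $L^s$ norm on the product of $m$ copies of the unit sphere $S^{n-1}$ of $\mathbb R^n$. Operator: $$\mathcal M_\Omega(\vec f)(x)=\sup_{Q\ni x}\frac1{|Q|^m}\int_{Q^m}|\Omega(x-y_1,\dots,x-y_m)|\prod_{i=1}^m|f_i(y_i)|\,d\vec y,$$ the supremum over all cubes $Q$ containing $x$. Class $A_{\vec R}$: for $\vec R=(r_1,\dots,r_m)$ with $1<r_i<\infty$, $\frac1r=\sum_i\frac1{r_i}$ and $\nu_{\vec\omega}=\prod_{i=1}^m\omega_i^{r/r_i}$, write $\vec\omega\in A_{\vec R}$ if $$[\vec\omega]_{A_{\vec R}}=\sup_Q\prod_{i=1}^m\Big(\frac1{|Q|}\int_Q\omega_i^{1-r_i'}\Big)^{r/r_i'}\Big(\frac1{|Q|}\int_Q\nu_{\vec\omega}\Big)<\infty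 .$$ (For $\vec R=\vec P/s'$ one has $r/r_i=p/p_i$, so $\nu_{\vec\omega}$ is the same weight.) $A_\infty$ constant: $[w]_{A_\infty}=\sup_Q\frac1{w(Q)}\int_Q M(w\chi_Q)\,dx$, with $M$ the Hardy–Littlewood maximal operator and $w(Q)=\int_Q w$.
   Formalization: For m ≥ 2, invariance of Ω under joint dilations alone makes the claim false; Ω is additionally assumed to depend only on the directions y_i/|y_i| (whenever all y_i ≠ 0), i.e. to be determined by its values on (S^{n-1})^m. Functions are taken Borel measurable. *)

(* Defs.v *)
From HB Require Import structures.
From mathcomp Require Import all_boot all_order all_algebra.
From mathcomp Require Import all_classical all_reals all_analysis.
From mathcomp Require Import measurable_realfun.

Set Implicit Arguments.
Unset Strict Implicit.
Unset Printing Implicit Defensive.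
Import Order.TTheory GRing.Theory Num.Theory numFieldNormedType.Exports.

Local Open Scope classical_set_scope.
Local Open Scope ring_scope.

Definition cons_pair (T : Type) (n : nat) (x : T * n.-tuple T) :
  n.+1.-tuple T := [tuple of x.1 :: x.2].

Section cons_measure.
Context d (T : measurableType d) (R : realType) (n : nat).
Variables (mu : {sigma_finite_measure set T -> \bar R})
  (nu : {sigma_finite_measure set (n.-tuple T) -> \bar R}).
Local Open Scope ereal_scope.

Lemma measurable_cons_pair : measurable_fun setT (@cons_pair T n).
Proof. by apply: measurable_cons; [exact: measurable_fst|exact: measurable_snd]. Qed.

Definition cons_measure : set (n.+1.-tuple T) -> \bar R :=
  pushforward (mu \x nu) (@cons_pair T n).

Let cm0 : cons_measure set0 = 0.
Proof. by rewrite /cons_measure /pushforward preimage_set0 measure0. Qed.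

Let cm_ge0 A : 0 <= cons_measure A.
Proof. by rewrite /cons_measure /pushforward measure_ge0. Qed.

Let cm_sigma_additive : semi_sigma_additive cons_measure.
Proof.
move=> F mF tF mUF; rewrite /cons_measure /pushforward preimage_bigcup.
have mc := measurable_cons_pair.
apply: measure_semi_sigma_additive.
- by move=> k; rewrite -[X in measurable X]setTI; exact: mc.
- apply/trivIsetP => /= i j _ _ ij; rewrite -preimage_setI.
  by move/trivIsetP : tF => /(_ _ _ _ _ ij) ->//; rewrite preimage_set0.
- by rewrite -preimage_bigcup -[X in measurable X]setTI; exact: mc.
Qed.

HB.instance Definition _ := isMeasure.Build _ _ _ cons_measure
  cm0 cm_ge0 cm_sigma_additive.

Let cm_sigma_finite : sigma_finite setT cons_measure.
Proof.
have /sigma_finiteP[F [FT ndF mF]] := sigma_finiteT mu.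
have /sigma_finiteP[G [GT ndG mG]] := sigma_finiteT nu.
pose H k : set (n.+1.-tuple T) :=
  [set t | F k (thead t) /\ G k (behead_tuple t)].
have HE k : @cons_pair T n @^-1` H k = F k `*` G k.
  apply/seteqP; split => -[x t]; rewrite /H/= theadE => -[Fx Gt]; split => //.
    by move: Gt; congr (G k _); exact: val_inj.
  by move: Gt; congr (G k _); exact: val_inj.
exists H.
  apply/seteqP; split => // t _.
  have : [set: T] (thead t) by [].
  rewrite FT => -[i _ Fi].
  have : [set: n.-tuple T] (behead_tuple t) by [].
  rewrite GT => -[j _ Gj].
  exists (maxn i j) => //; split.
    by have /subsetPset := ndF _ _ (leq_maxl i j); exact.
  by have /subsetPset := ndG _ _ (leq_maxr i j); exact.
move=> k; split.
  have -> : H k = (fun t => thead t) @^-1` F k `&`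
      (fun t : n.+1.-tuple T => [tuple of behead t]) @^-1` G k by [].
  apply: measurableI; rewrite -[X in measurable X]setTI.
    by apply: measurable_tnth => //; exact: (mF k).1.
  by apply: measurable_behead => //; exact: (mG k).1.
have [[mFk Fk] [mGk Gk]] := (mF k, mG k).
rewrite /cons_measure /pushforward HE product_measure1E//.
by rewrite lte_mul_pinfty// ge0_fin_numE.
Qed.

HB.instance Definition _ :=
  Measure_isSigmaFinite.Build _ _ _ cons_measure cm_sigma_finite.

End cons_measure.

Fixpoint tuple_measure d (T : measurableType d) (R : realType)
    (mu : {sigma_finite_measure set T -> \bar R}) (n : nat) :
    {sigma_finite_measure set (n.-tuple T) -> \bar R} :=
  match n with
  | 0 => \d_[tuple]
  | n'.+1 => cons_measure mu (tuple_measure mu n')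
  end.

Lemma measurable_box d (T : measurableType d) (n : nat) (A : 'I_n -> set T) :
  (forall i, measurable (A i)) ->
  measurable [set t : n.-tuple T | forall i, A i (tnth t i)].
Proof.
move=> mA; have -> : [set t : n.-tuple T | forall i, A i (tnth t i)] =
    \bigcap_(i in [set: 'I_n]) ((fun t => tnth t i) @^-1` A i).
  by apply/seteqP; split => t /= H i; [move=> _|]; exact: H.
apply: fin_bigcap_measurable => // i _.
by rewrite -[X in measurable X]setTI; exact: measurable_tnth.
Qed.

Lemma tuple_measure_box d (T : measurableType d) (R : realType)
    (mu : {sigma_finite_measure set T -> \bar R}) (n : nat)
    (A : 'I_n -> set T) : (forall i, measurable (A i)) ->
  tuple_measure mu n [set t | forall i, A i (tnth t i)] =
  (\prod_(i < n) mu (A i))%E.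
Proof.
elim: n A => [|n IH] A mA.
  rewrite big_ord0 /= (_ : [set _ | _] = setT) ?diracT//.
  by apply/seteqP; split => // t _ [].
rewrite big_ord_recl -IH//= /cons_measure /pushforward.
have -> : @cons_pair T n @^-1` [set t | forall i, A i (tnth t i)] =
    A ord0 `*` [set t | forall i, A (lift ord0 i) (tnth t i)].
  apply/seteqP; split => -[x t]; rewrite /cons_pair/=.
    by move=> H; split => [|i]; [exact: (H ord0)|have := H (lift ord0 i); rewrite tnthS].
  by move=> [A0 H] i; case: (unliftP ord0 i) => [j|] ->; rewrite ?tnthS.
by rewrite product_measure1E//; apply: (@measurable_box _ _ _ (fun i => A (lift ord0 i))).
Qed.

Notation Rn R n := (n.-tuple (measurableTypeR R)) (only parsing).

Definition lebesgue_Rn (R : realType) (n : nat) :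
    {sigma_finite_measure set (Rn R n) -> \bar R} :=
  tuple_measure lebesgue_measure n.

Section euclidean.
Context (R : realType) (n : nat).
Implicit Types (x y : Rn R n) (Q : set (Rn R n)).

Definition vsub x y : Rn R n := [tuple (tnth x i - tnth y i : R) | i < n].

Definition vscale (c : R) x : Rn R n := [tuple (c * tnth x i : R) | i < n].

Definition enorm x : R := Num.sqrt (\sum_(i < n) (tnth x i : R) ^+ 2).

Definition unit_sphere : set (Rn R n) := [set x | enorm x = 1].

(* The direction of the zero vector is the zero vector. *)
Definition direction x : Rn R n := vscale (enorm x)^-1 x.

Definition cube (a : Rn R n) (l : R) : set (Rn R n) :=
  [set y | forall i, tnth a i <= (tnth y i : R) <= tnth a i + l].

Definition cubes : set (set (Rn R n)) :=
  [set Q | exists a : Rn R n, exists2 l : R, 0 < l & Q = cube a l].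

Let side (a : Rn R n) (l : R) (i : 'I_n) : set (measurableTypeR R) :=
  `[(tnth a i : R), tnth a i + l]%classic.

Let cube_side (a : Rn R n) (l : R) :
  cube a l = [set t : Rn R n | forall i, side a l i (tnth t i)].
Proof.
by apply/seteqP; split => t H i; have := H i; rewrite /side/= in_itv.
Qed.

Lemma measurable_cube (a : Rn R n) (l : R) : measurable (cube a l).
Proof.
by rewrite cube_side; apply: measurable_box => i; exact: measurable_itv.
Qed.

Lemma lebesgue_cube (a : Rn R n) (l : R) : 0 < l ->
  lebesgue_Rn R n (cube a l) = (l ^+ n)%:E.
Proof.
move=> l0; rewrite cube_side /lebesgue_Rn.
rewrite (@tuple_measure_box _ _ R lebesgue_measure n (side a l)); last first.
  by move=> i; exact: measurable_itv.
rewrite (eq_bigr (fun=> l%:E)) => [|i _].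
  by rewrite prodEFin big_const_ord iter_mulr_1.
etransitivity; first exact: lebesgue_measure_itv.
by rewrite /= lte_fin ltrDl l0 -EFinB addrAC subrr add0r.
Qed.

Lemma measurable_enorm : measurable_fun setT enorm.
Proof.
have -> : enorm = (fun x => (\sum_(i < n) (tnth x i : R) ^+ 2) `^ 2^-1).
  by apply/funext => x; rewrite powR12_sqrt// sumr_ge0// => i _; rewrite sqr_ge0.
apply: (measurableT_comp (measurable_powR _)).
by apply: measurable_sum => i; apply: measurable_funX; exact: measurable_tnth.
Qed.

Lemma measurable_direction : measurable_fun setT direction.
Proof.
apply/measurable_fun_tnthP => i.
have -> : (@tnth _ _)^~ i \o direction =
    (fun x => (enorm x) `^ (-1) * (tnth x i : R)).
  by apply/funext => x /=; rewrite tnth_mktuple powR_inv1// sqrtr_ge0.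
apply: measurable_funM; last exact: measurable_tnth.
exact: (measurableT_comp (measurable_powR _) measurable_enorm).
Qed.

End euclidean.

Section sphere_measure.
Context (R : realType) (n : nat).
Local Open Scope ereal_scope.

Let B : set (Rn R n) := [set x | (0 < enorm x <= 1)%R].

(* By polar coordinates, the surface measure of a subset E of the sphere is
   n times the volume of the part of the cone over E inside the unit ball;
   here it is a measure on the whole space, carried by the sphere. *)
Definition sphere_measure (E : set (Rn R n)) : \bar R :=
  n%:R%:E *
  lebesgue_Rn R n [set x | (0 < enorm x <= 1)%R /\ E (direction x)].

Let mB : measurable B.
Proof.
have -> : B = @enorm R n @^-1` `]0%R, 1%R]%classic.
  by apply/seteqP; split => x /=; rewrite in_itv.
by rewrite -[X in measurable X]setTI; apply: measurable_enorm.
Qed.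

Let mE (E : set (Rn R n)) : measurable E ->
  measurable [set x | (0 < enorm x <= 1)%R /\ E (direction x)].
Proof.
move=> mE; have -> : [set x | (0 < enorm x <= 1)%R /\ E (direction x)] =
  B `&` @direction R n @^-1` E by [].
by apply: measurableI => //; rewrite -[X in measurable X]setTI;
  exact: measurable_direction.
Qed.

Let sm0 : sphere_measure set0 = 0.
Proof.
rewrite /sphere_measure (_ : [set _ | _] = set0) ?measure0 ?mule0//.
by apply/seteqP; split => // x [].
Qed.

Let sm_ge0 E : 0 <= sphere_measure E.
Proof. by rewrite mule_ge0// lee_fin. Qed.

Let sm_sigma_additive : semi_sigma_additive sphere_measure.
Proof.
move=> F mF tF mUF.
pose G k := [set x : Rn R n | (0 < enorm x <= 1)%R /\ F k (direction x)].
have GE : [set x : Rn R n | (0 < enorm x <= 1)%R /\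
    (\bigcup_k F k) (direction x)] = \bigcup_k G k.
  apply/seteqP; split => x /=.
    by move=> [Bx [k _ Fk]]; exists k.
  by move=> [k _ [Bx Fk]]; split => //; exists k.
have tG : trivIset setT G.
  apply/trivIsetP => i j _ _ ij; rewrite -subset0 => x [[_ Fi] [_ Fj]].
  have : (F i `&` F j) (direction x) by [].
  by move/trivIsetP : tF => ->.
have mG k : measurable (G k) by exact: mE.
rewrite [X in X @ \oo --> _](_ : _ =
    (fun k => n%:R%:E * \sum_(0 <= i < k) lebesgue_Rn R n (G i))); last first.
  by apply/funext => k; rewrite ge0_sume_distrr.
rewrite /sphere_measure GE; apply: cvgeZl => //.
by apply: measure_semi_sigma_additive => //; exact: bigcup_measurable.
Qed.

HB.instance Definition _ := isMeasure.Build _ _ _ sphere_measure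
  sm0 sm_ge0 sm_sigma_additive.

Let sm_fin : fin_num_fun sphere_measure.
Proof.
move=> E mEE; rewrite ge0_fin_numE// lte_mul_pinfty//.
apply: (@le_lt_trans _ _ (lebesgue_Rn R n (cube [tuple (-1)%R | i < n] 2))).
  apply: le_measure; rewrite ?inE; [exact: mE|exact: measurable_cube|].
  move=> x [/andP[_ x1] _] i; rewrite tnth_mktuple.
  have : (`|(tnth x i : R)| <= 1)%R.
    rewrite (le_trans _ x1)// -sqrtr_sqr ler_wsqrtr// (bigD1 i)//= lerDl.
    by rewrite sumr_ge0// => j _; rewrite sqr_ge0.
  by rewrite ler_norml => /andP[-> /le_trans->//]; rewrite (_ : -1 + 2 = 1 :> R)%R// addrC addrK.
by rewrite lebesgue_cube// ltry.
Qed.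

HB.instance Definition _ :=
  Measure_isFinite.Build _ _ _ sphere_measure sm_fin.

End sphere_measure.

(* w ^ a for a nonnegative real w, with 0 ^ a = +oo when a < 0
   (the library's powR has 0 `^ a = 0 there). *)
Definition wpow (R : realType) (w a : R) : \bar R :=
  if (w == 0) && (a < 0) then +oo%E else (w `^ a)%:E.

Definition conj_exponent (R : realType) (r : \bar R) : R :=
  fine (hoelder_conjugate r).

Definition sum_exponent (R : realType) (m : nat) (r : 'I_m -> R) : R :=
  (\sum_(i < m) (r i)^-1)^-1.

Section weights.
Context (R : realType) (n m : nat).
Local Notation mu := (lebesgue_Rn R n).
Local Open Scope ereal_scope.

Definition average (Q : set (Rn R n)) (g : Rn R n -> \bar R) : \bar R :=
  (mu Q)^-1 * \int[mu]_(x in Q) g x.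

Definition HL_maximal_cubes (g : Rn R n -> \bar R) (x : Rn R n) : \bar R :=
  ereal_sup [set average Q (fun y => `|g y|) |
    Q in [set Q | cubes Q /\ Q x]].

(* The weight is extended-valued because negative powers of weights are. *)
Definition Ainfty_const (w : Rn R n -> \bar R) : \bar R :=
  ereal_sup [set (\int[mu]_(x in Q) w x)^-1 *
      \int[mu]_(x in Q) HL_maximal_cubes (w \_ Q) x | Q in @cubes R n].

Definition nu_weight (r : 'I_m -> R) (w : 'I_m -> Rn R n -> R)
    (x : Rn R n) : R :=
  (\prod_(i < m) w i x `^ (sum_exponent r / r i))%R.

Definition dual_weight (r : R) (w : Rn R n -> R) (x : Rn R n) : \bar R :=
  wpow (w x) (1 - conj_exponent r%:E)%R.

Definition A_const (r : 'I_m -> R) (w : 'I_m -> Rn R n -> R) : \bar R :=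
  ereal_sup [set
    (\prod_(i < m) average Q (dual_weight (r i) (w i))
       `^ (sum_exponent r / conj_exponent (r i)%:E)%R) *
    average Q (fun x => (nu_weight r w x)%:E) | Q in @cubes R n].

Definition is_weight (w : Rn R n -> R) : Prop :=
  measurable_fun setT w /\ forall x, (0 <= w x)%R.

Definition A_class (r : 'I_m -> R) (w : 'I_m -> Rn R n -> R) : Prop :=
  A_const r w < +oo.

Definition weighted_norm (r : R) (w : Rn R n -> R) (g : Rn R n -> \bar R) :
    \bar R :=
  (\int[mu]_x (`|g x| `^ r * (w x)%:E)) `^ r^-1.

(* Every compact set is contained in a cube. *)
Definition locally_integrable_Rn (f : Rn R n -> R) : Prop :=
  measurable_fun setT f /\
  forall Q, cubes Q -> \int[mu]_(x in Q) `|(f x)%:E| < +oo.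

End weights.

Section rough_kernels.
Context (R : realType) (n m : nat).
Local Notation Rnm := (m.-tuple (Rn R n)).
Implicit Types (Omega : Rnm -> R) (y : Rnm).

Definition homogeneous_degree0 Omega : Prop :=
  forall (c : R) y, 0 < c -> Omega (map_tuple (vscale c) y) = Omega y.

(* An element of L^s((S^{n-1})^m) is a function on the product of spheres; it
   is evaluated at (y_1, ..., y_m) through the directions y_i / |y_i|. For
   m = 1 this follows from homogeneity of degree zero. For m > 1 invariance
   under joint dilations does not relate the values of Omega off the null set
   |y_1| = ... = |y_m| to its values on the product of spheres. *)
Definition function_of_directions Omega : Prop :=
  forall y, (forall i, enorm (tnth y i) != 0) ->
    Omega y = Omega (map_tuple (@direction R n) y).

Definition sphere_product : set Rnm :=
  [set y | forall i, unit_sphere (tnth y i)].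

Definition sphere_norm (s : \bar R) Omega : \bar R :=
  ('N[tuple_measure (@sphere_measure R n) m]_s
     [(EFin \o Omega) \_ sphere_product])%E.

Definition Ls_sphere (s : \bar R) Omega : Prop :=
  measurable_fun sphere_product Omega /\ (sphere_norm s Omega < +oo)%E.

Definition rough_maximal Omega (f : 'I_m -> Rn R n -> R) (x : Rn R n) :
    \bar R :=
  ereal_sup [set ((lebesgue_Rn R n Q ^+ m)^-1 *
      \int[tuple_measure (lebesgue_Rn R n) m]_(y in
          [set y : Rnm | forall i, Q (tnth y i)])
        (`|Omega (map_tuple (vsub x) y)| *
           \prod_(i < m) `|f i (tnth y i)|)%:E)%E |
    Q in [set Q | cubes Q /\ Q x]].

End rough_kernels.

(* Main.v *)
Require Import Defs.
From mathcomp Require Import all_boot all_order all_algebra.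
From mathcomp Require Import all_classical all_reals all_analysis.
From mathcomp Require Import measurable_realfun ess_sup_inf.
From mathcomp Require Import zify ring lra.
Set Implicit Arguments.
Unset Strict Implicit.
Unset Printing Implicit Defensive.
Import Order.TTheory GRing.Theory Num.Theory numFieldNormedType.Exports.
Local Open Scope classical_set_scope.
Local Open Scope ring_scope.

(** Hoelder's inequality with the exponents [s] and [s'] separates the kernel
    from the functions in an average of the rough operator. The directions of
    [x - y], for [y] in a cube of side [l] around [x], are controlled by polar
    coordinates: their image measure is at most a multiple of [l ^+ n] times the
    measure of the sphere. So the rough operator is at most a dimensional
    constant times the sphere norm of the kernel times
    [multilinear_maximal (`|f i| `^ s') `^ s'^-1] ([rough_maximal_le]). With
    [r i = P i / s'] the theorem becomes a weighted inequality for the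
    multilinear maximal function in the class of the exponents [r], in which the
    constant of the class enters to the power one and the Fujii-Wilson constants
    to the powers [rho / r i], where [rho = sum_exponent r = p / s']
    ([multilinear_maximal_bound]).

    Every cube lies in a comparable cube of one of [2 ^ n] shifted dyadic grids
    ([dyadic_cover]), so it suffices to bound dyadic maximal functions, and by
    monotone convergence those of finite lists of dyadic cubes
    ([finite_maximal_bound]). For a finite list the argument has four steps.

    - Pass to a stopping family for the geometric means of the averages of the
      functions ([stopping_family]). At least half of each of its cubes is
      outside the smaller ones, because a geometric mean of measures is
      superadditive ([stacked_half]). So the cubes are sparse, and the sum over
      them of the masses of a dual weight inside a given cube is at most twice
      the integral of the maximal function of that weight, which is what the
      Fujii-Wilson constant measures ([stacked_carleson], [stacked_weight_sum],
      [Ainfty_dominates]).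
    - The condition on the weights replaces Lebesgue averages of the functions
      by averages with respect to the dual weights.
    - The exponents [rho / r i] add up to one, so Hoelder's inequality for sums
      over the family splits the bound into one sum for each function
      ([hoelder_sum_prod]).
    - Each of these sums is a linear Carleson embedding. The cubes are grouped
      under a second stopping family, for the weighted averages; the Carleson
      property pays for each group ([stacked_average_sum]). What remains follows
      by duality, because the values of a stopping family grow geometrically
      along every chain of cubes ([stacked_embedding]).

    The quantities of the theorem may be zero or infinite. If the product weight
    has no mass on any cube, the left-hand side is zero. Otherwise finiteness of
    the constant of the class makes the dual weights locally integrable. Then a
    function of zero norm vanishes almost everywhere, which makes the operator
    zero, as does a kernel of zero norm. In the remaining case all factors on
    the right are positive, so an infinite one makes the right-hand side
    infinite. *)

(** * Powers, weighted means and Hoelder's inequality for sums *)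

Section real_powers.
Context {R : realType}.
Implicit Types (x y r : R).

Lemma le_powR x y r : 0 <= r -> 0 <= x -> x <= y -> x `^ r <= y `^ r.
Proof.
move=> r0 x0 xy; apply: ge0_ler_powR => //; rewrite nnegrE//.
exact: le_trans xy.
Qed.

Lemma le_poweR (x y : \bar R) r : 0 <= r -> (0 <= x)%E -> (x <= y)%E ->
  (x `^ r <= y `^ r)%E.
Proof.
move=> r0 x0 xy; apply: gt0_ler_poweR => //; rewrite in_itv/= leey andbT//.
exact: le_trans xy.
Qed.

Lemma powR_prod (I : Type) (l : seq I) (F : I -> R) r :
  (forall i, 0 <= F i) ->
  (\prod_(i <- l) F i) `^ r = \prod_(i <- l) F i `^ r.
Proof.
move=> F0; elim: l => [|a l IH]; first by rewrite !big_nil powR1.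
by rewrite !big_cons powRM// ?IH// prodr_ge0.
Qed.

Lemma powR_sum (I : Type) (l : seq I) (F : I -> R) x : 0 < x ->
  x `^ (\sum_(i <- l) F i) = \prod_(i <- l) x `^ F i.
Proof.
move=> x0; elim: l => [|a l IH]; first by rewrite !big_nil powRr0.
by rewrite !big_cons powRD ?IH// (gt_eqF x0) implybT.
Qed.

Lemma exprn_powR x r k : 0 <= x -> (x `^ r) ^+ k = (x ^+ k) `^ r.
Proof.
move=> x0; elim: k => [|k IH]; first by rewrite !expr0 powR1.
by rewrite !exprS IH powRM// exprn_ge0.
Qed.

Lemma powRK x r : 0 <= x -> r != 0 -> (x `^ r) `^ r^-1 = x.
Proof. by move=> x0 r0; rewrite -powRrM mulfV// powRr1. Qed.

Lemma powRVK x r : 0 <= x -> r != 0 -> (x `^ r^-1) `^ r = x.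
Proof. by move=> x0 r0; rewrite -powRrM mulVf// powRr1. Qed.

Lemma poweRK (x : \bar R) r : (0 <= x)%E -> r != 0 -> ((x `^ r) `^ r^-1 = x)%E.
Proof. by move=> x0 r0; rewrite -poweRrM mulfV// poweRe1. Qed.

Lemma poweRVK (x : \bar R) r : (0 <= x)%E -> r != 0 -> ((x `^ r^-1) `^ r = x)%E.
Proof. by move=> x0 r0; rewrite -poweRrM mulVf// poweRe1. Qed.

(** Each factor obeys the tangent-line bound [x `^ t <= expR (t * (x - 1))];
    the exponents then add up to the exponent of the arithmetic mean. *)
Lemma weighted_AM_GM (I : finType) (t x : I -> R) :
    (forall k, 0 <= t k) -> (forall k, 0 <= x k) -> \sum_k t k = 1 ->
  \prod_k x k `^ t k <= \sum_k t k * x k.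
Proof.
move=> t0 x0 t1; set A := \sum_k _.
have A0 : 0 <= A by apply: sumr_ge0 => k _; rewrite mulr_ge0.
have tangent (y : I -> R) : (forall k, 0 <= y k) ->
    \prod_k y k `^ t k <= expR (\sum_k t k * y k - 1).
  move=> y0; rewrite -[X in _ - X]t1 -sumrB expR_sum.
  apply: ler_prod => k _; rewrite powR_ge0/=.
  have -> : t k * y k - t k = (y k - 1) * t k by rewrite mulrBl mul1r mulrC.
  rewrite expRM le_powR//.
  by rewrite (le_trans _ (expR_ge1Dx _))// addrC subrK.
have [Ap|] := ltP 0 A; last first.
  (* The weighted mean vanishes: some weight is nonzero, and the corresponding
     factor of the product is zero. *)
  move=> /(conj A0)/andP/le_anti/esym A00.
  have tx k : t k * x k = 0.
    apply/eqP; move: A00; rewrite /A => /eqP.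
    rewrite psumr_eq0 => [/allP/(_ k (mem_index_enum k))/implyP/(_ isT)//|? _].
    by rewrite mulr_ge0.
  have [k tk] : exists k, t k != 0.
    apply/existsP; apply: contraTT (oner_neq0 R); rewrite negb_exists => /forallP h.
    by rewrite -t1 big1 ?eqxx// => k _; apply/eqP/negPn/h.
  rewrite (bigD1 k)//=; have /eqP := tx k.
  by rewrite mulf_eq0 (negPf tk)/= => /eqP ->; rewrite powR0// mul0r.
(* Normalised to have mean one, the family has tangent bound [expR 0]. *)
have := tangent (fun k => x k / A).
have -> : \sum_k t k * (x k / A) = 1.
  under eq_bigr do rewrite mulrA.
  by rewrite -mulr_suml mulfV ?gt_eqF.
rewrite subrr expR0 => /(_ (fun k => divr_ge0 (x0 k) A0)).
under eq_bigr do rewrite powRM// ?invr_ge0//.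
rewrite big_split/= -[X in _ * X]powR_sum ?invr_gt0// t1 powRr1 ?invr_ge0//.
by rewrite ler_pdivrMr// mul1r.
Qed.

(** After every sum is normalised to one, the inequality of weighted means
    applies term by term. *)
Lemma hoelder_sum_prod (J : Type) (I : finType) (l : seq J) (t : I -> R)
    (X : I -> J -> R) :
    (forall k, 0 < t k) -> \sum_k t k = 1 -> (forall k j, 0 <= X k j) ->
  \sum_(j <- l) \prod_k X k j `^ t k <= \prod_k (\sum_(j <- l) X k j) `^ t k.
Proof.
move=> t0 t1 X0; pose S k := \sum_(j <- l) X k j.
have S0 k : 0 <= S k by apply: sumr_ge0.
have key : \sum_(j <- l) \prod_k (X k j / S k) `^ t k <= 1.
  apply: (@le_trans _ _ (\sum_(j <- l) \sum_k t k * (X k j / S k))).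
    apply: ler_sum => j _; apply: weighted_AM_GM => // k; first exact: ltW.
    by rewrite divr_ge0.
  rewrite exchange_big/= -t1; apply: ler_sum => k _.
  rewrite -mulr_sumr -mulr_suml -/(S k).
  have [->|Sk] := eqVneq (S k) 0; first by rewrite mul0r mulr0 ltW.
  by rewrite mulfV// mulr1.
have [/existsP[k /eqP Sk]|] := boolP [exists k, S k == 0].
  rewrite (_ : \sum_(j <- l) _ = 0); first by rewrite prodr_ge0// => ? _; exact: powR_ge0.
  move: Sk; rewrite /S => Sk.
  elim: l Sk {S S0 key} => [|j l IH]; first by rewrite !big_nil.
  rewrite !big_cons => /eqP; rewrite paddr_eq0//; last exact: sumr_ge0.
  move=> /andP[/eqP Xkj /eqP Sk]; rewrite IH// addr0 (bigD1 k)//= Xkj.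
  by rewrite powR0 ?gt_eqF// mul0r.
rewrite negb_exists => /forallP Sn0.
rewrite -[leRHS]mul1r -ler_pdivrMr; last first.
  by rewrite prodr_gt0// => k _; rewrite powR_gt0// lt_neqAle eq_sym Sn0 S0.
apply: le_trans key; rewrite mulr_suml; apply: ler_sum => j _.
rewrite -prodf_div; apply: ler_prod => k _.
by rewrite divr_ge0 ?powR_ge0//= powRM ?invr_ge0// -powR_inv1// powRAC powR_inv1 ?powR_ge0.
Qed.

(** Hoelder's inequality for a sum of two terms. *)
Lemma geometric_mean_superadditive (I : finType) (t x y : I -> R) :
    (forall k, 0 < t k) -> \sum_k t k = 1 ->
    (forall k, 0 <= x k) -> (forall k, 0 <= y k) ->
  \prod_k x k `^ t k + \prod_k y k `^ t k <= \prod_k (x k + y k) `^ t k.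
Proof.
move=> t0 t1 x0 y0.
have := @hoelder_sum_prod bool _ [:: true; false] t
  (fun k b => if b then x k else y k) t0 t1.
rewrite !big_cons !big_nil !addr0.
under [leRHS]eq_bigr do rewrite !big_cons !big_nil !addr0.
by apply => k [].
Qed.

End real_powers.

Section extended_products.
Context {R : realType}.
Local Open Scope ereal_scope.

Lemma poweR_prod (I : Type) (l : seq I) (F : I -> \bar R) (r : R) :
  (forall i, 0 <= F i) ->
  (\prod_(i <- l) F i) `^ r = \prod_(i <- l) F i `^ r.
Proof.
move=> F0; elim: l => [|a l IH]; first by rewrite !big_nil poweR1r.
by rewrite !big_cons poweRM ?IH// prode_ge0.
Qed.

Lemma prode_gt0 (I : Type) (l : seq I) (F : I -> \bar R) :
  (forall i, 0 < F i) -> 0 < \prod_(i <- l) F i.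
Proof. by move=> F0; elim/big_ind: _ => // x y; exact: mule_gt0. Qed.

Lemma prode_infinite (I : finType) (k : I) (F : I -> \bar R) :
  (forall i, 0 < F i) -> F k = +oo -> \prod_i F i = +oo.
Proof.
move=> F0 Fk; rewrite (bigD1 k)//= Fk gt0_mulye//.
by elim/big_ind: _ => // x y; exact: mule_gt0.
Qed.

Lemma lee_prod (I : Type) (l : seq I) (F G : I -> \bar R) :
  (forall i, 0 <= F i <= G i) -> \prod_(i <- l) F i <= \prod_(i <- l) G i.
Proof.
move=> FG; suff : 0 <= \prod_(i <- l) F i <= \prod_(i <- l) G i by move=> /andP[].
elim/big_ind2: _ => [|x1 x2 y1 y2 /andP[? ?] /andP[? ?]|k _]; last exact: FG.
  by rewrite lee01 lexx.
by rewrite mule_ge0//= lee_pmul.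
Qed.

End extended_products.

(** * Stopping families *)

Section stopping_families.
Context {T : Type} {I : eqType} {R : realType}.
Variable Q : I -> set T.
Implicit Types (v : I -> R) (a : R) (l S : seq I).

(** Smaller sets come first, so that the nested and disjoint alternatives for
    a pair of sets are decided by its position in the list. *)
Definition laminar l :=
  pairwise (fun i j => `[< Q i `&` Q j = set0 \/ Q i `<=` Q j >]) l.

(** Unlike a laminar list, a stacked one has values that grow by a factor [a]
    along each chain, which makes sums along the chain geometric. *)
Definition stacked v a l := pairwise (fun i j =>
  `[< Q i `&` Q j = set0 \/ (Q i `<=` Q j /\ a * v j < v i) >]) l.

Lemma stacked_laminar v a l : stacked v a l -> laminar l.
Proof.
by apply: sub_pairwise => i j /asboolP[h|[h _]]; apply/asboolP; [left|right].
Qed.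

Lemma stackedP v a i l j : stacked v a (i :: l) -> j \in l ->
  Q i `&` Q j = set0 \/ (Q i `<=` Q j /\ a * v j < v i).
Proof. by rewrite /stacked/= => /andP[/allP h _] jl; apply/asboolP/h. Qed.

(** The list is scanned from the largest sets to the smallest ones, and a set
    is kept when no kept set containing it has a comparable value. *)
Lemma stopping_family v a l : 1 <= a -> (forall i, 0 <= v i) -> laminar l ->
  exists S, [/\ {subset S <= l}, stacked v a S &
    forall i, i \in l -> exists2 j, j \in S & Q i `<=` Q j /\ v i <= a * v j].
Proof.
move=> a1 v0; elim: l => [|i l IH]; first by move=> _; exists [::].
rewrite /laminar/= => /andP[/allP il /IH[S [Sl stS domS]]].
have [[j jS [ij vij]]|new] := pselect
    (exists2 j, j \in S & Q i `<=` Q j /\ v i <= a * v j).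
  exists S; split => //.
    by move=> k /Sl kl; rewrite inE kl orbT.
  by move=> k; rewrite inE => /predU1P[->|/domS//]; exists j.
exists (i :: S); split.
- by move=> k; rewrite !inE => /predU1P[->|/Sl ->]; rewrite ?eqxx ?orbT.
- rewrite /stacked/= [X in _ && X]stS andbT; apply/allP => j jS; apply/asboolP.
  have /asboolP[|ij] := il _ (Sl _ jS); [by left|right; split => //].
  by rewrite ltNge; apply/negP => h; apply: new; exists j.
- move=> k; rewrite inE => /predU1P[->|/domS[j jS h]].
    exists i; first by rewrite mem_head.
    by split => //; rewrite ler_peMl.
  by exists j; rewrite // inE jS orbT.
Qed.

(** Along the chain of stacked sets through a point the values grow at least
    geometrically, so a sum of positive powers is governed by its largest
    term; [2 `^ r / (2 `^ r - 1)] is the sum of the geometric series of ratio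
    [2 `^ (- r)]. *)
Lemma stacked_sum_powR v l (r : R) x : 0 < r -> (forall i, 0 <= v i) ->
    stacked v 2 l ->
  exists2 y, (y = 0 \/ exists2 i, i \in l & Q i x /\ y = v i) &
  \sum_(i <- l) \1_(Q i) x * v i `^ r <= (2 `^ r / (2 `^ r - 1)) * y `^ r.
Proof.
move=> r0 v0; set C := _ / _.
have r21 : 1 < 2 `^ r :> R.
  by have := @gt0_ltr_powR R r r0 1 2; rewrite powR1; apply; rewrite ?nnegrE// ltr1n.
have C0 : 0 <= C by rewrite divr_ge0 ?powR_ge0// subr_ge0 ltW.
have CE : 1 + C / 2 `^ r = C.
  have u : 2 `^ r - 1 != 0 by rewrite subr_eq0 gt_eqF.
  rewrite /C mulrAC mulfV ?mul1r; last by rewrite gt_eqF// (lt_trans _ r21).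
  by rewrite -{1}(mulfV u) -[X in _ + X]mul1r -mulrDl subrK.
elim: l => [|i l IH] st; first by exists 0; [left|rewrite big_nil mulr_ge0// powR_ge0].
have [|y yP yS] := IH; first by move: st; rewrite /stacked/= => /andP[].
have [Qix|nQix] := pselect (Q i x); last first.
  exists y; last by rewrite big_cons indicE memNset// mul0r add0r.
  by case: yP => [|[j jl h]]; [left|right; exists j; rewrite // inE jl orbT].
exists (v i); first by right; exists i; rewrite ?mem_head.
rewrite big_cons indicE mem_set// mul1r (le_trans (lerD (lexx _) yS))//.
rewrite -[in leRHS]CE mulrDl mul1r lerD2l -[leRHS]mulrA; apply: ler_wpM2l => //.
have vr : 2 `^ r > 0 :> R by rewrite (lt_trans _ r21).
rewrite ler_pdivlMl// -powRM//; last first.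
  by case: yP => [->//|[j _ [_ ->]]].
apply: le_powR; first exact: ltW.
  by case: yP => [->|[j _ [_ ->]]]; rewrite mulr_ge0.
case: yP => [->|[j jl [Qjx ->]]]; first by rewrite mulr0.
case: (stackedP st jl) => [dis|[_ /ltW//]].
by have : (Q i `&` Q j) x by []; rewrite dis.
Qed.

End stopping_families.

(** * Sparseness and the Carleson property *)

Section contents.
Context d {T : measurableType d} {R : realType}.

(** The counting of sparse families uses finite additivity only. Real values on
    the subsets of one set [W] keep infinite measures out of the estimates. *)
Definition content_on (W : set T) (V : set T -> R) :=
  (forall A, 0 <= V A) /\
  (forall A B, measurable A -> measurable B -> A `<=` W -> B `<=` W ->
     A `&` B = set0 -> V (A `|` B) = V A + V B).

Variable W : set T.

Lemma le_content V A B : content_on W V -> measurable A -> measurable B ->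
  A `<=` B -> B `<=` W -> V A <= V B.
Proof.
move=> [V0 VU] mA mB AB BW; rewrite -(setDUK AB) VU//; first by rewrite lerDl.
- exact: measurableD.
- exact: subset_trans BW.
- by apply: subset_trans BW => x [].
- by rewrite setDIK.
Qed.

Lemma content0 V : content_on W V -> V set0 = 0.
Proof.
move=> [_ /(_ set0 set0)]; rewrite setU0 setI0 => h.
have /eqP := h measurable0 measurable0 (sub0set _) (sub0set _) erefl.
by rewrite addrC -subr_eq subrr => /eqP.
Qed.

Context {I : choiceType}.
Variables (Q : I -> set T) (V : set T -> R).
Hypothesis mQ : forall i, measurable (Q i).
Hypothesis cV : content_on W V.
Hypothesis V0 : forall i, 0 < V (Q i).

Definition union_of (l : seq I) := \big[setU/set0]_(i <- l) Q i.

Lemma measurable_union_of l : measurable (union_of l).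
Proof. by apply: bigsetU_measurable. Qed.

Lemma union_of_cons i l : union_of (i :: l) = Q i `|` union_of l.
Proof. by rewrite /union_of big_cons. Qed.

Lemma union_of_sub l A : (forall i, i \in l -> Q i `<=` A) -> union_of l `<=` A.
Proof.
move=> h; rewrite /union_of big_seq_cond.
by elim/big_ind: _ => [//|B C AB AC x [/AB|/AC]//|i /andP[/h]].
Qed.

Lemma sub_union_of l i : i \in l -> Q i `<=` union_of l.
Proof.
elim: l => // j l IH; rewrite inE union_of_cons => /predU1P[->|/IH h] x Qx.
  by left.
by right; exact: h.
Qed.

Lemma head_disjoint_or_inside i l : laminar Q (i :: l) ->
  Q i `&` union_of l = set0 \/ Q i `<=` union_of l.
Proof.
elim: l => [|j l IH]; first by rewrite /union_of big_nil setI0; left.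
rewrite /laminar/= => /andP[/andP[/asboolP ij il] /andP[_ ll]].
have [|dis|sub] := IH; first by rewrite /laminar/= il.
- case: ij => [ij|ij]; last by right; apply: subset_trans ij _ => x; rewrite union_of_cons; left.
  by left; rewrite union_of_cons setIUr ij dis setU0.
- by right=> x /sub; rewrite union_of_cons; right.
Qed.

Context {K : finType}.
Variables (G : K -> set T -> R) (t : K -> R).
Hypothesis cG : forall k, content_on W (G k).
Hypothesis t0 : forall k, 0 < t k.
Hypothesis t1 : \sum_k t k = 1.

(** The geometric mean of the averages of the contents [G k], written with a
    single division because the weights [t k] add up to one. *)
Definition mean_density (i : I) := (\prod_k G k (Q i) `^ t k) / V (Q i).

(** Geometric means of contents are superadditive, so a lower bound on each
    set of a laminar list passes to their union; a set inside the union of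
    the later ones adds nothing. *)
Lemma union_of_lower_bound (c : R) l : laminar Q l ->
    (forall i, i \in l -> Q i `<=` W /\
       c * V (Q i) <= \prod_k G k (Q i) `^ t k) ->
  c * V (union_of l) <= \prod_k G k (union_of l) `^ t k.
Proof.
elim: l => [|i l IH] laml hl.
  rewrite /union_of big_nil content0// mulr0 prodr_ge0// => k _; exact: powR_ge0.
have mU := measurable_union_of l.
have UW : union_of l `<=` W.
  by apply: union_of_sub => j jl; apply: (hl _ _).1; rewrite inE jl orbT.
have {IH}IH : c * V (union_of l) <= \prod_k G k (union_of l) `^ t k.
  apply: IH => [|j jl]; first by move: laml; rewrite /laminar/= => /andP[].
  by apply: hl; rewrite inE jl orbT.
have [QiW ci] := hl i (mem_head _ _).
rewrite union_of_cons; have [dis|sub] := head_disjoint_or_inside laml; last first.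
  by rewrite (setUidPr _ _).2.
rewrite cV.2// mulrDr (le_trans (lerD ci IH))//.
under [leRHS]eq_bigr do rewrite (cG _).2//.
apply: geometric_mean_superadditive => // k; exact: (cG k).1.
Qed.

(** The sets of a stacked list that lie inside [Q j] have at least twice its
    density, so together they fill at most half of [Q j]. *)
Lemma stacked_half l j : stacked Q mean_density 2 (rcons l j) ->
    0 < mean_density j -> Q j `<=` W ->
  V (Q j `&` union_of l) <= V (Q j) / 2.
Proof.
move=> st pj QjW.
(* The sets of [l] that meet [Q j] are inside it; only these matter. *)
pose l' := [seq i <- l | `[< Q i `<=` Q j >]].
have inl' i : i \in l' -> Q i `<=` Q j by rewrite mem_filter => /andP[/asboolP].
have rel i : i \in l -> Q i `&` Q j = set0 \/
    Q i `<=` Q j /\ 2 * mean_density j < mean_density i.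
  by move: st; rewrite /stacked pairwise_rcons => /andP[/allP h _] /h/asboolP.
have U'Q : union_of l' `<=` Q j by exact: union_of_sub.
have sub : Q j `&` union_of l `<=` union_of l'.
  move=> x [Qjx]; rewrite /union_of -bigcup_seq => -[i /= il Qix].
  apply: (@sub_union_of _ i) => //; rewrite mem_filter il andbT; apply/asboolP.
  have [dis|[]//] := rel _ il.
  by have : (Q i `&` Q j) x by []; rewrite dis.
apply: (@le_trans _ _ (V (union_of l'))).
  apply: le_content => //.
  - by apply: measurableI => //; exact: measurable_union_of.
  - exact: measurable_union_of.
  - exact: subset_trans U'Q _.
have laml' : laminar Q l'.
  apply: pairwise_filter; move: st => /stacked_laminar.
  by rewrite /laminar pairwise_rcons => /andP[].
have empty_set0 i : i \in l' -> Q i `&` Q j = set0 -> False.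
  move=> il /(fun h => etrans (esym (setIidl (inl' _ il))) h) Qi0.
  by have := V0 i; rewrite Qi0 (content0 cV) ltxx.
have lower : 2 * mean_density j * V (union_of l') <=
    \prod_k G k (union_of l') `^ t k.
  apply: union_of_lower_bound => // i il; split.
    exact: subset_trans (inl' _ il) QjW.
  have [/(empty_set0 _ il)//|[_ /ltW]] : Q i `&` Q j = set0 \/
      Q i `<=` Q j /\ 2 * mean_density j < mean_density i.
    by apply: rel; move: il; rewrite mem_filter => /andP[].
  by rewrite {2}/mean_density ler_pdivlMr.
have upper : \prod_k G k (union_of l') `^ t k <= mean_density j * V (Q j).
  rewrite /mean_density -mulrA mulVf ?gt_eqF// mulr1; apply: ler_prod => k _.
  rewrite powR_ge0/= le_powR ?(ltW (t0 k))//; first exact: (cG k).1.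
  by apply: le_content (cG k) _ _ _ _ => //; exact: measurable_union_of.
(* Twice the density of [Q j] on the union is at most the density of [Q j] on
   all of [Q j]. *)
have := le_trans lower upper.
by rewrite (mulrC 2) -mulrA ler_pM2l// ler_pdivlMr// mulrC.
Qed.

(** The part of each set outside the smaller ones has at least half of its
    volume, and these parts are disjoint; so the masses [s i], spread evenly
    over these parts and doubled, are dominated by [F] without overlap. *)
Lemma stacked_carleson (s : I -> R) (F : set T -> R) l :
    content_on W F -> stacked Q mean_density 2 l ->
    (forall i, i \in l -> [/\ Q i `<=` W, 0 < mean_density i, 0 <= s i &
       forall A, measurable A -> A `<=` Q i ->
         V A * (s i / V (Q i)) <= F A]) ->
  \sum_(i <- l) s i <= 2 * F (union_of l).
Proof.
move=> cF; elim/last_ind: l => [|l j IH] st hl.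
  by rewrite /union_of !big_nil mulr_ge0//; exact: cF.1.
have [QjW pj sj Fj] : [/\ Q j `<=` W, 0 < mean_density j, 0 <= s j &
    forall A, measurable A -> A `<=` Q j -> V A * (s j / V (Q j)) <= F A].
  by apply: hl; rewrite mem_rcons mem_head.
have hl' i : i \in l -> i \in rcons l j by rewrite mem_rcons inE => ->; rewrite orbT.
have mU := measurable_union_of l.
have UW : union_of l `<=` W by apply: union_of_sub => i /hl' /hl[].
pose E := Q j `\` union_of l.
have mE : measurable E by exact: measurableD.
have EQ : E `<=` Q j by move=> x [].
have -> : union_of (rcons l j) = union_of l `|` E.
  by rewrite /union_of -cats1 big_cat big_seq1 -/(union_of l)/= /E setUDr setDv setD0.
rewrite cF.2//; [|exact: subset_trans QjW|exact: setDIK].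
rewrite mulrDr -cats1 big_cat big_seq1/= lerD//.
  apply: IH => [|i /hl'/hl//].
  by move: st; rewrite /stacked pairwise_rcons => /andP[].
have half := stacked_half st pj QjW.
have VE : V (Q j) = V (Q j `&` union_of l) + V E.
  rewrite -cV.2//; [by rewrite setUIDK| | | |].
  - exact: measurableI.
  - by move=> x [/QjW].
  - exact: subset_trans QjW.
  - by rewrite /E setDE setIACA setICr setI0.
have VE2 : V (Q j) <= 2 * V E by lra.
apply: (@le_trans _ _ (2 * (V E * (s j / V (Q j))))).
  rewrite (_ : 2 * _ = s j * ((2 * V E) / V (Q j))); last by ring.
  by rewrite ler_peMr// ler_pdivlMr// mul1r.
by rewrite ler_pM2l// Fj.
Qed.

End contents.

(** * Integrals and the Carleson embedding *)

Section weighted_embedding.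
Context d {T : measurableType d} {R : realType}.
Variable mu : {measure set T -> \bar R}.
Implicit Types (f g w : T -> R) (p q : R).

Lemma hoelder_integral f g p q :
    measurable_fun setT f -> measurable_fun setT g ->
    (forall x, 0 <= f x) -> (forall x, 0 <= g x) ->
    0 < p -> 0 < q -> p^-1 + q^-1 = 1 ->
  (\int[mu]_x (f x * g x)%:E <=
   (\int[mu]_x (f x `^ p)%:E) `^ p^-1 * (\int[mu]_x (g x `^ q)%:E) `^ q^-1)%E.
Proof.
move=> mf mg f0 g0 p0 q0 pq; have := hoelder mu mf mg p0 q0 pq.
rewrite Lnorm1 unlock /=.
under eq_integral do rewrite ger0_norm ?mulr_ge0//.
move=> /le_trans; apply; apply: lee_pmul; rewrite ?poweR_ge0//.
  by under eq_integral do rewrite ger0_norm//.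
by under eq_integral do rewrite ger0_norm//.
Qed.

(** Maximal functions are suprema over uncountably many cubes. They are only
    ever bounded from above, so the integral of a nonnegative function is
    handled as a supremum over the simple functions below it. *)
Lemma ge0_le_integral_any (D : set T) (f g : T -> \bar R) :
    (forall x, D x -> 0 <= f x)%E -> (forall x, D x -> f x <= g x)%E ->
  (\int[mu]_(x in D) f x <= \int[mu]_(x in D) g x)%E.
Proof.
move=> f0 fg; have g0 x : D x -> (0 <= g x)%E.
  by move=> Dx; exact: le_trans (f0 _ Dx) (fg _ Dx).
rewrite !ge0_integralE//; apply: le_ereal_sup => _ [h /= hf <-].
exists h => // x; apply: le_trans (hf x) _; rewrite /patch; case: ifPn => //.
by rewrite inE => /fg.
Qed.

(** The same reason as for [ge0_le_integral_any]: the integrand may be a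
    supremum that is not known to be measurable. *)
Lemma ge0_subset_integral_any (A B : set T) (f : T -> \bar R) :
  (forall x, 0 <= f x)%E -> A `<=` B ->
  (\int[mu]_(x in A) f x <= \int[mu]_(x in B) f x)%E.
Proof.
move=> f0 AB; rewrite integral_mkcond [leRHS]integral_mkcond.
apply: ge0_le_integral_any => x _; rewrite /patch; first by case: ifPn.
by case: ifPn => [|_]; [rewrite inE => /AB Bx; rewrite mem_set|case: ifPn].
Qed.

Context {I : eqType}.
Variable Q : I -> set T.
Hypothesis mQ : forall i, measurable (Q i).

Lemma integral_indic_sum f (a : I -> R) (l : seq I) :
    measurable_fun setT f -> (forall x, 0 <= f x) -> (forall i, 0 <= a i) ->
  (\int[mu]_x (f x * \sum_(i <- l) \1_(Q i) x * a i)%:E =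
   \sum_(i <- l) (a i)%:E * \int[mu]_(x in Q i) (f x)%:E)%E.
Proof.
move=> mf f0 a0.
under eq_integral do rewrite mulr_sumr -sumEFin.
rewrite ge0_integral_sum//; last 2 first.
- move=> i; apply/measurable_EFinP; apply: measurable_funM => //.
  by apply: measurable_funM => //; exact: measurable_indic.
- by move=> i x _; rewrite lee_fin !mulr_ge0.
apply: eq_bigr => i _; rewrite -ge0_integralZl//; last 3 first.
- by apply/measurable_EFinP; exact: measurable_funTS.
- by move=> x _; rewrite lee_fin.
- by rewrite lee_fin.
rewrite [RHS]integral_mkcond; apply: eq_integral => x _.
rewrite /patch indicE; case: ifPn => _; last by rewrite mul0r mulr0.
by rewrite mul1r mulrC.
Qed.

(** A power of the sum of the geometric series of ratio [2 `^ (1 - q)], as it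
    comes out of [stacked_sum_powR]. *)
Definition embedding_const (q : R) := (2 `^ (q - 1) / (2 `^ (q - 1) - 1)) `^ q.

(** The dyadic Carleson embedding for a family stacked by its averages with
    respect to [w `^ (1 - q')]. By duality the left-hand side [t] is the
    integral of [g] against the sum of the powers [v i `^ (q - 1)] over the
    sets containing a point; that sum is geometric, so the inequality of
    Hoelder bounds [t] by a multiple of [t `^ q'^-1], which is divided out. *)
Lemma stacked_embedding g w (q q' : R) (G S : I -> R) (l : seq I)
    (v := fun i => G i / S i) :
    1 < q -> 0 < q' -> q^-1 + q'^-1 = 1 ->
    measurable_fun setT g -> (forall x, 0 <= g x) ->
    measurable_fun setT w -> (forall x, 0 <= w x) ->
    {ae mu, forall x, w x != 0} ->
    (forall i, (\int[mu]_(x in Q i) (g x)%:E = (G i)%:E)%E) ->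
    (forall i, (\int[mu]_(x in Q i) (w x `^ (1 - q'))%:E = (S i)%:E)%E) ->
    (forall i, 0 < S i) ->
    stacked Q v 2 l ->
  ((\sum_(i <- l) v i `^ q * S i)%:E <=
   (embedding_const q)%:E *
     \int[mu]_x (g x `^ q * w x)%:E)%E.
Proof.
move=> q1 q'0 qq' mg g0 mw w0 wn0 GE SE S0 st; rewrite /embedding_const.
set C := _ / _.
have q0 : 0 < q by rewrite (lt_trans _ q1).
have qn0 : q != 0 by rewrite gt_eqF.
have q'n0 : q' != 0 by rewrite gt_eqF.
have q1q' : (q - 1) * q' = q.
  have : q * q' * (q^-1 + q'^-1) = q * q' by rewrite qq' mulr1.
  rewrite mulrDr mulrAC mulfV// mul1r -mulrA mulfV// mulr1 => h.
  by rewrite mulrBl mul1r -h addrC addKr.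
have C0 : 0 <= C.
  rewrite divr_ge0 ?powR_ge0// subr_ge0.
  by rewrite -[leLHS](powRr0 2) ler_powR ?ler1n// subr_ge0 ltW.
have G0 i : 0 <= G i by rewrite -lee_fin -GE integral_ge0// => x _; rewrite lee_fin.
have v0 i : 0 <= v i by rewrite /v divr_ge0// ltW.
pose t := \sum_(i <- l) v i `^ q * S i.
have t0 : 0 <= t by apply: sumr_ge0 => i _; rewrite mulr_ge0 ?powR_ge0// ltW.
pose Psi x := \sum_(i <- l) \1_(Q i) x * v i `^ (q - 1).
have Psi0 x : 0 <= Psi x by apply: sumr_ge0 => i _; rewrite mulr_ge0 ?powR_ge0.
have mPsi : measurable_fun setT Psi.
  apply: measurable_sum => i; apply: measurable_funM => //; exact: measurable_indic.
have tE : (t%:E = \int[mu]_x (g x * Psi x)%:E)%E.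
  rewrite integral_indic_sum//; last by move=> i; exact: powR_ge0.
  rewrite /t -sumEFin; apply: eq_bigr => i _; rewrite GE -EFinM.
  have -> : v i `^ q = v i `^ (q - 1) * v i.
    by rewrite -{3}[v i]powRr1// -powRD subrK// (negPf qn0).
  by rewrite -mulrA /v divfK// gt_eqF.
(* A geometric sum is comparable to its largest term, hence its power to the sum
   of the powers of the terms. *)
have PsiC x : Psi x `^ q' <= C `^ q' * \sum_(i <- l) \1_(Q i) x * v i `^ q.
  have q10 : 0 < q - 1 by rewrite subr_gt0.
  have [y yP le_y] := stacked_sum_powR x q10 v0 st.
  have y0 : 0 <= y by case: yP => [->|[i _ [_ ->]]].
  apply: (@le_trans _ _ ((C * y `^ (q - 1)) `^ q')); first by rewrite le_powR// ltW.
  rewrite powRM ?powR_ge0// -powRrM q1q'; apply: ler_wpM2l; first exact: powR_ge0.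
  have sum0 (r : seq I) : 0 <= \sum_(i <- r) \1_(Q i) x * v i `^ q.
    by apply: sumr_ge0 => i _; rewrite mulr_ge0 ?powR_ge0.
  case: yP => [->|[i il [Qix ->]]]; first by rewrite powR0.
  rewrite (perm_big _ (perm_to_rem il))/= big_cons indicE mem_set// mul1r.
  by rewrite lerDl.
have mwp a : measurable_fun setT (fun x => w x `^ a).
  exact: (measurableT_comp (measurable_powR _)).
(* The weight is distributed between the two factors; its powers cancel almost
   everywhere because [w] has no zeros there. *)
have HtE : (t%:E <= (\int[mu]_x (g x `^ q * w x)%:E) `^ q^-1 *
    ((C `^ q' * t)%:E) `^ q'^-1)%E.
  rewrite tE.
  apply: (@le_trans _ _ (\int[mu]_x
      (g x * w x `^ q^-1 * (Psi x * w x `^ (- q^-1)))%:E)%E).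
    apply: ae_ge0_le_integral => //.
    - by move=> x _; rewrite lee_fin mulr_ge0.
    - by apply/measurable_EFinP; exact: measurable_funM.
    - by move=> x _; rewrite lee_fin !mulr_ge0// powR_ge0.
    - apply/measurable_EFinP.
      by apply: measurable_funM; apply: measurable_funM => //; exact: mwp.
    apply: filterS wn0 => x wx _; rewrite lee_fin mulrACA -powRD ?subrr ?powRr0 ?mulr1//.
    by rewrite wx implybT.
  apply: le_trans (hoelder_integral _ _ _ _ q0 q'0 qq') _.
  - by apply: measurable_funM => //; exact: mwp.
  - by apply: measurable_funM => //; exact: mwp.
  - by move=> x; rewrite mulr_ge0// powR_ge0.
  - by move=> x; rewrite mulr_ge0// powR_ge0.
  apply: lee_pmul; rewrite ?poweR_ge0//.
    under eq_integral do rewrite powRM ?powR_ge0// powRVK//.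
    exact: lexx.
  apply: le_poweR; first by rewrite invr_ge0 ltW.
    by apply: integral_ge0 => x _; rewrite lee_fin powR_ge0.
  rewrite /t EFinM -sumEFin.
  have : (\sum_(i <- l) (v i `^ q * S i)%:E = \int[mu]_x
      (w x `^ (1 - q') * \sum_(i <- l) \1_(Q i) x * v i `^ q)%:E)%E.
    rewrite (integral_indic_sum _ (mwp (1 - q'))).
    - by apply: eq_bigr => i _; rewrite SE EFinM.
    - by move=> x; exact: powR_ge0.
    - by move=> i; exact: powR_ge0.
  move=> ->; rewrite -ge0_integralZl//; last 3 first.
  - apply/measurable_EFinP; apply: measurable_funM; first exact: mwp.
    by apply: measurable_sum => i; apply: measurable_funM => //; exact: measurable_indic.
  - move=> x _; rewrite lee_fin mulr_ge0 ?powR_ge0// sumr_ge0// => i _.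
    by rewrite mulr_ge0 ?powR_ge0.
  - by rewrite lee_fin powR_ge0.
  apply: ge0_le_integral_any => x _; first by rewrite lee_fin powR_ge0.
  rewrite -EFinM lee_fin powRM ?powR_ge0// -powRrM.
  rewrite (_ : - q^-1 * q' = 1 - q'); last first.
    rewrite (_ : q^-1 = 1 - q'^-1); last by rewrite -qq' addrK.
    by rewrite opprB mulrBl mulVf// mul1r.
  by rewrite mulrC [in leRHS]mulrCA; apply: ler_wpM2l; rewrite ?powR_ge0.
have [A|] := eqVneq (\int[mu]_x (g x `^ q * w x)%:E)%E +oo%E.
  rewrite A; have [C00|Cn0] := eqVneq C 0.
    move: HtE; rewrite C00 powR0// mul0r poweR0r ?invr_neq0// mule0 lee_fin => t00.
    by rewrite -/t powR0// mul0e lee_fin.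
  by rewrite gt0_muley ?leey// lte_fin powR_gt0// lt_neqAle eq_sym Cn0.
have A0 : (0 <= \int[mu]_x (g x `^ q * w x)%:E)%E.
  by apply: integral_ge0 => x _; rewrite lee_fin mulr_ge0// powR_ge0.
move: (\int[mu]_x _)%E A0 HtE => [A||]// A0 HtE _; rewrite lee_fin in A0.
rewrite -/t; move: HtE; rewrite !poweR_EFin -!EFinM !lee_fin => HtE.
have [->|tn0] := eqVneq t 0; first by rewrite mulr_ge0 ?powR_ge0.
have tp : 0 < t by rewrite lt_neqAle eq_sym tn0.
(* The two sides share the factor [t `^ q'^-1], finite and positive. *)
have {}HtE : t `^ q^-1 <= A `^ q^-1 * C.
  move: HtE; rewrite powRM ?powR_ge0// powRK// mulrA.
  rewrite -{1}[t](powRr1 t0) -qq' powRD ?tn0 ?implybT// ler_pM2r// powR_gt0//.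
have := le_powR (ltW q0) (powR_ge0 _ _) HtE.
by rewrite powRVK// powRM ?powR_ge0// powRVK// mulrC.
Qed.

End weighted_embedding.

Section scaling.
Import HBNNSimple.

(** Without measurability only the inequality is available: a simple function
    below [c%:E * f] is [c] times a simple function below [f]. *)
Lemma ge0_le_integralZl_any d (T : measurableType d) (R : realType)
    (mu : {measure set T -> \bar R}) (c : R) (f : T -> \bar R) :
  0 <= c -> (forall x, 0 <= f x)%E ->
  (\int[mu]_x (c%:E * f x) <= c%:E * \int[mu]_x f x)%E.
Proof.
move=> c0 f0; have [->|cn0] := eqVneq c 0.
  by rewrite mul0e integral0_eq// => x _; rewrite mul0e.
have cp : 0 < c by rewrite lt_neqAle eq_sym cn0.
rewrite [leLHS]ge0_integralTE => [|x]; last by rewrite mule_ge0.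
apply: ge_ereal_sup => _ [h /= hf <-].
have -> : sintegral mu h = (\int[mu]_x (h x)%:E)%E by rewrite integral_nnsfun// patch_setT.
rewrite muleC -lee_pdivrMr//.
pose k : T -> R := h.
have mh : measurable_fun setT (fun x => (k x)%:E) by exact/measurable_EFinP.
have h0 x : setT x -> (0 <= (h x)%:E)%E by rewrite lee_fin.
have cV0 : (0 <= c^-1%:E)%E by rewrite lee_fin invr_ge0.
rewrite -(ge0_integralZr mu measurableT mh h0 cV0).
apply: ge0_le_integral_any => x _; first by rewrite -EFinM lee_fin divr_ge0.
by rewrite lee_pdivrMr// muleC.
Qed.

End scaling.

Section content_instances.
Context d {T : measurableType d} {R : realType}.
Variable mu : {measure set T -> \bar R}.
Variable W : set T.
Hypothesis mW : measurable W.

Lemma content_measure : (mu W < +oo)%E -> content_on W (fun A => fine (mu A)).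
Proof.
move=> Wfin; split=> [A|A B mA mB AW BW AB]; first by rewrite fine_ge0.
have fin A' : measurable A' -> A' `<=` W -> mu A' \is a fin_num.
  move=> mA' A'W; rewrite ge0_fin_numE// (le_lt_trans _ Wfin)//.
  by apply: le_measure; rewrite ?inE.
by rewrite measureU// fineD ?fin.
Qed.

Lemma content_integral (f : T -> R) : measurable_fun setT f ->
    (forall x, 0 <= f x) -> (\int[mu]_(x in W) (f x)%:E < +oo)%E ->
  content_on W (fun A => fine (\int[mu]_(x in A) (f x)%:E)).
Proof.
move=> mf f0 Wfin.
have mf' A : measurable_fun A (EFin \o f).
  by apply/measurable_EFinP; exact: measurable_funTS.
have i0 A : (0 <= \int[mu]_(x in A) (f x)%:E)%E.
  by apply: integral_ge0 => x _; rewrite lee_fin.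
split=> [A|A B mA mB AW BW AB]; first by rewrite fine_ge0.
have fin A' : measurable A' -> A' `<=` W ->
    (\int[mu]_(x in A') (f x)%:E)%E \is a fin_num.
  move=> mA' A'W; rewrite ge0_fin_numE// (le_lt_trans _ Wfin)//.
  by apply: ge0_subset_integral => // x _; rewrite lee_fin.
rewrite ge0_integral_setU//; last 2 first.
- by move=> x _; rewrite lee_fin.
- exact/disj_set2P.
by rewrite fineD ?fin.
Qed.

End content_instances.

(** * Maximal functions of finite families of sets *)

Section finite_families.
Context d {T : measurableType d} {R : realType} {I : choiceType}.
Variable mu : {measure set T -> \bar R}.
Variable Q : I -> set T.
Hypothesis mQ : forall i, measurable (Q i).
Variable V : I -> R.
Hypothesis VE : forall i, (mu (Q i) = (V i)%:E)%E.
Hypothesis V0 : forall i, 0 < V i.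

Lemma measure_union_of_lty (l : seq I) : (mu (union_of Q l) < +oo)%E.
Proof.
elim: l => [|i l IH]; first by rewrite /union_of big_nil measure0.
rewrite union_of_cons.
apply: (le_lt_trans (measureU2 _ (mQ i) (measurable_union_of mQ l))).
have h : (mu (Q i) < +oo)%E by rewrite VE ltry.
exact: lte_add_pinfty.
Qed.

Lemma integral_union_of_lty (f : T -> R) (l : seq I) :
    measurable_fun setT f -> (forall x, 0 <= f x) ->
    (forall i, \int[mu]_(x in Q i) (f x)%:E < +oo)%E ->
  (\int[mu]_(x in union_of Q l) (f x)%:E < +oo)%E.
Proof.
move=> mf f0 fin; have mf' A : measurable_fun A (EFin \o f).
  by apply/measurable_EFinP; exact: measurable_funTS.
elim: l => [|i l IH]; first by rewrite /union_of big_nil integral_set0.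
have mU : measurable (union_of Q l) by exact: measurable_union_of.
rewrite union_of_cons -(setDUK (@subsetUl _ (Q i) (union_of Q l))).
set D := _ `\` _; have mD : measurable D.
  by apply: measurableD => //; exact: measurableU.
rewrite ge0_integral_setU//.
- apply: lte_add_pinfty => //; apply: le_lt_trans IH.
  apply: ge0_subset_integral => // [x _|x [[]//]]; by rewrite lee_fin.
- by move=> x _; rewrite lee_fin.
- by apply/disj_set2P; rewrite /D setDIK.
Qed.

(** The maximal function of a finite list of sets with values [a]; it is
    measurable and finite. *)
Definition list_max (l : seq I) (a : I -> R) (x : T) : R :=
  \big[Num.max/0]_(i <- l) (\1_(Q i) x * a i).

Lemma list_max_ge0 l a x : 0 <= list_max l a x.
Proof.
rewrite /list_max; elim: l => [|i l IH]; first by rewrite big_nil.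
by rewrite big_cons le_max IH orbT.
Qed.

Lemma le_list_max l a x i : i \in l -> Q i x -> a i <= list_max l a x.
Proof.
rewrite /list_max; elim: l => // j l IH; rewrite inE big_cons le_max => /predU1P[<-|il] Qix.
  by rewrite indicE mem_set// mul1r lexx.
by rewrite IH// orbT.
Qed.

Lemma list_max_le l a x c : 0 <= c ->
  (forall i, i \in l -> Q i x -> a i <= c) -> list_max l a x <= c.
Proof.
rewrite /list_max => c0; elim: l => [|j l IH] h; first by rewrite big_nil.
rewrite big_cons ge_max IH => [|i il]; last by apply: h; rewrite inE il orbT.
rewrite indicE andbT; have [Qjx|Qjx] := boolP (x \in Q j); last by rewrite mul0r.
by rewrite mul1r h ?mem_head//; rewrite inE in Qjx.
Qed.

Lemma measurable_list_max l a : measurable_fun setT (list_max l a).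
Proof.
rewrite /list_max; elim: l => [|i l IH].
  by under eq_fun do rewrite big_nil; exact: measurable_cst.
under eq_fun do rewrite big_cons.
by apply: measurable_maxr => //; apply: measurable_funM => //; exact: measurable_indic.
Qed.

Context {K : finType}.
Variables (g : K -> T -> R) (G : K -> I -> R).
Hypothesis mg : forall k, measurable_fun setT (g k).
Hypothesis g0 : forall k x, 0 <= g k x.
Hypothesis GE : forall k i, (\int[mu]_(x in Q i) (g k x)%:E = (G k i)%:E)%E.
Variable t : K -> R.
Hypothesis t0 : forall k, 0 < t k.
Hypothesis t1 : \sum_k t k = 1.

Definition density (i : I) := (\prod_k G k i `^ t k) / V i.

(** The Carleson property applies to the integral of the maximum [psi] of the
    averages [s i / V i] over the sets inside [Q j]. Unlike [H], which lies above
    it, [psi] is measurable and its integral is additive. *)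
Lemma stacked_weight_sum (s : I -> R) (l : seq I) (j : I) (H : T -> \bar R)
    (c : R) :
    stacked Q density 2 l -> (forall i, i \in l -> 0 < density i) ->
    (forall i, 0 <= s i) ->
    (forall x, 0 <= H x)%E ->
    (forall i x, i \in l -> Q i `<=` Q j -> Q i x -> ((s i / V i)%:E <= H x)%E) ->
    (\int[mu]_(x in Q j) H x <= c%:E)%E ->
  \sum_(i <- l | `[< Q i `<=` Q j >]) s i <= 2 * c.
Proof.
move=> st d0 s0 H0 sH Hc; rewrite -big_filter.
set l' := [seq i <- l | _].
have l'l i : i \in l' -> i \in l /\ Q i `<=` Q j.
  by rewrite mem_filter => /andP[/asboolP].
pose W := union_of Q l'.
have mW : measurable W by exact: measurable_union_of.
have WQj : W `<=` Q j by apply: union_of_sub => i /l'l[].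
pose a i := s i / V i.
have a0 i : 0 <= a i by rewrite divr_ge0// ltW.
pose psi := list_max l' a.
have mpsi : measurable_fun setT psi by exact: measurable_list_max.
have psi0 x : 0 <= psi x by exact: list_max_ge0.
have psiH x : Q j x -> ((psi x)%:E <= H x)%E.
  move=> Qjx; have [h|h] := pselect (exists2 i, i \in l' & Q i x); last first.
    rewrite (_ : psi x = 0) ?H0//; apply/le_anti; rewrite psi0 andbT.
    by apply: list_max_le => // i il Qix; case: h; exists i.
  move: h => [i il Qix].
  have [Hfin|] := boolP (H x \is a fin_num); last first.
    by rewrite ge0_fin_numE// -leNgt leye_eq => /eqP->; rewrite leey.
  rewrite -(fineK Hfin) lee_fin; apply: list_max_le; first by rewrite fine_ge0.
  move=> k kl Qkx; rewrite -lee_fin fineK//.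
  by have [? ?] := l'l _ kl; exact: sH.
have psic : (\int[mu]_(x in Q j) (psi x)%:E <= c%:E)%E.
  apply: le_trans Hc; apply: ge0_le_integral_any => x Qx; rewrite ?lee_fin//.
  exact: psiH.
have psiW : (\int[mu]_(x in W) (psi x)%:E <= c%:E)%E.
  apply: le_trans psic; apply: ge0_subset_integral => //.
    by apply/measurable_EFinP; exact: measurable_funTS.
  by move=> x _; rewrite lee_fin.
have psiWfin : (\int[mu]_(x in W) (psi x)%:E < +oo)%E by exact: le_lt_trans psiW (ltry _).
have cF := content_integral mW mpsi psi0 psiWfin.
have cV := content_measure mW (measure_union_of_lty l').
have cG k : content_on W (fun A => fine (\int[mu]_(x in A) (g k x)%:E)).
  apply: content_integral => //.
  by apply: integral_union_of_lty => // i; rewrite GE ltry.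
have densE i : mean_density Q (fun A => fine (mu A))
    (fun k A => fine (\int[mu]_(x in A) (g k x)%:E)) t i = density i.
  rewrite /mean_density /density VE; congr (_ / _).
  by apply: eq_bigr => k _; rewrite GE.
have st' : stacked Q (mean_density Q (fun A => fine (mu A))
    (fun k A => fine (\int[mu]_(x in A) (g k x)%:E)) t) 2 l'.
  rewrite (_ : mean_density _ _ _ _ = density); last exact/funext.
  exact: pairwise_filter.
have V0' i : 0 < fine (mu (Q i)) by rewrite VE; exact: V0.
apply: le_trans (stacked_carleson mQ cV V0' cG t0 t1 cF st' _) _.
  move=> i il; have [il0 iQj] := l'l _ il; split.
  - exact: sub_union_of.
  - by rewrite densE d0.
  - exact: s0.
  move=> A mA AQ; rewrite VE/= -/(a i) -lee_fin.
  have AW : A `<=` W by apply: subset_trans AQ (sub_union_of _).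
  rewrite fineK; last first.
    rewrite ge0_fin_numE ?integral_ge0//; last by move=> x _; rewrite lee_fin.
    apply: le_lt_trans psiWfin; apply: ge0_subset_integral => //.
      by apply/measurable_EFinP; exact: measurable_funTS.
    by move=> x _; rewrite lee_fin.
  rewrite mulrC EFinM fineK; last first.
    rewrite ge0_fin_numE// (@le_lt_trans _ _ (mu (Q i)))// ?VE ?ltry//.
    by rewrite -VE; apply: le_measure; rewrite ?inE.
  rewrite -integral_cst//; apply: ge0_le_integral_any => x Ax; rewrite lee_fin//.
  exact: le_list_max il (AQ _ Ax).
rewrite ler_pM2l// -lee_fin fineK//.
by rewrite ge0_fin_numE ?integral_ge0// => x _; rewrite lee_fin.
Qed.

(** The list is stacked by [density], while the embedding needs a list stacked
    by the weighted averages. So the sets are grouped under stopping sets of the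
    weighted averages: inside a group the averages are at most twice that of the
    top set and the weights add up by the Carleson property; the embedding
    applies to the top sets. *)
Lemma stacked_average_sum (k : K) (w : T -> R) (s : I -> R) (q q' B : R)
    (l : seq I) :
    1 < q -> 0 < q' -> q^-1 + q'^-1 = 1 ->
    measurable_fun setT w -> (forall x, 0 <= w x) ->
    {ae mu, forall x, w x != 0} ->
    (forall i, (\int[mu]_(x in Q i) (w x `^ (1 - q'))%:E = (s i)%:E)%E) ->
    (forall i, 0 < s i) ->
    stacked Q density 2 l -> (forall i, i \in l -> 0 < density i) ->
    0 <= B ->
    (forall j, exists H : T -> \bar R, [/\ (forall x, 0 <= H x)%E,
       (forall i x, Q i `<=` Q j -> Q i x -> (s i / V i)%:E <= H x)%E &
       (\int[mu]_(x in Q j) H x <= (B * s j)%:E)%E]) ->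
  ((\sum_(i <- l) (G k i / s i) `^ q * s i)%:E <=
   (2 `^ q * (2 * B) * embedding_const q)%:E *
     \int[mu]_x (g k x `^ q * w x)%:E)%E.
Proof.
move=> q1 q'0 qq' mw w0 wn0 sE s0 st d0 B0 carl.
have q0 : 0 < q by rewrite (lt_trans _ q1).
have G0 i : 0 <= G k i.
  by rewrite -lee_fin -GE integral_ge0// => x _; rewrite lee_fin.
pose v i := G k i / s i.
have v0 i : 0 <= v i by rewrite divr_ge0// ltW.
have [S [Sl stS domS]] := stopping_family (ler1n R 2) v0 (stacked_laminar st).
have emb := stacked_embedding mQ q1 q'0 qq' (mg k) (g0 k) mw w0 wn0 (GE k) sE s0 stS.
rewrite EFinM -muleA.
apply: le_trans (lee_wpmul2l _ emb); last first.
  by rewrite lee_fin mulr_ge0 ?powR_ge0// mulr_ge0.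
rewrite -EFinM lee_fin.
have group i : i \in l -> v i `^ q * s i <=
    \sum_(j <- S | `[< Q i `<=` Q j >]) 2 `^ q * v j `^ q * s i.
  move=> /domS[j jS [ij vij]].
  rewrite (perm_big _ (perm_to_rem jS))/= big_cons asboolT// -[leLHS]addr0.
  apply: lerD.
    by rewrite ler_pM2r// -powRM// le_powR// ltW.
  by apply: sumr_ge0 => h _; rewrite !mulr_ge0 ?powR_ge0// ltW.
apply: (@le_trans _ _ (\sum_(i <- l)
    \sum_(j <- S | `[< Q i `<=` Q j >]) 2 `^ q * v j `^ q * s i)).
  by rewrite big_seq [leRHS]big_seq; apply: ler_sum => i /group.
rewrite (exchange_big_dep xpredT)//= mulr_sumr; apply: ler_sum => j _.
rewrite -mulr_sumr -!mulrA; apply: ler_wpM2l; first exact: powR_ge0.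
rewrite [leRHS]mulrCA [X in _ <= _ * X]mulrCA.
rewrite [leRHS](_ : _ = v j `^ q * (2 * (B * s j))); last by rewrite /v; ring.
apply: ler_wpM2l; first exact: powR_ge0.
have [H [H0 sH Hc]] := carl j.
apply: stacked_weight_sum st d0 _ H0 _ Hc => [i|i x _]; [exact: ltW|exact: sH].
Qed.

End finite_families.

Section finite_maximal_bound.
Context d {T : measurableType d} {R : realType} {I : choiceType} {K : finType}.
Variable mu : {measure set T -> \bar R}.
Variable Q : I -> set T.
Hypothesis mQ : forall i, measurable (Q i).
Variable V : I -> R.
Hypothesis VE : forall i, (mu (Q i) = (V i)%:E)%E.
Hypothesis V0 : forall i, 0 < V i.
Hypothesis K0 : (0 < #|K|)%N.
Variables (g : K -> T -> R) (G : K -> I -> R).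
Hypothesis mg : forall k, measurable_fun setT (g k).
Hypothesis g0 : forall k x, 0 <= g k x.
Hypothesis GE : forall k i, (\int[mu]_(x in Q i) (g k x)%:E = (G k i)%:E)%E.

Let m := #|K|%:R : R.
Let t (k : K) : R := m^-1.

Let m0 : 0 < m. Proof. by rewrite ltr0n. Qed.

Let t0 k : 0 < t k. Proof. by rewrite invr_gt0. Qed.

Let t1 : \sum_k t k = 1.
Proof. by rewrite sumr_const -[LHS]mulr_natl mulfV ?gt_eqF. Qed.

Definition mean_product (i : I) := \prod_k (G k i / V i).

Let G0 k i : 0 <= G k i.
Proof. by rewrite -lee_fin -GE integral_ge0// => x _; rewrite lee_fin. Qed.

Let GV0 k i : 0 <= G k i / V i. Proof. by rewrite divr_ge0// ltW. Qed.

Let mean_product_ge0 i : 0 <= mean_product i.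
Proof. by rewrite prodr_ge0. Qed.

(* For equal weights the geometric mean of the averages is the [m]-th root of
   their product. *)
Let mean_productE i : mean_product i = density V G t i `^ m.
Proof.
rewrite /density /mean_product.
have VtE : (V i)^-1 = \prod_k ((V i)^-1 `^ t k).
  by rewrite -powR_sum ?invr_gt0// t1 powRr1// invr_ge0 ltW.
rewrite [X in _ = (_ * X) `^ _]VtE -big_split/=.
under [in RHS]eq_bigr do rewrite -powRM ?invr_ge0 ?(ltW (V0 i))//.
rewrite powR_prod => [|k]; last exact: powR_ge0.
by apply: eq_bigr => k _; rewrite powRVK ?GV0 ?gt_eqF.
Qed.

Variables (q q' B F : K -> R) (w : K -> T -> R) (s : K -> I -> R).
Hypothesis q1 : forall k, 1 < q k.
Hypothesis q'0 : forall k, 0 < q' k.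
Hypothesis qq' : forall k, (q k)^-1 + (q' k)^-1 = 1.
Hypothesis mw : forall k, measurable_fun setT (w k).
Hypothesis w0 : forall k x, 0 <= w k x.
Hypothesis wn0 : forall k, {ae mu, forall x, w k x != 0}.
Hypothesis sE : forall k i,
  (\int[mu]_(x in Q i) (w k x `^ (1 - q' k))%:E = (s k i)%:E)%E.
Hypothesis s0 : forall k i, 0 < s k i.
Hypothesis B0 : forall k, 0 <= B k.
Hypothesis carleson : forall k j, exists H : T -> \bar R,
  [/\ (forall x, 0 <= H x)%E,
    (forall i x, Q i `<=` Q j -> Q i x -> (s k i / V i)%:E <= H x)%E &
    (\int[mu]_(x in Q j) H x <= (B k * s k j)%:E)%E].
Hypothesis FE : forall k, (\int[mu]_x (g k x `^ q k * w k x)%:E = (F k)%:E)%E.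
Variables (r A : R) (nu : T -> R) (N : I -> R).
Hypothesis r0 : 0 < r.
Hypothesis rq : \sum_k r / q k = 1.
Hypothesis mnu : measurable_fun setT nu.
Hypothesis nu0 : forall x, 0 <= nu x.
Hypothesis NE : forall i, (\int[mu]_(x in Q i) (nu x)%:E = (N i)%:E)%E.
Hypothesis A0 : 0 <= A.
Hypothesis Abound : forall i,
  (\prod_k (s k i / V i) `^ (r / q' k)) * (N i / V i) <= A.

Let q0 k : 0 < q k. Proof. exact: lt_trans (q1 k). Qed.

Let N0 i : 0 <= N i.
Proof. by rewrite -lee_fin -NE integral_ge0// => x _; rewrite lee_fin. Qed.

(** The weight condition trades the Lebesgue averages for averages with respect
    to the dual weights [s k]: in [G / V = (G / s) * (s / V)] the power [r] of
    the last factor is split as [r / q + r / q'], the second part belonging to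
    the weight constant and the first to the measure of the set. *)
Let mean_product_weight i : mean_product i `^ r * N i <=
  A * \prod_k ((G k i / s k i) `^ q k * s k i) `^ (r / q k).
Proof.
have Vi := V0 i.
have sV k : 0 <= s k i / V i by rewrite divr_ge0// ltW.
have Gs k : 0 <= G k i / s k i by rewrite divr_ge0// ltW.
have -> : mean_product i `^ r * N i =
    \prod_k ((G k i / s k i) `^ r * (s k i / V i) `^ (r / q k)) * V i *
    ((\prod_k (s k i / V i) `^ (r / q' k)) * (N i / V i)).
  rewrite mulrACA mulrA [X in _ = X * _](_ : _ = mean_product i `^ r * V i); last first.
    congr (_ * _).
    rewrite -big_split/= powR_prod//; apply: eq_bigr => k _.
    rewrite -mulrA -powRD; last by rewrite (gt_eqF (divr_gt0 (s0 k i) Vi)) implybT.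
    rewrite -mulrDr qq' mulr1 -powRM//; congr (_ `^ _).
    by rewrite mulrA divfK// gt_eqF.
  by rewrite -mulrA; congr (_ * _); rewrite mulrCA mulfV ?mulr1// gt_eqF.
rewrite mulrC (_ : \prod_k _ * V i = \prod_k ((G k i / s k i) `^ q k * s k i) `^ (r / q k)).
  by apply: ler_wpM2r; rewrite ?prodr_ge0// => k _; exact: powR_ge0.
have {2}-> : V i = \prod_k V i `^ (r / q k) by rewrite -powR_sum// rq powRr1// ltW.
rewrite -big_split/=; apply: eq_bigr => k _.
have qn : q k != 0 by rewrite gt_eqF.
have -> : (G k i / s k i) `^ r = ((G k i / s k i) `^ q k) `^ (r / q k).
  by rewrite -powRrM (mulrC (q k)) divfK.
rewrite -mulrA -[X in _ * X]powRM ?sV ?(ltW Vi)// divfK ?gt_eqF//.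
by rewrite -powRM ?powR_ge0// ltW.
Qed.

(** The factor [2 `^ p] is the loss inside a group of [stacked_average_sum], and
    [2] is the loss by sparseness. *)
Definition average_sum_const (p : R) := 2 `^ p * 2 * embedding_const p.

(** The maximum over the list is at most a sum over the stopping sets of the
    geometric means. There the weight condition turns each term into a product
    of weighted averages, Hoelder's inequality separates the functions, and the
    Carleson embedding bounds the sum for each of them. *)
Lemma finite_maximal_bound (l : seq I) : laminar Q l ->
  (\int[mu]_x (list_max Q l (fun i => mean_product i `^ r) x * nu x)%:E <=
   (2 `^ (m * r) * A *
    \prod_k (average_sum_const (q k) * B k * F k) `^ (r / q k))%:E)%E.
Proof.
move=> laml; set L := fun i => mean_product i `^ r.
(* Sets on which some function vanishes do not contribute; the density has to
   be positive for the sparseness of the family. *)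
pose l' := [seq i <- l | 0 < mean_product i].
have dens0 i : 0 <= density V G t i.
  by rewrite divr_ge0 ?(ltW (V0 i))// prodr_ge0// => k _; exact: powR_ge0.
have [S [Sl stS domS]] := stopping_family (ler1n R 2) dens0
  (pairwise_filter (fun i => 0 < mean_product i) laml).
have dS i : i \in S -> 0 < density V G t i.
  move=> /Sl; rewrite mem_filter mean_productE => /andP[h _].
  rewrite lt_neqAle dens0 andbT; apply: contraTneq h => <-.
  by rewrite powR0 ?ltxx// gt_eqF.
pose a i := 2 `^ (m * r) * L i.
have L0 i : 0 <= L i by exact: powR_ge0.
have a0 i : 0 <= a i by rewrite mulr_ge0// powR_ge0.
have majorant x : list_max Q l L x <= \sum_(j <- S) \1_(Q j) x * a j.
  have sum0 (S' : seq I) : 0 <= \sum_(j <- S') \1_(Q j) x * a j.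
    by apply: sumr_ge0 => j _; rewrite mulr_ge0.
  apply: list_max_le => // i il Qix.
  have [i0|] := ltP 0 (mean_product i); last first.
    move=> i0; have i00 : mean_product i = 0 by apply/le_anti; rewrite i0 mean_product_ge0.
    by rewrite /L i00 powR0 ?gt_eqF.
  have [|j jS [ij dij]] := domS i; first by rewrite mem_filter i0.
  rewrite (perm_big _ (perm_to_rem jS))/= big_cons indicE mem_set ?mul1r; last exact: ij.
  have ij' : mean_product i <= 2 `^ m * mean_product j.
    by rewrite !mean_productE -powRM// le_powR// ltW.
  rewrite -[leLHS]addr0 lerD// /a /L.
  rewrite powRrM -(powRM _ (powR_ge0 _ _) (mean_product_ge0 j)).
  by apply: le_powR => //; exact: ltW.
apply: (@le_trans _ _ (\int[mu]_x (nu x * \sum_(j <- S) \1_(Q j) x * a j)%:E)%E).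
  apply: ge0_le_integral_any => x _; rewrite lee_fin ?mulr_ge0 ?list_max_ge0//.
  by rewrite mulrC ler_wpM2l.
rewrite integral_indic_sum//.
rewrite (eq_bigr (fun i => (a i * N i)%:E)) => [|i _]; last by rewrite NE.
rewrite sumEFin lee_fin.
have avg k : \sum_(i <- S) (G k i / s k i) `^ q k * s k i <=
    average_sum_const (q k) * B k * F k.
  have := stacked_average_sum mQ VE V0 mg g0 GE t0 t1 k (q1 k) (q'0 k) (qq' k)
    (mw k) (w0 k) (wn0 k) (sE k) (s0 k) stS dS (B0 k) (carleson k).
  rewrite FE -EFinM lee_fin => /le_trans; apply.
  by rewrite le_eqVlt; apply/orP; left; apply/eqP; rewrite /average_sum_const; ring.
have X0 k i : 0 <= (G k i / s k i) `^ q k * s k i by rewrite mulr_ge0 ?powR_ge0// ltW.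
apply: (@le_trans _ _ (\sum_(i <- S) 2 `^ (m * r) * A *
    \prod_k ((G k i / s k i) `^ q k * s k i) `^ (r / q k))).
  apply: ler_sum => i _; rewrite /a -!mulrA; apply: ler_wpM2l; first exact: powR_ge0.
  exact: mean_product_weight.
rewrite -mulr_sumr; apply: ler_wpM2l; first by rewrite mulr_ge0 ?powR_ge0.
have rq0 k : 0 < r / q k by exact: divr_gt0.
apply: le_trans (hoelder_sum_prod S rq0 rq X0) _.
apply: ler_prod => k _; rewrite powR_ge0/= le_powR ?(ltW (rq0 k))//.
by apply: sumr_ge0.
Qed.

End finite_maximal_bound.

(** * Shifted dyadic grids *)

Section dyadic_intervals.
Context {R : realType}.
Implicit Types (b : bool) (j k h : int) (a l z : R).

(** The grid of scale [k] is [2 ^ k] times the integers, possibly shifted by a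
    third of a step; the sign of the shift alternates with the scale because
    [2 / 3] and [- 1 / 3] differ by an integer, which keeps the grids nested. *)
Definition grid_offset b k : R := b%:R * ((-1 : int) ^ k)%:~R / 3.

Definition grid_point b k j : R := 2 ^ k * (j%:~R + grid_offset b k).

Lemma sign_exprzS k : (-1 : int) ^ (k + 1) = - (-1) ^ k.
Proof. by rewrite exprzDr ?unitrN1// expr1z mulrN1. Qed.

Lemma grid_pointS b k j : exists N : int, grid_point b (k + 1) j = grid_point b k N.
Proof.
exists (j * 2 - (b%:R * (-1) ^ k)).
rewrite /grid_point /grid_offset sign_exprzS expfzDr ?pnatr_eq0// expr1z -[LHS]mulrA.
congr (_ * _); rewrite !(intrB, intrM, intrN).
have -> : (b%:R : int)%:~R = b%:R :> R by case: b.
have -> : 2%:~R = 2 :> R by [].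
by field.
Qed.

Lemma grid_point_refine b h k j : h <= k ->
  exists N : int, grid_point b k j = grid_point b h N.
Proof.
move=> hk; have [d ->] : exists d : nat, k = h + d%:Z.
  by exists `|k - h|%N; lia.
elim: d j => [|d IH] j; first by exists j; rewrite addr0.
have [N ->] : exists N, grid_point b (h + d.+1%:Z) j = grid_point b (h + d%:Z) N.
  rewrite (_ : h + d.+1%:Z = h + d%:Z + 1); first exact: grid_pointS.
  by lia.
exact: IH.
Qed.

Lemma ltr_grid_point b k i j : (grid_point b k i < grid_point b k j) = (i < j).
Proof. by rewrite /grid_point ltr_pM2l ?exprz_gt0// ltrD2r ltr_int. Qed.

Lemma ler_grid_point b k i j : (grid_point b k i <= grid_point b k j) = (i <= j).
Proof. by rewrite /grid_point ler_pM2l ?exprz_gt0// lerD2r ler_int. Qed.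

Lemma grid_point_succ b k j : grid_point b k (j + 1) = grid_point b k j + 2 ^ k.
Proof. by rewrite /grid_point intrD/= -addrA (addrC 1) addrA mulrDr mulr1. Qed.

Definition grid_interval b k j z := grid_point b k j <= z < grid_point b k (j + 1).

Lemma grid_interval_nested b h k i j x z : h <= k ->
    grid_interval b h i x -> grid_interval b k j x -> grid_interval b h i z ->
  grid_interval b k j z.
Proof.
move=> hk; rewrite /grid_interval.
have [N ->] := grid_point_refine b j hk.
have [N' ->] := grid_point_refine b (j + 1) hk.
move=> /andP[ix xi] /andP[jx xj] /andP[iz zi]; apply/andP; split.
  apply: le_trans iz; rewrite ler_grid_point -ltzD1 -(ltr_grid_point b h).
  exact: le_lt_trans xi.
apply: lt_le_trans zi _; rewrite ler_grid_point lezD1 -(ltr_grid_point b h).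
exact: le_lt_trans xj.
Qed.

Lemma grid_interval_floor b k a : exists j, grid_interval b k j a.
Proof.
have k0 : 0 < (2 : R) ^ k by rewrite exprz_gt0.
exists (Num.floor ((2 ^ k)^-1 * a - grid_offset b k)).
rewrite /grid_interval /grid_point -ler_pdivlMl// -ltr_pdivrMl//.
by rewrite -lerBrDr -ltrBlDr floor_le/=; exact: floorD1_gt.
Qed.

(** Points of the two grids of scale [k] are at distance at least [2 ^ k / 3],
    so a shorter interval cannot contain one of each, and it avoids the endpoints
    of one of the grids. *)
Lemma grid_interval_cover k a l : 0 < l -> 3 * l < 2 ^ k ->
  exists b j, forall z, a <= z <= a + l -> grid_interval b k j z.
Proof.
move=> l0 lk; have k0 : 0 < (2 : R) ^ k by rewrite exprz_gt0.
have [i /andP[i1 i2]] := grid_interval_floor false k a.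
have [j /andP[j1 j2]] := grid_interval_floor true k a.
have [ai|ai] := ltP (a + l) (grid_point false k (i + 1)).
  exists false, i => z /andP[az zl]; rewrite /grid_interval (le_trans i1 az)/=.
  exact: le_lt_trans ai.
have [aj|aj] := ltP (a + l) (grid_point true k (j + 1)).
  exists true, j => z /andP[az zl]; rewrite /grid_interval (le_trans j1 az)/=.
  exact: le_lt_trans aj.
exfalso.
pose e : int := (-1) ^ k.
have eE : e = 1 \/ e = -1.
  rewrite /e; case: (k) => p.
    by rewrite -exprnP -signr_odd; case: odd; [right|left].
  by rewrite NegzE -exprnN -signr_odd; case: odd; [right|left].
have close : `|grid_point true k (j + 1) - grid_point false k (i + 1)| < 2 ^ k / 3.
  rewrite ltr_norml; apply/andP; split; lra.
move: close; rewrite /grid_point /grid_offset -/e mul0r mul0r addr0 mul1r -mulrBr.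
rewrite normrM (gtr0_norm k0) ltr_pM2l//.
(* In units of the step, three times the difference of the two grid points is an
   integer congruent to [1] or [- 1] modulo [3]; its absolute value cannot be
   less than one. *)
set u := _ - _; have uE : 3 * u = (3 * (j - i) + e)%:~R.
  by rewrite /u !(intrD, intrM, intrB); field.
rewrite -(ltr_pM2l (ltr0n R 3)) mulfV// -{1}(gtr0_norm (ltr0n R 3)).
rewrite -normrM uE -intr_norm -[X in _ < X]/(1%:~R) ltr_int; case: eE => ->; lia.
Qed.

Lemma dyadic_scale l : 0 < l -> exists k : int, 3 * l < 2 ^ k <= 6 * l.
Proof.
move=> l0; have l60 : 0 < 6 * l by rewrite mulr_gt0.
have ln20 : 0 < ln (2 : R) by rewrite ln_gt0// ltr1n.
have powE (k : int) : (2 : R) ^ k = expR (k%:~R * ln 2).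
  by rewrite -powR_intmul// /powR pnatr_eq0.
exists (Num.floor (ln (6 * l) / ln 2)); set k := Num.floor _; apply/andP; split.
  have : 6 * l < 2 ^ (k + 1).
    rewrite powE -ltr_ln ?posrE ?expR_gt0// expRK -ltr_pdivrMr//.
    exact: floorD1_gt.
  rewrite expfzDr ?pnatr_eq0// expr1z; move: (2 ^ k) => u.
  by clear; lra.
rewrite powE -ler_ln ?posrE ?expR_gt0// expRK -ler_pdivlMr//; exact: floor_le.
Qed.

End dyadic_intervals.

Section dyadic_cubes.
Context {R : realType} {n : nat}.
Local Notation mu := (lebesgue_Rn R n).
Implicit Types (t : n.-tuple bool) (c : int * n.-tuple int).

(** A dyadic cube is indexed by its scale and its position; [t] selects one of
    the two one-dimensional grids in every coordinate. *)
Definition dyadic_cube t c : set (Rn R n) :=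
  [set y | forall i, grid_interval (tnth t i) c.1 (tnth c.2 i) (tnth y i : R)].

Definition dyadic_corner t c : Rn R n :=
  [tuple (grid_point (tnth t i) c.1 (tnth c.2 i) : R) | i < n].

Definition dyadic_hull t c : set (Rn R n) := cube (dyadic_corner t c) (2 ^ c.1).

Lemma dyadic_hull_cubes t c : cubes (dyadic_hull t c).
Proof. by exists (dyadic_corner t c); exists (2 ^ c.1) => //; rewrite exprz_gt0. Qed.

Lemma dyadic_cube_hull t c : dyadic_cube t c `<=` dyadic_hull t c.
Proof.
move=> y Qy i; rewrite tnth_mktuple.
by have /andP[-> /ltW] := Qy i; rewrite grid_point_succ.
Qed.

Let side t c (i : 'I_n) : set (measurableTypeR R) :=
  `[grid_point (tnth t i) c.1 (tnth c.2 i), grid_point (tnth t i) c.1 (tnth c.2 i + 1)[%classic.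

Let dyadic_cubeE t c : dyadic_cube t c = [set y | forall i, side t c i (tnth y i)].
Proof.
by apply/seteqP; split => y H i; have := H i; rewrite /side/= in_itv.
Qed.

Lemma measurable_dyadic_cube t c : measurable (dyadic_cube t c).
Proof. by rewrite dyadic_cubeE; apply: measurable_box => i; exact: measurable_itv. Qed.

Lemma lebesgue_dyadic_cube t c : mu (dyadic_cube t c) = (((2 : R) ^ c.1) ^+ n)%:E.
Proof.
rewrite dyadic_cubeE /lebesgue_Rn.
rewrite (@tuple_measure_box _ _ R lebesgue_measure n (side t c)); last first.
  by move=> i; exact: measurable_itv.
rewrite (eq_bigr (fun=> (2 ^ c.1)%:E)) => [|i _].
  by rewrite prodEFin big_const_ord iter_mulr_1.
etransitivity; first exact: lebesgue_measure_itv.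
rewrite /= lte_fin grid_point_succ ltrDl exprz_gt0//.
by rewrite -EFinB addrAC subrr add0r.
Qed.

(** Half-open cubes make the grids nested, while the constants of the weights
    are suprema over closed cubes; the boundary that separates them is null. *)
Lemma dyadic_hull_null t c : mu (dyadic_hull t c `\` dyadic_cube t c) = 0%E.
Proof.
have k0 : 0 < (2 : R) ^ c.1 by rewrite exprz_gt0.
have mH := @measurable_cube R n (dyadic_corner t c) (2 ^ c.1).
have VH := @lebesgue_cube R n (dyadic_corner t c) (2 ^ c.1) k0.
have VHfin : (mu (dyadic_hull t c) < +oo)%E by rewrite VH ltry.
have mD := measurable_dyadic_cube t c.
have -> : (mu (dyadic_hull t c `\` dyadic_cube t c) =
    mu (dyadic_hull t c) - mu (dyadic_hull t c `&` dyadic_cube t c))%E.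
  exact: measureD.
rewrite setIidr; last exact: dyadic_cube_hull.
by rewrite VH lebesgue_dyadic_cube subee.
Qed.

Lemma dyadic_laminar t (l : seq (int * n.-tuple int)) :
  sorted (fun c c' => c.1 <= c'.1) l -> laminar (dyadic_cube t) l.
Proof.
rewrite sorted_pairwise => [|a b c]; last exact: le_trans.
apply: sub_pairwise => c c' cc'; apply/asboolP.
have [[x [cx c'x]]|disj] := pselect (exists x, dyadic_cube t c x /\ dyadic_cube t c' x).
  right=> z cz i; exact: grid_interval_nested cc' (cx i) (c'x i) (cz i).
by left; apply/seteqP; split => // x [cx c'x]; case: disj; exists x.
Qed.

(** Sorting an initial segment of an enumeration by size makes it laminar. *)
Definition dyadic_list (N : nat) : seq (int * n.-tuple int) :=
  sort (fun c c' => c.1 <= c'.1) (pmap unpickle (iota 0 N)).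

Lemma dyadic_list_laminar t N : laminar (dyadic_cube t) (dyadic_list N).
Proof. by apply: dyadic_laminar; apply: sort_sorted => c c'; exact: le_total. Qed.

Lemma mem_dyadic_list c N : (pickle c < N)%N -> c \in dyadic_list N.
Proof.
move=> cN; rewrite mem_sort mem_pmap; apply/mapP; exists (pickle c).
  by rewrite mem_iota.
by rewrite pickleK.
Qed.

Lemma dyadic_list_sub N N' : (N <= N')%N -> {subset dyadic_list N <= dyadic_list N'}.
Proof.
move=> NN' c; rewrite !mem_sort !mem_pmap => /mapP[k kN ->].
apply/mapP; exists k => //; move: kN; rewrite !mem_iota/= !add0n => kN.
exact: leq_trans NN'.
Qed.

(** The side of the cube fixes the scale, and each coordinate chooses its own
    grid. *)
Lemma dyadic_cover (a : Rn R n) (l : R) : 0 < l ->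
  exists t c, cube a l `<=` dyadic_cube t c /\ (2 : R) ^ c.1 <= 6 * l.
Proof.
move=> l0; have [k /andP[k1 k2]] := dyadic_scale l0.
have cov (i : 'I_n) : exists bj : bool * int, forall z : R,
    (tnth a i : R) <= z <= (tnth a i : R) + l -> grid_interval bj.1 k bj.2 z.
  by have [b [j h]] := grid_interval_cover (tnth a i : R) l0 k1; exists (b, j).
have [f hf] := fin_all_exists cov.
exists [tuple (f i).1 | i < n], (k, [tuple (f i).2 | i < n]); split => //.
by move=> y ay i /=; rewrite !tnth_mktuple; apply: hf; exact: ay.
Qed.

End dyadic_cubes.

(** * Integrals over tuples *)

Section tuple_integrals.
Context d {T : measurableType d} {R : realType}.
Local Open Scope ereal_scope.

Definition tuple_box n (A : set T) : set (n.-tuple T) :=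
  [set y | forall i, A (tnth y i)].
Arguments tuple_box : clear implicits.

Lemma measurable_tuple_box n A : measurable A -> measurable (tuple_box n A).
Proof. by move=> mA; apply: (@measurable_box _ _ _ (fun=> A)). Qed.

Lemma tuple_box_cons n A (x : T) (y : n.-tuple T) :
  tuple_box n.+1 A (cons_pair (x, y)) <-> A x /\ tuple_box n A y.
Proof.
rewrite /tuple_box /cons_pair/=; split => [h|[Ax Ay] i].
  split; first exact: (h ord0).
  by move=> i; have := h (lift ord0 i); rewrite tnthS.
by case: (unliftP ord0 i) => [j|] ->; rewrite ?tnthS ?tnth0.
Qed.

Variable mu : {sigma_finite_measure set T -> \bar R}.

Lemma measurable_section n (F : n.+1.-tuple T -> \bar R) :
  measurable_fun setT F -> (forall y, 0 <= F y) ->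
  measurable_fun setT (fun x => \int[tuple_measure mu n]_u F (cons_pair (x, u))).
Proof.
move=> mF F0; apply: (@measurable_fun_fubini_tonelli_F _ _ _ _ _ _
  (fun z => F (cons_pair z))) => //.
by apply: measurableT_comp => //; exact: measurable_cons_pair.
Qed.

(** Tuples carry the image of a product measure under the adjunction of a first
    coordinate, so Tonelli's theorem splits that coordinate off. *)
Lemma integral_tupleS n (F : n.+1.-tuple T -> \bar R) :
  measurable_fun setT F -> (forall y, 0 <= F y) ->
  \int[tuple_measure mu n.+1]_y F y =
  \int[mu]_x \int[tuple_measure mu n]_u F (cons_pair (x, u)).
Proof.
move=> mF F0.
rewrite [LHS](ge0_integral_pushforward (@measurable_cons_pair _ T n))//.
rewrite preimage_setT fubini_tonelli1// => [|z]; last exact: F0.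
by apply: measurableT_comp => //; exact: measurable_cons_pair.
Qed.

Lemma integral_tuple_boxS n (A : set T) (F : n.+1.-tuple T -> \bar R) :
  measurable A -> measurable_fun setT F -> (forall y, 0 <= F y) ->
  \int[tuple_measure mu n.+1]_(y in tuple_box n.+1 A) F y =
  \int[mu]_(x in A) \int[tuple_measure mu n]_(u in tuple_box n A) F (cons_pair (x, u)).
Proof.
move=> mA mF F0; rewrite integral_mkcond integral_tupleS; last 2 first.
- apply/(measurable_restrictT _ _).1; first exact: measurable_tuple_box.
  exact: measurable_funTS.
- by move=> y; rewrite /patch; case: ifPn.
rewrite [RHS]integral_mkcond; apply: eq_integral => x _.
rewrite /patch; case: ifPn => xA.
  rewrite [RHS]integral_mkcond; apply: eq_integral => u _; rewrite /patch.
  congr (if _ then _ else _); apply/idP/idP; rewrite !inE.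
    by move/tuple_box_cons => [].
  by move=> h; apply/tuple_box_cons; split => //; rewrite inE in xA.
apply: integral0_eq => u _; case: ifPn => //; rewrite inE => /tuple_box_cons[Ax _].
by case/negP: xA; rewrite inE.
Qed.

Lemma measurable_prod_coordinates m (f : 'I_m -> T -> R) :
  (forall i, measurable_fun setT (f i)) ->
  measurable_fun setT (fun y : m.-tuple T => \prod_(i < m) f i (tnth y i))%R.
Proof.
move=> mf; apply: measurable_prod => i _.
by apply: (measurableT_comp (mf i)); exact: measurable_tnth.
Qed.

Lemma integral_prod_coordinates m (A : set T) (f : 'I_m -> T -> R) :
  measurable A -> (forall i, measurable_fun setT (f i)) ->
  (forall i x, (0 <= f i x)%R) ->
  \int[tuple_measure mu m]_(y in tuple_box m A) (\prod_(i < m) f i (tnth y i))%:E =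
  \prod_(i < m) \int[mu]_(x in A) (f i x)%:E.
Proof.
elim: m f => [|m IH] f mA mf f0.
  rewrite big_ord0 (eq_integral (cst 1)) => [|y _]; last by rewrite big_ord0.
  rewrite integral_cst; last exact: measurable_tuple_box.
  by rewrite mul1e /= diracE mem_set// => -[].
rewrite integral_tuple_boxS//; last 2 first.
- apply/measurable_EFinP; exact: (measurable_prod_coordinates mf).
- by move=> y; rewrite lee_fin prodr_ge0.
rewrite big_ord_recl -(IH (fun i => f (lift ord0 i)))//.
have mf0 : measurable_fun setT (fun y : m.-tuple T =>
    (\prod_(i < m) f (lift ord0 i) (tnth y i))%:E).
  apply/measurable_EFinP.
  exact: (measurable_prod_coordinates (fun i => mf (lift ord0 i))).
have pos y : (0 <= \prod_(i < m) f (lift ord0 i) (tnth y i))%R by rewrite prodr_ge0.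
rewrite -ge0_integralZr//; last 3 first.
- by apply/measurable_EFinP; exact: measurable_funTS.
- by move=> x _; rewrite lee_fin.
- by apply: integral_ge0 => y _; rewrite lee_fin.
apply: eq_integral => x _; rewrite -ge0_integralZl//; last 4 first.
- exact: measurable_tuple_box.
- exact: measurable_funTS.
- by move=> y _; rewrite lee_fin.
- by rewrite lee_fin.
apply: eq_integral => u _; rewrite big_ord_recl EFinM/=.
congr (_%:E * _%:E).
by apply: eq_bigr => i _; rewrite tnthS.
Qed.

(** This discards the tuples having a coordinate at which a kernel is not
    determined by its values on spheres. *)
Lemma tuple_measure_null m (A : set T) (i : 'I_m) : measurable A -> mu A = 0 ->
  tuple_measure mu m [set y | A (tnth y i)] = 0.
Proof.
move=> mA A0; pose B (j : 'I_m) := if j == i then A else setT.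
have -> : [set y : m.-tuple T | A (tnth y i)] = [set y | forall j, B j (tnth y j)].
  apply/seteqP; split => y; rewrite /B/= => h; last by have := h i; rewrite eqxx.
  by move=> j; case: eqP => [->|].
rewrite tuple_measure_box; last by move=> j; rewrite /B; case: ifP.
by rewrite (bigD1 i)//= /B eqxx A0 mul0e.
Qed.

End tuple_integrals.
Arguments tuple_box {d T} n A _.

(** * Affine changes of variables *)

Section affine_change.
Context {R : realType}.
Local Open Scope ereal_scope.

Lemma measurable_affine (a rho : R) : measurable_fun setT
  ((fun z => (a - rho * z)%R) : measurableTypeR R -> measurableTypeR R).
Proof. by apply: measurable_funB => //; exact: measurable_funM. Qed.

Lemma lebesgue_integral_affine (a rho : R) (phi : measurableTypeR R -> \bar R) :
  (0 < rho)%R -> measurable_fun setT phi -> (forall y, 0 <= phi y) ->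
  \int[lebesgue_measure]_y phi y =
  rho%:E * \int[lebesgue_measure]_z phi (a - rho * z)%R.
Proof.
move=> rho0 mphi phi0.
pose h (z : measurableTypeR R) : measurableTypeR R := (a - rho * z)%R.
have mh : measurable_fun setT h by exact: measurable_affine.
pose P : {measure set (measurableTypeR R) -> \bar R} :=
  measure_function_pushforward__canonical__measure_function_Measure
    lebesgue_measure mh.
pose c : {nonneg R} := NngNum (ltW rho0).
(* The scaled image measure has the right values on intervals. *)
have mE A : measurable A -> lebesgue_measure A = mscale c P A.
  move=> mA; apply: (lebesgue_measure_unique (mu := mscale c P)) mA => _ [[x y] _ <-]/=.
  rewrite /mscale/= /pushforward.
  have -> : h @^-1` `]x, y]%classic = `[((a - y) / rho)%R, ((a - x) / rho)%R[%classic.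
    apply/seteqP; split => z /=; rewrite !in_itv/= /h ler_pdivrMr// ltr_pdivlMr//
      ![(z * rho)%R]mulrC => /andP[z1 z2]; apply/andP; split; lra.
  rewrite !lebesgue_measure_itv/= !lte_fin ltr_pM2r ?invr_gt0// ltrD2l ltrN2.
  case: ifPn => _; last by rewrite mule0.
  by rewrite -!EFinB -EFinM; congr _%:E; field; rewrite gt_eqF.
rewrite (eq_measure_integral (mscale c P)); last by move=> A mA _; exact: mE.
rewrite ge0_integral_mscale//; congr (_ * _).
by rewrite [LHS](ge0_integral_pushforward mh) ?preimage_setT.
Qed.

Lemma measurable_vaffine m (x : Rn R m) (rho : R) :
  measurable_fun setT (fun z : Rn R m => vsub x (vscale rho z)).
Proof.
apply/measurable_fun_tnthP => i.
have -> : (@tnth _ _)^~ i \o (fun z : Rn R m => vsub x (vscale rho z)) =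
    (fun z => (tnth x i : R) - rho * (tnth z i : R))%R.
  by apply/funext => z /=; rewrite !tnth_mktuple.
apply: measurable_funB => //; apply: measurable_funM => //; exact: measurable_tnth.
Qed.

(** Affine changes of variables act on one coordinate at a time, so Tonelli's
    theorem reduces them to the line. *)
Lemma lebesgue_Rn_affine m (x : Rn R m) (rho : R) (phi : Rn R m -> \bar R) :
  (0 < rho)%R -> measurable_fun setT phi -> (forall y, 0 <= phi y) ->
  \int[lebesgue_Rn R m]_y phi y =
  (rho ^+ m)%:E * \int[lebesgue_Rn R m]_z phi (vsub x (vscale rho z)).
Proof.
move=> rho0; elim: m x phi => [|m IH] x phi mphi phi0.
  rewrite expr0 mul1e; apply: eq_integral => y _; congr phi.
  by rewrite (tuple0 y) [RHS]tuple0.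
have mphiV : measurable_fun setT (fun z => phi (vsub x (vscale rho z))).
  by apply: measurableT_comp => //; exact: measurable_vaffine.
rewrite /lebesgue_Rn !integral_tupleS//.
rewrite (lebesgue_integral_affine (thead x) rho0); last 2 first.
- exact: measurable_section.
- by move=> y; exact: integral_ge0.
rewrite exprS EFinM -muleA; congr (_ * _).
rewrite -ge0_integralZl//; last 3 first.
- exact: (measurable_section lebesgue_measure mphiV (fun=> phi0 _)).
- by move=> y _; exact: integral_ge0.
- by rewrite lee_fin exprn_ge0// ltW.
apply: eq_integral => z _.
rewrite (IH (behead_tuple x)) => [|| u]; last exact: phi0.
  congr (_ * _); apply: eq_integral => u _; congr phi.
  apply: eq_from_tnth => i; case: (unliftP ord0 i) => [j|] ->.
    rewrite tnthS !tnth_mktuple tnthS tnth_behead; congr (tnth x _ - _)%R.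
    by apply: val_inj; rewrite /= inordK// ltnS.
  by rewrite /= !tnth_mktuple.
apply: (measurable_fun_pair2 (f := fun v => phi (cons_pair v))).
apply: measurableT_comp mphi _; exact: measurable_cons_pair.
Qed.

End affine_change.

(** * Directions and the measure of the sphere *)

Section directions.
Context {R : realType} {n : nat}.
Implicit Types (x y z a : Rn R n) (rho l : R).
Local Notation mu := (lebesgue_Rn R n).

Lemma enorm_ge0 x : 0 <= enorm x. Proof. exact: sqrtr_ge0. Qed.

Lemma enorm_vscale rho z : 0 <= rho -> enorm (vscale rho z) = rho * enorm z.
Proof.
move=> rho0; rewrite /enorm.
have -> : \sum_(i < n) (tnth (vscale rho z) i : R) ^+ 2 =
    rho ^+ 2 * \sum_(i < n) (tnth z i : R) ^+ 2.
  by rewrite mulr_sumr; apply: eq_bigr => i _; rewrite tnth_mktuple exprMn.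
by rewrite sqrtrM ?sqr_ge0// sqrtr_sqr ger0_norm.
Qed.

Lemma direction_vscale rho z : 0 < rho -> direction (vscale rho z) = direction z.
Proof.
move=> rho0; apply: eq_from_tnth => i; rewrite /direction enorm_vscale ?ltW//.
by rewrite !tnth_mktuple invfM mulrACA mulVf ?mul1r// gt_eqF.
Qed.

Lemma enorm_direction z : enorm z != 0 -> enorm (direction z) = 1.
Proof. by move=> z0; rewrite /direction enorm_vscale ?invr_ge0 ?enorm_ge0// mulVf. Qed.

Lemma vsubK x z : vsub x (vsub x z) = z.
Proof. by apply: eq_from_tnth => i; rewrite !tnth_mktuple opprB addrC subrK. Qed.

Lemma enorm_eq0 z i : enorm z = 0 -> tnth z i = 0 :> R.
Proof.
move=> /eqP; rewrite sqrtr_eq0 => s0.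
have : \sum_(j < n) (tnth z j : R) ^+ 2 == 0.
  by rewrite eq_le s0/= sumr_ge0// => j _; exact: sqr_ge0.
rewrite psumr_eq0 => [/allP/(_ i)|j _]; last exact: sqr_ge0.
by rewrite mem_index_enum => /(_ isT); rewrite sqrf_eq0 => /eqP.
Qed.

Lemma measurable_vsub x : measurable_fun setT (vsub x).
Proof.
apply/measurable_fun_tnthP => i.
have -> : (@tnth _ _)^~ i \o vsub x = (fun z => (tnth x i : R) - (tnth z i : R)).
  by apply/funext => z /=; rewrite tnth_mktuple.
by apply: measurable_funB => //; exact: measurable_tnth.
Qed.

Let measurable_coordinate (i : 'I_n) (c : R) :
  measurable [set z : Rn R n | (tnth z i : R) = c].
Proof.
have mc : measurable ([set c] : set (measurableTypeR R)) by exact: measurable_set1.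
rewrite -[X in measurable X]setTI.
exact: (@measurable_tnth _ (measurableTypeR R) n i measurableT _ mc).
Qed.

Lemma coordinate_null (i : 'I_n) (c : R) : mu [set z | (tnth z i : R) = c] = 0%E.
Proof.
have mc : measurable ([set c] : set (measurableTypeR R)) by exact: measurable_set1.
exact: (tuple_measure_null i mc (lebesgue_measure_set1 c)).
Qed.

Lemma null_in_coordinate (A : set (Rn R n)) (i : 'I_n) (c : R) : measurable A ->
  A `<=` [set z | (tnth z i : R) = c] -> mu A = 0%E.
Proof.
move=> mA Ac; apply/eqP; rewrite eq_le measure_ge0 andbT -(coordinate_null i c).
by apply: le_measure; rewrite ?inE//; exact: measurable_coordinate.
Qed.

Let measurable_enorm0 : measurable [set z : Rn R n | enorm z = 0].
Proof.
have -> : [set z : Rn R n | enorm z = 0] = @enorm R n @^-1` [set 0] by [].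
by rewrite -[X in measurable X]setTI; apply: measurable_enorm.
Qed.

Lemma enorm0_null : (0 < n)%N -> mu [set z | enorm z = 0] = 0%E.
Proof.
move=> n0; apply: (@null_in_coordinate _ (Ordinal n0) 0) => // z /= z0.
exact: enorm_eq0.
Qed.

Lemma measurable_point x : measurable [set y | enorm (vsub x y) = 0].
Proof.
have -> : [set y | enorm (vsub x y) = 0] = vsub x @^-1` [set z | enorm z = 0] by [].
by rewrite -[X in measurable X]setTI; apply: measurable_vsub.
Qed.

Lemma point_null x : (0 < n)%N -> mu [set y | enorm (vsub x y) = 0] = 0%E.
Proof.
move=> n0; apply: (@null_in_coordinate _ (Ordinal n0) (tnth x (Ordinal n0))).
  exact: measurable_point.
move=> z /= /(enorm_eq0 (Ordinal n0)); rewrite tnth_mktuple => /eqP.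
by rewrite subr_eq0 => /eqP.
Qed.

Lemma enorm_vsub_cube a l x y : 0 <= l -> cube a l x -> cube a l y ->
  enorm (vsub x y) <= Num.sqrt n%:R * l.
Proof.
move=> l0 ax ay.
rewrite -[X in _ * X](ger0_norm l0) -sqrtr_sqr -sqrtrM ?ler0n// ler_wsqrtr//.
rewrite mulr_natl -[X in _ *+ X](card_ord n) -sumr_const; apply: ler_sum => i _.
rewrite tnth_mktuple -[leLHS]real_normK ?num_real// lerXn2r ?nnegrE// ler_norml.
have /andP[? ?] := ax i; have /andP[? ?] := ay i.
apply/andP; split; lra.
Qed.

(** The measure of the sphere is [n] times the image under [direction] of the
    Lebesgue measure on the unit ball, and [1 <= n]. *)
Lemma integral_direction_ball (phi : Rn R n -> \bar R) : (0 < n)%N ->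
    measurable_fun setT phi -> (forall y, 0 <= phi y)%E ->
  (\int[mu]_(z in [set z | (0 < enorm z <= 1)%R]) phi (direction z) <=
   \int[@sphere_measure R n]_z phi z)%E.
Proof.
move=> n0 mphi phi0; set B := [set z | _].
have mB : measurable B.
  have -> : B = @enorm R n @^-1` `]0%R, 1%R]%classic.
    by apply/seteqP; split => x /=; rewrite in_itv.
  by rewrite -[X in measurable X]setTI; apply: measurable_enorm.
have mphid : measurable_fun setT (phi \o @direction R n).
  by apply: measurableT_comp => //; exact: measurable_direction.
pose P : {measure set (Rn R n) -> \bar R} :=
  measure_function_pushforward__canonical__measure_function_Measure
    (mrestr mu mB) (@measurable_direction R n).
apply: (@le_trans _ _ (\int[P]_z phi z)%E).
  rewrite [leRHS](ge0_integral_pushforward (@measurable_direction R n))//.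
  rewrite preimage_setT.
  rewrite (@eq_measure_integral _ _ _ B (mrestr mu mB) mu); last first.
    by move=> A mA AB; rewrite /= /mrestr (setIidl AB).
  by apply: ge0_subset_integral => // x _; exact: phi0.
apply: ge0_le_measure_integral => // E mE.
rewrite /P/= /pushforward /mrestr /sphere_measure setIC.
rewrite -[leLHS]mul1e; apply: lee_wpmul2r; first exact: measure_ge0.
by rewrite lee_fin ler1n.
Qed.

(** Polar coordinates in one variable: around [x] the cube lies in the ball of
    radius [sqrt n * l], and the direction does not see the radius. *)
Lemma integral_direction_cube a l x (phi : Rn R n -> \bar R) : (0 < n)%N ->
    0 < l -> cube a l x -> measurable_fun setT phi -> (forall y, 0 <= phi y)%E ->
  (\int[mu]_(y in cube a l) phi (direction (vsub x y)) <=
   ((Num.sqrt n%:R * l) ^+ n)%:E * \int[@sphere_measure R n]_z phi z)%E.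
Proof.
move=> n0 l0 ax mphi phi0; set rho := Num.sqrt n%:R * l.
have rho0 : 0 < rho by rewrite mulr_gt0// sqrtr_gt0 ltr0n.
have mQ := @measurable_cube R n a l.
have mphid : measurable_fun setT (fun z => phi (direction z)).
  by apply: measurableT_comp => //; exact: measurable_direction.
pose F y := phi (direction (vsub x y)).
have mF : measurable_fun setT F.
  by apply: (measurableT_comp mphid); exact: measurable_vsub.
have mFQ : measurable_fun setT (F \_ (cube a l)).
  by apply/(measurable_restrictT _ _).1 => //; exact: measurable_funTS.
have FQ0 y : (0 <= (F \_ (cube a l)) y)%E by rewrite /patch; case: ifPn => // _; exact: phi0.
(* In the variable [z] with [y = x - rho z], the cube becomes a subset of the
   unit ball and the direction of [x - y] is that of [z]. *)
rewrite integral_mkcond -/F (lebesgue_Rn_affine x rho0)//.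
apply: lee_wpmul2l; first by rewrite lee_fin exprn_ge0// ltW.
apply: le_trans (integral_direction_ball n0 mphi phi0).
set B := [set z | _].
have mB : measurable B.
  have -> : B = @enorm R n @^-1` `]0%R, 1%R]%classic.
    by apply/seteqP; split => z /=; rewrite in_itv.
  by rewrite -[X in measurable X]setTI; apply: measurable_enorm.
rewrite [leRHS]integral_mkcond; apply: ae_ge0_le_integral => //.
- by apply: (measurableT_comp mFQ); exact: measurable_vaffine.
- by move=> z _; rewrite /patch; case: ifPn.
- by apply/(measurable_restrictT _ _).1 => //; exact: measurable_funTS.
have nn : {ae mu, forall z, enorm z != 0}.
  exists [set z | enorm z = 0]; split.
  - exact: measurable_enorm0.
  - exact: enorm0_null.
  - by move=> z /= /negP; rewrite negbK => /eqP.
apply: filterS nn => z z0 _; rewrite /patch; case: ifPn => [|_]; last by case: ifPn.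
rewrite inE => Qz; rewrite /F vsubK direction_vscale// mem_set//= /B/=.
rewrite lt_neqAle eq_sym z0 enorm_ge0/=.
have : enorm (vscale rho z) <= rho.
  by have := enorm_vsub_cube (ltW l0) ax Qz; rewrite vsubK.
by rewrite (enorm_vscale z (ltW rho0)) -(ler_pM2l rho0 (enorm z)) mulr1.
Qed.

Let dir x y := direction (vsub x y).

(** Tonelli's theorem applies the inequality for one variable to one coordinate
    at a time. *)
Lemma integral_directions_cube m a l x (Phi : m.-tuple (Rn R n) -> \bar R) :
    (0 < n)%N -> 0 < l -> cube a l x ->
    measurable_fun setT Phi -> (forall v, 0 <= Phi v)%E ->
  (\int[tuple_measure mu m]_(v in tuple_box m (cube a l))
      Phi (map_tuple (fun y => direction (vsub x y)) v) <=
   (((Num.sqrt n%:R * l) ^+ n) ^+ m)%:E *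
     \int[tuple_measure (@sphere_measure R n) m]_u Phi u)%E.
Proof.
move=> n0 l0 ax; set c := (_ * l) ^+ n.
have c0 : 0 <= c by rewrite exprn_ge0// mulr_ge0 ?sqrtr_ge0// ltW.
have mdir : measurable_fun setT (dir x).
  by apply: (measurableT_comp (@measurable_direction R n)); exact: measurable_vsub.
have mmap k : measurable_fun setT (fun v : k.-tuple (Rn R n) => map_tuple (dir x) v).
  apply/measurable_fun_tnthP => i.
  have -> : (@tnth _ _)^~ i \o (fun v : k.-tuple (Rn R n) => map_tuple (dir x) v) =
      dir x \o (fun v => tnth v i) by apply/funext => v /=; rewrite tnth_map.
  by apply: (measurableT_comp mdir); exact: measurable_tnth.
elim: m Phi => [|m IH] Phi mPhi Phi0.
  rewrite expr0 mul1e (_ : tuple_box 0 _ = setT); last first.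
    by apply/seteqP; split => // y _ [].
  rewrite le_eqVlt; apply/orP; left; apply/eqP; apply: eq_integral => y _.
  by congr Phi; rewrite [RHS]tuple0 [LHS]tuple0.
have mQ := @measurable_cube R n a l.
have mPhim : measurable_fun setT (fun v => Phi (map_tuple (dir x) v)).
  by apply: measurableT_comp => //; exact: mmap.
rewrite integral_tuple_boxS// [X in (_ <= _ * X)%E]integral_tupleS//.
pose Psi z := (\int[tuple_measure (@sphere_measure R n) m]_u Phi (cons_pair (z, u)))%E.
have mPsi : measurable_fun setT Psi by exact: measurable_section.
have Psi0 z : (0 <= Psi z)%E by exact: integral_ge0.
apply: (@le_trans _ _ (\int[mu]_(y in cube a l) ((c ^+ m)%:E * Psi (dir x y)))%E).
  apply: ge0_le_integral_any => y Qy; first exact: integral_ge0.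
  have -> : (\int[tuple_measure mu m]_(u in tuple_box m (cube a l))
        Phi (map_tuple (dir x) (cons_pair (y, u))) =
      \int[tuple_measure mu m]_(u in tuple_box m (cube a l))
        Phi (cons_pair (dir x y, map_tuple (dir x) u)))%E.
    by apply: eq_integral => u _; congr Phi; exact: val_inj.
  apply: IH => [|u]; last exact: Phi0.
  apply: (measurable_fun_pair2 (f := fun v => Phi (cons_pair v))).
  by apply: measurableT_comp mPhi _; exact: measurable_cons_pair.
have mPsid : measurable_fun setT (fun y => Psi (dir x y)) by exact: measurableT_comp.
rewrite ge0_integralZl//; last 2 first.
- exact: measurable_funTS.
- by rewrite lee_fin exprn_ge0.
rewrite exprSr EFinM -muleA; apply: lee_wpmul2l; first by rewrite lee_fin exprn_ge0.
exact: integral_direction_cube.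
Qed.

End directions.

(** * Averages against a rough kernel *)

Section rough_average.
Context {R : realType}.
Local Open Scope ereal_scope.

(** The kernel is constrained only at tuples without a coordinate equal to the
    centre. The other tuples form a null set, on which the integrand is
    arbitrary and possibly not measurable. *)
Lemma ge0_le_integral_off_null d (T : measurableType d)
    (mu : {measure set T -> \bar R}) (D N : set T) (f g : T -> \bar R) :
    measurable D -> measurable N -> mu N = 0 ->
    (forall x, 0 <= f x) -> (forall x, 0 <= g x) -> measurable_fun D g ->
    (forall x, D x -> ~ N x -> f x <= g x) ->
  \int[mu]_(x in D) f x <= \int[mu]_(x in D) g x.
Proof.
move=> mD mN N0 f0 g0 mg fg.
have mI : measurable_fun D (fun x => (\1_N x : R)%:E).
  by apply/measurable_EFinP; apply: measurable_funTS; exact: measurable_indic.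
have -> : \int[mu]_(x in D) g x = \int[mu]_(x in D) (g x + +oo * (\1_N x : R)%:E).
  have I0 x : D x -> 0 <= (\1_N x : R)%:E by rewrite lee_fin.
  have yI0 x : D x -> 0 <= +oo * (\1_N x : R)%:E by move=> Dx; rewrite mule_ge0// I0.
  rewrite (ge0_integralD mu mD (fun x _ => g0 x) mg yI0 (measurable_funeM _ mI)).
  rewrite (ge0_integralZl mu mD mI I0)//.
  rewrite integral_indic// (_ : mu (N `&` D) = 0) ?mule0 ?adde0//.
  apply/eqP; rewrite eq_le measure_ge0 andbT -N0; apply: le_measure; rewrite ?inE//.
  exact: measurableI.
apply: ge0_le_integral_any => x Dx; first exact: f0.
rewrite indicE; have [xN|xN] := boolP (x \in N).
  by rewrite mule1 addey ?leey// gt_eqF// (lt_le_trans _ (g0 x))// ltNy0.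
by rewrite mule0 adde0; apply: fg => //; move/negP: xN; rewrite inE.
Qed.

Lemma average_ge0 (n : nat) (Q : set (Rn R n)) (g : Rn R n -> \bar R) :
  (forall x, 0 <= g x) -> 0 <= average Q g.
Proof.
move=> g0; rewrite /average mule_ge0 ?inve_ge0//; first exact: integral_ge0.
Qed.

Context {n m : nat}.
Hypothesis n0 : (0 < n)%N.
Local Notation mu := (lebesgue_Rn R n).
Implicit Types (Omega : m.-tuple (Rn R n) -> R) (f : 'I_m -> Rn R n -> R).

Lemma measurable_unit_sphere : measurable (@unit_sphere R n).
Proof.
have -> : @unit_sphere R n = @enorm R n @^-1` [set 1%R] by [].
by rewrite -[X in measurable X]setTI; apply: measurable_enorm.
Qed.

(** Measurability of the kernel is given on the product of spheres only. *)
Let sphere_part Omega : m.-tuple (Rn R n) -> R := Omega \_ (@sphere_product R n m).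

Lemma measurable_sphere_part s Omega : Ls_sphere s Omega ->
  measurable_fun setT (sphere_part Omega).
Proof.
move=> [mO _]; apply/(measurable_restrictT _ _).1 => //.
have -> : @sphere_product R n m = tuple_box m (@unit_sphere R n) by [].
apply: measurable_tuple_box; exact: measurable_unit_sphere.
Qed.

Lemma sphere_norm_part s Omega :
  sphere_norm s Omega =
  'N[tuple_measure (@sphere_measure R n) m]_s [EFin \o sphere_part Omega].
Proof.
rewrite /sphere_norm; congr Lnorm; apply/funext => v.
by rewrite /sphere_part /patch/=; case: ifPn.
Qed.

Let dirs x (v : m.-tuple (Rn R n)) := map_tuple (fun y => direction (vsub x y)) v.

Let measurable_dirs x : measurable_fun setT (dirs x).
Proof.
apply/measurable_fun_tnthP => i.
have -> : (@tnth _ _)^~ i \o dirs x = (@direction R n \o vsub x) \o (fun v => tnth v i).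
  by apply/funext => v /=; rewrite tnth_map.
apply: measurableT_comp; last exact: measurable_tnth.
by apply: (measurableT_comp (@measurable_direction R n)); exact: measurable_vsub.
Qed.

(** Off the null set of tuples having a coordinate equal to [x], the kernel is
    read off from its values on the product of spheres. *)
Lemma integral_rough_kernel Omega s f (a x : Rn R n) (l : R) :
    function_of_directions Omega -> Ls_sphere s Omega ->
    (forall i, measurable_fun setT (f i)) ->
  \int[tuple_measure mu m]_(v in tuple_box m (cube a l))
     (`|Omega (map_tuple (vsub x) v)| * \prod_(i < m) `|f i (tnth v i)|)%:E <=
  \int[tuple_measure mu m]_(v in tuple_box m (cube a l))
     (`|sphere_part Omega (dirs x v)| * \prod_(i < m) `|f i (tnth v i)|)%:E.
Proof.
move=> dO LO mf.
pose N := \big[setU/set0]_(i < m) [set v : m.-tuple (Rn R n) |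
  [set y | enorm (vsub x y) = 0%R] (tnth v i)].
have mNi (i : 'I_m) : measurable [set v : m.-tuple (Rn R n) |
    [set y | enorm (vsub x y) = 0%R] (tnth v i)].
  rewrite -[X in measurable X]setTI.
  exact: (@measurable_tnth _ (Rn R n) m i measurableT _ (measurable_point x)).
have [mN N0] : measurable N /\ tuple_measure mu m N = 0.
  rewrite /N; elim/big_ind: _ => [|A B [mA A0] [mB B0]|i _].
  - by split; [exact: measurable0|exact: measure0].
  - split; first exact: measurableU.
    apply/eqP; rewrite eq_le measure_ge0 andbT.
    by apply: le_trans (measureU2 _ mA mB) _; rewrite [X in X + _]A0 add0e [X in X <= _]B0.
  - split; first exact: mNi.
    exact: (tuple_measure_null i (measurable_point x) (point_null x n0)).
apply: (@ge0_le_integral_off_null _ _ _ _ N) => //.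
- by apply: measurable_tuple_box; exact: measurable_cube.
- by move=> v; rewrite lee_fin mulr_ge0// prodr_ge0.
- by move=> v; rewrite lee_fin mulr_ge0// prodr_ge0.
- apply/measurable_EFinP; apply: measurable_funTS; apply: measurable_funM.
    apply: measurableT_comp => //; apply: (measurableT_comp (measurable_sphere_part LO)).
    exact: measurable_dirs.
  apply: (measurable_prod_coordinates (f := fun i y => `|f i y|%R)) => i.
  exact: measurableT_comp.
move=> v _ vN.
have v0 (i : 'I_m) : enorm (vsub x (tnth v i)) != 0%R.
  apply/eqP => vi; apply: vN; rewrite /N -bigcup_seq.
  by exists i => //=; rewrite mem_index_enum.
rewrite lee_fin ler_wpM2r ?prodr_ge0//.
have v0' i : enorm (tnth (map_tuple (vsub x) v) i) != 0%R by rewrite tnth_map.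
rewrite (dO _ v0') /sphere_part /patch mem_set.
  rewrite le_eqVlt; apply/orP; left; apply/eqP; congr (`|Omega _|)%R.
  by apply: eq_from_tnth => i; rewrite !tnth_map.
by move=> i; rewrite tnth_map; exact: enorm_direction.
Qed.

Lemma averageE (a : Rn R n) (l : R) (g : Rn R n -> \bar R) : (0 < l)%R ->
  \int[mu]_(y in cube a l) g y = (l ^+ n)%:E * average (cube a l) g.
Proof.
move=> l0; rewrite /average lebesgue_cube// muleA inver gt_eqF ?exprn_gt0//.
by rewrite -EFinM mulfV ?mul1e// gt_eqF ?exprn_gt0.
Qed.

Lemma prode_average (a : Rn R n) (l : R) (g : 'I_m -> Rn R n -> \bar R) (r : R) :
    (0 < l)%R -> (forall i x, 0 <= g i x) ->
  \prod_(i < m) (\int[mu]_(y in cube a l) g i y) `^ r =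
  (((l ^+ n) ^+ m) `^ r)%:E * \prod_(i < m) average (cube a l) (g i) `^ r.
Proof.
move=> l0 g0; pose u := (l ^+ n)%R; have u0 : (0 <= u)%R by rewrite exprn_ge0// ltW.
have E i : (\int[mu]_(y in cube a l) g i y) `^ r =
    (u `^ r)%:E * average (cube a l) (g i) `^ r.
  rewrite averageE//; apply: (@poweRM _ u%:E); first by rewrite lee_fin.
  exact: average_ge0.
rewrite (eq_bigr _ (fun i _ => E i)) big_split/=; congr (_ * _).
rewrite prodEFin big_const_ord iter_mulr_1; congr _%:E.
exact: exprn_powR.
Qed.

(** Hoelder's inequality on the cube, followed by polar coordinates for the
    kernel and Tonelli's theorem for the functions. The powers [r^-1] and [r'^-1]
    of the volume recombine to the volume itself. *)
Lemma rough_average_finite (r r' : R) Omega f (a x : Rn R n) (l : R) :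
    (1 < r)%R -> (0 < r')%R -> (r^-1 + r'^-1 = 1)%R ->
    function_of_directions Omega -> Ls_sphere r%:E Omega ->
    (forall i, measurable_fun setT (f i)) -> (0 < l)%R -> cube a l x ->
  \int[tuple_measure mu m]_(v in tuple_box m (cube a l))
     (`|Omega (map_tuple (vsub x) v)| * \prod_(i < m) `|f i (tnth v i)|)%:E <=
  (((Num.sqrt n%:R ^+ n) ^+ m) `^ r^-1 * (l ^+ n) ^+ m)%:E *
    sphere_norm r%:E Omega *
    \prod_(i < m) average (cube a l) (fun y => (`|f i y| `^ r')%:E) `^ r'^-1.
Proof.
move=> r1 r'0 rr' dO LO mf l0 ax.
have r0 : (0 < r)%R by rewrite (lt_trans _ r1).
apply: le_trans (integral_rough_kernel a x l dO LO mf) _.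
set D := tuple_box m (cube a l).
have mD : measurable D by apply: measurable_tuple_box; exact: measurable_cube.
have mS := measurable_sphere_part LO.
have mSd : measurable_fun setT (fun v => sphere_part Omega (dirs x v)).
  by apply: (measurableT_comp mS); exact: measurable_dirs.
have mI : measurable_fun setT (\1_D : _ -> R) by exact: measurable_indic.
pose u v := (`|sphere_part Omega (dirs x v)| * \1_D v : R)%R.
pose g v := (\prod_(i < m) `|f i (tnth v i)| * \1_D v : R)%R.
have mu_ : measurable_fun setT u.
  by apply: measurable_funM => //; exact: measurableT_comp.
have mg : measurable_fun setT g.
  apply: measurable_funM => //.
  apply: (measurable_prod_coordinates (f := fun i y => `|f i y|%R)) => i.
  exact: measurableT_comp.
have u0 v : (0 <= u v)%R by rewrite mulr_ge0.
have g0 v : (0 <= g v)%R by rewrite mulr_ge0// prodr_ge0.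
have -> : \int[tuple_measure mu m]_(v in D)
    (`|sphere_part Omega (dirs x v)| * \prod_(i < m) `|f i (tnth v i)|)%:E =
    \int[tuple_measure mu m]_v (u v * g v)%:E.
  rewrite integral_mkcond; apply: eq_integral => v _; rewrite /patch /u /g indicE.
  by case: ifPn => _; rewrite ?mulr1// !mulr0.
apply: le_trans (hoelder_integral _ mu_ mg u0 g0 r0 r'0 rr') _.
have restrict_power (h : m.-tuple (Rn R n) -> R) (q : R) : (0 < q)%R ->
    (forall v, 0 <= h v)%R -> \int[tuple_measure mu m]_v ((h v * \1_D v) `^ q)%:E =
    \int[tuple_measure mu m]_(v in D) (h v `^ q)%:E.
  move=> q0 h0; rewrite [RHS]integral_mkcond; apply: eq_integral => v _.
  rewrite /patch indicE; case: ifPn => _; first by rewrite mulr1.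
  by rewrite mulr0 powR0// gt_eqF.
rewrite !restrict_power//.
have -> : \int[tuple_measure mu m]_(v in D) ((\prod_(i < m) `|f i (tnth v i)|) `^ r')%:E =
    \prod_(i < m) \int[mu]_(y in cube a l) (`|f i y| `^ r')%:E.
  rewrite -(integral_prod_coordinates _ (f := fun i y => (`|f i y| `^ r')%R)).
  - by apply: eq_integral => v _; rewrite powR_prod.
  - exact: measurable_cube.
  - move=> i; apply: (measurableT_comp (measurable_powR _)); exact: measurableT_comp.
  - by move=> i y; exact: powR_ge0.
have first_factor : \int[tuple_measure mu m]_(v in D)
      (`|sphere_part Omega (dirs x v)| `^ r)%:E <=
    (((Num.sqrt n%:R * l) ^+ n) ^+ m)%:E *
    \int[tuple_measure (@sphere_measure R n) m]_z (`|sphere_part Omega z| `^ r)%:E.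
  apply: (integral_directions_cube (Phi := fun v => (`|sphere_part Omega v| `^ r)%:E)) => //.
  apply/measurable_EFinP; apply: (measurableT_comp (measurable_powR _)).
  exact: measurableT_comp.
apply: (@le_trans _ _ (((((Num.sqrt n%:R * l) ^+ n) ^+ m)%:E *
    \int[tuple_measure (@sphere_measure R n) m]_z (`|sphere_part Omega z| `^ r)%:E) `^ r^-1 *
   (\prod_(i < m) \int[mu]_(y in cube a l) (`|f i y| `^ r')%:E) `^ r'^-1)).
  apply: lee_pmul; rewrite ?poweR_ge0//; apply: le_poweR => //.
    by rewrite invr_ge0 ltW.
  by apply: integral_ge0 => v _; rewrite lee_fin powR_ge0.
have sl0 : (0 <= ((Num.sqrt n%:R * l) ^+ n) ^+ m)%R.
  by rewrite !exprn_ge0// mulr_ge0 ?sqrtr_ge0 ?(ltW l0).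
rewrite poweRM ?lee_fin//; last by apply: integral_ge0 => v _; rewrite lee_fin powR_ge0.
have -> : sphere_norm r%:E Omega =
    (\int[tuple_measure (@sphere_measure R n) m]_z (`|sphere_part Omega z| `^ r)%:E) `^ r^-1.
  by rewrite sphere_norm_part unlock.
rewrite poweR_prod; last first.
  by move=> i; apply: integral_ge0 => v _; rewrite lee_fin powR_ge0.
rewrite prode_average// muleACA muleA poweR_EFin -EFinM.
have -> : ((((Num.sqrt n%:R * l) ^+ n) ^+ m) `^ r^-1 * ((l ^+ n) ^+ m) `^ r'^-1 =
   ((Num.sqrt n%:R ^+ n) ^+ m) `^ r^-1 * (l ^+ n) ^+ m)%R.
  have kappa0 : (0 <= (Num.sqrt n%:R ^+ n) ^+ m :> R)%R by rewrite !exprn_ge0// sqrtr_ge0.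
  have V0 : (0 <= (l ^+ n) ^+ m)%R by rewrite !exprn_ge0// ltW.
  rewrite !exprMn (powRM _ kappa0 V0) -mulrA -powRD ?rr' ?oner_eq0//.
  by rewrite powRr1.
  exact: lexx.
by move=> v; exact: prodr_ge0.
Qed.

(** For an essentially bounded kernel the exceptional set of directions is null,
    and polar coordinates show that the tuples pointing to it are null too. *)
Lemma rough_average_infinite Omega f (a x : Rn R n) (l : R) :
    function_of_directions Omega -> Ls_sphere +oo Omega ->
    (forall i, measurable_fun setT (f i)) -> (0 < l)%R -> cube a l x ->
  \int[tuple_measure mu m]_(v in tuple_box m (cube a l))
     (`|Omega (map_tuple (vsub x) v)| * \prod_(i < m) `|f i (tnth v i)|)%:E <=
  ((l ^+ n) ^+ m)%:E * sphere_norm +oo Omega *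
    \prod_(i < m) average (cube a l) (fun y => (`|f i y|)%:E).
Proof.
move=> dO LO mf l0 ax.
apply: le_trans (integral_rough_kernel a x l dO LO mf) _.
set D := tuple_box m (cube a l).
have mD : measurable D by apply: measurable_tuple_box; exact: measurable_cube.
set M := sphere_norm +oo Omega.
have M0 : 0 <= M by exact: Lnorm_ge0.
have [N [mN N0 MN]] : exists N, [/\ measurable N,
    tuple_measure (@sphere_measure R n) m N = 0 &
    forall z, ~ N z -> (`|sphere_part Omega z|)%:E <= M].
  rewrite /M sphere_norm_part unlock; case: ifPn => [pos|].
    have [N [mN N0 subN]] := ess_sup_ge (tuple_measure (@sphere_measure R n) m)
      (abse \o (EFin \o sphere_part Omega)).
    exists N; split => // z Nz; apply: contrapT => h; apply: Nz; exact: subN.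
  (* If the sphere has no mass then everything is exceptional. *)
  rewrite -leNgt => le0; exists setT; split; first exact: measurableT.
    by apply/eqP; rewrite eq_le le0 measure_ge0.
  by move=> z /(_ Logic.I).
pose N' := D `&` dirs x @^-1` N.
have mN' : measurable (dirs x @^-1` N).
  by rewrite -[X in measurable X]setTI; exact: measurable_dirs.
have N'0 : tuple_measure mu m N' = 0.
  apply/eqP; rewrite eq_le measure_ge0 andbT.
  have IN0 : \int[tuple_measure (@sphere_measure R n) m]_z (\1_N z : R)%:E = 0.
    by rewrite integral_indic// setIT.
  have := @integral_directions_cube R n m a l x (fun z => (\1_N z)%:E) n0 l0 ax.
  rewrite IN0 mule0.
  have -> : \int[tuple_measure mu m]_(v in D)
      (\1_N (map_tuple (fun y => direction (vsub x y)) v))%:E =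
      \int[tuple_measure mu m]_(v in D) (\1_(dirs x @^-1` N) v)%:E.
    by apply: eq_integral.
  rewrite integral_indic// setIC; apply.
    by apply/measurable_EFinP; exact: measurable_indic.
  by move=> z; rewrite lee_fin.
pose F v := (\prod_(i < m) `|f i (tnth v i)|)%:E.
have F0 v : 0 <= F v by rewrite lee_fin prodr_ge0.
have mF : measurable_fun D F.
  apply/measurable_EFinP; apply: measurable_funTS.
  apply: (measurable_prod_coordinates (f := fun i y => `|f i y|%R)) => i.
  exact: measurableT_comp.
apply: (@le_trans _ _ (\int[tuple_measure mu m]_(v in D) (M * F v))).
  apply: (@ge0_le_integral_off_null _ _ _ _ N') => //.
  - exact: measurableI.
  - by move=> v; rewrite lee_fin mulr_ge0// prodr_ge0.
  - by move=> v; rewrite mule_ge0.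
  - exact: measurable_funeM.
  move=> v Dv N'v; rewrite EFinM; apply: lee_wpmul2r; first exact: F0.
  by apply: MN => h; exact: N'v.
rewrite ge0_integralZl//.
rewrite /F (integral_prod_coordinates _ (f := fun i y => `|f i y|%R)); last 3 first.
- exact: measurable_cube.
- by move=> i; exact: measurableT_comp.
- by [].
rewrite (eq_bigr (fun i => (l ^+ n)%:E * average (cube a l) (fun y => (`|f i y|)%:E)))
  => [|i _]; last exact: averageE.
rewrite big_split/= prodEFin big_const_ord iter_mulr_1 muleA [M * _]muleC.
exact: lexx.
Qed.

End rough_average.

(** * Conjugate exponents *)

Section exponents.
Context {R : realType}.
Implicit Types (r : R).

Lemma conj_exponentE r : 1 < r -> conj_exponent r%:E = r / (r - 1).
Proof.
move=> r1; rewrite /conj_exponent /hoelder_conjugate /=.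
rewrite eqe gt_eqF ?(lt_trans _ r1)//.
by rewrite -EFinB inver subr_eq0 gt_eqF.
Qed.

Lemma conj_exponent_infinite : conj_exponent (+oo%E : \bar R) = 1.
Proof. by []. Qed.

Lemma conj_exponent_gt1 r : 1 < r -> 1 < conj_exponent r%:E.
Proof.
move=> r1; rewrite conj_exponentE// ltr_pdivlMr ?subr_gt0// mul1r.
by rewrite ltrBlDr ltrDl.
Qed.

Lemma conj_exponentD r : 1 < r -> r^-1 + (conj_exponent r%:E)^-1 = 1.
Proof.
move=> r1; have r0 : r != 0 by rewrite gt_eqF// (lt_trans _ r1).
by rewrite conj_exponentE// invf_div mulrBl mulfV// mul1r addrC subrK.
Qed.

Lemma conj_exponent_ge1 (s : \bar R) : (1 < s)%E -> 1 <= conj_exponent s.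
Proof.
case: s => [r||//]; first by rewrite lte_fin => /conj_exponent_gt1/ltW.
by rewrite conj_exponent_infinite.
Qed.

End exponents.

(** * Cubes and averages *)

Section weights.
Context {R : realType} {n m : nat}.
Local Notation mu := (lebesgue_Rn R n).
Local Open Scope ereal_scope.

Lemma cubes_measurable Q : @cubes R n Q -> measurable Q.
Proof. by move=> [a [l l0 ->]]; exact: measurable_cube. Qed.

Lemma cubes_lebesgue Q : @cubes R n Q -> exists2 V : R, (0 < V)%R & mu Q = V%:E.
Proof.
move=> [a [l l0 ->]]; exists (l ^+ n)%R; first by rewrite exprn_gt0.
exact: lebesgue_cube.
Qed.

Lemma average_gt0 Q (g : Rn R n -> \bar R) : cubes Q ->
  0 < \int[mu]_(x in Q) g x -> 0 < average Q g.
Proof.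
move=> /cubes_lebesgue[V V0 VE] g0; rewrite /average VE inver gt_eqF//.
by rewrite mule_gt0// lte_fin invr_gt0.
Qed.

Lemma average_infinite Q (g : Rn R n -> \bar R) : cubes Q ->
  \int[mu]_(x in Q) g x = +oo -> average Q g = +oo.
Proof.
move=> /cubes_lebesgue[V V0 VE] gy; rewrite /average gy VE inver gt_eqF//.
by rewrite gt0_muley// lte_fin invr_gt0.
Qed.

Definition centered_cube (N : R) : set (Rn R n) := cube [tuple (- N)%R | i < n] (2 * N).

Lemma cube_sub_centered (a : Rn R n) (l N : R) :
  (0 <= l)%R -> (\sum_(i < n) `|tnth a i : R| + l <= N)%R ->
  cube a l `<=` centered_cube N.
Proof.
move=> l0 aN y ay i; rewrite tnth_mktuple; have /andP[y1 y2] := ay i.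
have ai : (`|tnth a i : R| <= \sum_(j < n) `|tnth a j : R|)%R.
  by rewrite (bigD1 i)//= lerDl sumr_ge0.
have := ler_norm (tnth a i : R); have := ler_norm (- (tnth a i : R))%R.
by rewrite normrN => *; apply/andP; split; lra.
Qed.

Lemma cubes_sub_cube Q Q' : @cubes R n Q -> @cubes R n Q' ->
  exists Q1, [/\ cubes Q1, Q `<=` Q1 & Q' `<=` Q1].
Proof.
move=> [a [l l0 ->]] [b [h h0 ->]].
pose N := (\sum_(i < n) `|tnth a i : R| + l + (\sum_(i < n) `|tnth b i : R| + h))%R.
have sa : (0 <= \sum_(i < n) `|tnth a i : R|)%R by rewrite sumr_ge0.
have sb : (0 <= \sum_(i < n) `|tnth b i : R|)%R by rewrite sumr_ge0.
exists (centered_cube N); split.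
- by exists [tuple (- N)%R | i < n], (2 * N)%R => //; rewrite /N mulr_gt0//; lra.
- by apply: cube_sub_centered; rewrite ?ltW//; rewrite /N; lra.
- by apply: cube_sub_centered; rewrite ?ltW//; rewrite /N; lra.
Qed.

Lemma centered_cubes_cover : \bigcup_(N in [set: nat]) centered_cube N.+1%:R = setT.
Proof.
apply/seteqP; split => // x _.
pose s := (\sum_(i < n) `|tnth x i : R| + 0)%R.
exists (Num.trunc s).+1 => //; apply: (@cube_sub_centered x 0); rewrite ?lexx//.
  rewrite (le_trans (ltW (truncnS_gt _)))// ler_nat; exact: leqnSn.
by move=> i; rewrite addr0 lexx.
Qed.

Lemma centered_cube_cubes (N : nat) : cubes (centered_cube N.+1%:R).
Proof. by exists [tuple (- N.+1%:R)%R | i < n], (2 * N.+1%:R)%R => //; rewrite mulr_gt0. Qed.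

(** Exhausting the space by cubes shows that the integral of [nu] is zero, so
    [nu] vanishes almost everywhere and [0 * +oo = 0] makes even [+oo * nu]
    integrate to zero. *)
Lemma integral_null_weight (nu : Rn R n -> R) (h : Rn R n -> \bar R) :
    measurable_fun setT nu -> (forall x, 0 <= nu x)%R -> (forall x, 0 <= h x) ->
    (forall Q, cubes Q -> \int[mu]_(x in Q) (nu x)%:E = 0) ->
  \int[mu]_x (h x * (nu x)%:E) = 0.
Proof.
move=> mnu nu0 h0 null.
have nuT : \int[mu]_x (nu x)%:E = 0.
  pose C N := centered_cube N.+1%:R.
  have ndC : nondecreasing_seq C.
    apply/nondecreasing_seqP => N; rewrite subsetEset => y yN i.
    have := yN i; rewrite !tnth_mktuple -(natr1 N.+1) => /andP[? ?].
    by apply/andP; split; lra.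
  have mC N : measurable (C N) by apply: cubes_measurable; exact: centered_cube_cubes.
  have mnuC N : measurable_fun (C N) (fun x => (nu x)%:E).
    by apply/measurable_EFinP; exact: measurable_funTS.
  have := ge0_nondecreasing_set_cvg_integral (mu := mu) ndC mC mnuC (fun _ x _ => nu0 x).
  rewrite centered_cubes_cover.
  have -> : (fun N => \int[mu]_(x in C N) (nu x)%:E) = cst 0.
    by apply/funext => N; apply: null; exact: centered_cube_cubes.
  move=> /(cvg_lim (@ereal_hausdorff R)) <-.
  by rewrite lim_cst.
apply/eqP; rewrite eq_le integral_ge0 ?andbT => [|x _]; last by rewrite mule_ge0// lee_fin.
apply: (@le_trans _ _ (\int[mu]_x (+oo * (nu x)%:E))).
  apply: ge0_le_integral_any => x _; first by rewrite mule_ge0// lee_fin.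
  by apply: lee_wpmul2r; rewrite ?lee_fin// leey.
rewrite ge0_integralZl//.
- by rewrite nuT mule0.
- exact/measurable_EFinP.
- by move=> x _; rewrite lee_fin.
Qed.

End weights.

(** * Dual weights and the Fujii-Wilson constant *)

Section dual_weights.
Context {R : realType} {n : nat}.
Local Notation mu := (lebesgue_Rn R n).
Local Open Scope ereal_scope.
Variables (r : R) (w : Rn R n -> R).
Hypothesis r1 : (1 < r)%R.
Hypothesis mw : measurable_fun setT w.
Hypothesis w0 : forall x, (0 <= w x)%R.

Let r' := conj_exponent r%:E.

(** The dual weight with value [0] in place of [+oo] at the zeros of [w]. The two
    agree almost everywhere once the dual weight is locally integrable. *)
Definition real_dual (x : Rn R n) : R := (w x `^ (1 - r'))%R.

Lemma real_dual_ge0 x : (0 <= real_dual x)%R. Proof. exact: powR_ge0. Qed.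

Lemma measurable_real_dual : measurable_fun setT real_dual.
Proof. exact: (measurableT_comp (measurable_powR _)). Qed.

Lemma dual_weightE x :
  dual_weight r w x = if w x == 0%R then +oo else (real_dual x)%:E.
Proof.
rewrite /dual_weight /wpow (_ : (1 - conj_exponent r%:E < 0)%R) ?andbT//.
by rewrite subr_lt0 conj_exponent_gt1.
Qed.

Lemma dual_weight_gt0 x : 0 < dual_weight r w x.
Proof.
rewrite dual_weightE; case: ifPn => [_|wx]; first exact: ltry.
by rewrite lte_fin powR_gt0// lt_neqAle eq_sym wx w0.
Qed.

Let measurable_zeros : measurable [set x | w x = 0%R].
Proof.
have -> : [set x | w x = 0%R] = w @^-1` [set 0%R] by [].
by rewrite -[X in measurable X]setTI; apply: mw.
Qed.

Lemma measurable_dual_weight : measurable_fun setT (dual_weight r w).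
Proof.
have -> : dual_weight r w = fun x => if w x == 0%R then +oo else (real_dual x)%:E.
  by apply/funext => x; exact: dual_weightE.
apply: measurable_fun_ifT => //.
  exact: (measurable_fun_eqr mw).
by apply/measurable_EFinP; exact: measurable_real_dual.
Qed.

Lemma integral_dual_gt0 Q : cubes Q -> 0 < \int[mu]_(x in Q) dual_weight r w x.
Proof.
move=> cQ; have mQ := cubes_measurable cQ; have [V V0 VE] := cubes_lebesgue cQ.
have d0 x : Q x -> 0 <= dual_weight r w x by move=> _; exact: ltW (dual_weight_gt0 x).
rewrite lt_neqAle integral_ge0// andbT eq_sym; apply/negP => /eqP int0.
have : \int[mu]_(x in Q) `|dual_weight r w x| = 0.
  by rewrite -int0; apply: eq_integral => x /set_mem Qx; rewrite gee0_abs// d0.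
move/(ae_eq_integral_abs mu mQ (measurable_funTS measurable_dual_weight)).
move=> [N [mN N0 subN]].
have QN : Q `<=` N.
  move=> x Qx; apply: subN => /= /(_ Qx) dx.
  by have := dual_weight_gt0 x; rewrite dx ltxx.
have : mu Q <= 0 by rewrite -N0; apply: le_measure; rewrite ?inE.
by rewrite VE lee_fin leNgt V0.
Qed.

(** The dual weight is infinite at the zeros of [w]. *)
Lemma zeros_null_in Q : cubes Q -> \int[mu]_(x in Q) dual_weight r w x < +oo ->
  mu ([set x | w x = 0%R] `&` Q) = 0.
Proof.
move=> cQ fin; have mQ := cubes_measurable cQ.
apply/eqP/negPn/negP => zn0; move: fin; rewrite ltNge => /negP; apply.
have -> : +oo = \int[mu]_(x in Q) (+oo * (\1_[set x | w x = 0%R] x : R)%:E).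
  have I0 x : Q x -> 0 <= (\1_[set x | w x = 0%R] x : R)%:E by rewrite lee_fin.
  have mI : measurable_fun Q (fun x => (\1_[set x | w x = 0%R] x : R)%:E).
    by apply/measurable_EFinP; apply: measurable_funTS; exact: measurable_indic.
  rewrite (ge0_integralZl mu mQ mI I0)// integral_indic// gt0_mulye//.
  by rewrite lt_neqAle eq_sym zn0 measure_ge0.
apply: ge0_le_integral_any => x Qx; first by rewrite mule_ge0// lee_fin.
rewrite dual_weightE indicE; case: eqP => wx; first by rewrite leey.
by rewrite memNset ?mule0 ?lee_fin ?powR_ge0.
Qed.

Hypothesis fin : forall Q, cubes Q -> \int[mu]_(x in Q) dual_weight r w x < +oo.

Lemma weight_neq0_ae : {ae mu, forall x, w x != 0%R}.
Proof.
exists [set x | w x = 0%R]; split => //; last by move=> x /= /negP; rewrite negbK => /eqP.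
pose C (N : nat) := @centered_cube R n N.+1%:R.
have -> : [set x | w x = 0%R] = \bigcup_N ([set x | w x = 0%R] `&` C N).
  by rewrite -setI_bigcupr centered_cubes_cover setIT.
apply/eqP; rewrite eq_le measure_ge0 andbT.
have mC N : measurable (C N) by apply: cubes_measurable; exact: centered_cube_cubes.
apply: (@le_trans _ _ (\sum_(N <oo) mu ([set x | w x = 0%R] `&` C N))).
  apply: measure_sigma_subadditive => //.
  - by move=> N; exact: measurableI.
  - by apply: bigcup_measurable => N _; exact: measurableI.
rewrite eseries0// => N _ _; apply: zeros_null_in; first exact: centered_cube_cubes.
by apply: fin; exact: centered_cube_cubes.
Qed.

Lemma integral_real_dual Q : measurable Q ->
  \int[mu]_(x in Q) dual_weight r w x = \int[mu]_(x in Q) (real_dual x)%:E.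
Proof.
move=> mQ; apply: ge0_ae_eq_integral => //.
- exact: measurable_funTS measurable_dual_weight.
- by apply/measurable_EFinP; apply: measurable_funTS; exact: measurable_real_dual.
- by move=> x _; exact: ltW (dual_weight_gt0 x).
- by move=> x _; rewrite lee_fin real_dual_ge0.
apply: filterS weight_neq0_ae => x wx _.
by rewrite dual_weightE (negPf wx).
Qed.

(** Hoelder's inequality against the dual weight; it makes functions of finite
    weighted norm integrable on cubes. *)
Lemma integral_cube_weighted (g : Rn R n -> R) Q : cubes Q ->
    measurable_fun setT g -> (forall x, 0 <= g x)%R ->
  \int[mu]_(x in Q) (g x)%:E <=
  (\int[mu]_x (g x `^ r * w x)%:E) `^ r^-1 *
  (\int[mu]_(x in Q) (real_dual x)%:E) `^ r'^-1.
Proof.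
move=> cQ mg g0; have mQ := cubes_measurable cQ.
have r0 : (0 < r)%R by rewrite (lt_trans _ r1).
have r'0 : (0 < r')%R by rewrite (lt_trans _ (conj_exponent_gt1 r1)).
have mwp a : measurable_fun setT (fun x => w x `^ a)%R.
  exact: (measurableT_comp (measurable_powR _)).
have mI : measurable_fun setT (\1_Q : _ -> R) by exact: measurable_indic.
pose u x := (g x * w x `^ r^-1)%R.
pose v x := (w x `^ (- r^-1) * \1_Q x)%R.
have mu_ : measurable_fun setT u by exact: measurable_funM.
have mv : measurable_fun setT v by exact: measurable_funM.
have u0 x : (0 <= u x)%R by rewrite mulr_ge0 ?powR_ge0.
have v0 x : (0 <= v x)%R by rewrite mulr_ge0 ?powR_ge0.
apply: (@le_trans _ _ (\int[mu]_x (u x * v x)%:E)).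
  rewrite integral_mkcond; apply: ae_ge0_le_integral => //.
  - by move=> x _; rewrite /patch; case: ifPn => // _; rewrite lee_fin.
  - apply/(measurable_restrictT _ _).1 => //.
    by apply/measurable_EFinP; exact: measurable_funTS.
  - by move=> x _; rewrite lee_fin mulr_ge0.
  - by apply/measurable_EFinP; exact: measurable_funM.
  apply: filterS weight_neq0_ae => x wx _; rewrite /patch /u /v indicE.
  case: ifPn => _; last by rewrite !mulr0.
  by rewrite mulr1 -mulrA -powRD ?subrr ?powRr0 ?mulr1// wx implybT.
apply: le_trans (hoelder_integral mu mu_ mv u0 v0 r0 r'0 (conj_exponentD r1)) _.
apply: lee_pmul; rewrite ?poweR_ge0//.
  rewrite le_eqVlt; apply/orP; left; apply/eqP; congr (_ `^ _).
  by apply: eq_integral => x _; rewrite /u powRM ?powR_ge0// powRVK// gt_eqF.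
rewrite le_eqVlt; apply/orP; left; apply/eqP; congr (_ `^ _).
rewrite [RHS]integral_mkcond; apply: eq_integral => x _; rewrite /patch /v indicE.
case: ifPn => _; last by rewrite mulr0 powR0// gt_eqF.
rewrite mulr1 -powRrM /real_dual; congr (_ `^ _)%:E.
have := conj_exponentD r1; rewrite -/r' => h.
rewrite (_ : r^-1 = 1 - r'^-1)%R; last by rewrite -h addrK.
by rewrite opprB mulrBl mulVf ?mul1r// gt_eqF.
Qed.

(** On a cube the maximal function of the dual weight restricted to it is at
    least the average of the dual weight there. *)
Lemma Ainfty_ge1 : 1 <= Ainfty_const (dual_weight r w).
Proof.
pose Q : set (Rn R n) := cube [tuple 0%R | _ < n] 1.
have cQ : cubes Q by exists [tuple 0%R | _ < n], 1%R.
have mQ := cubes_measurable cQ; have [V V0 VE] := cubes_lebesgue cQ.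
pose sg := dual_weight r w.
have sg0 x : 0 <= sg x by exact: ltW (dual_weight_gt0 x).
have [a a0 aE] : exists2 a : R, (0 < a)%R & \int[mu]_(x in Q) sg x = a%:E.
  have := integral_dual_gt0 cQ; have := fin cQ; rewrite -/sg.
  by move: (\int[mu]_(x in Q) sg x) => [a| |]// _; rewrite lte_fin => a0; exists a.
apply: (@le_trans _ _ ((\int[mu]_(x in Q) sg x)^-1 *
    \int[mu]_(x in Q) HL_maximal_cubes (sg \_ Q) x)); last first.
  by apply: ereal_sup_ubound; exists Q.
rewrite aE inver gt_eqF// lee_pdivlMl// mule1.
have -> : a%:E = \int[mu]_(x in Q) (cst (V^-1 * a)%:E) x.
  transitivity ((V^-1 * a)%:E * mu Q); last exact: esym (integral_cst _ mQ _).
  by rewrite VE -EFinM mulrAC mulVf ?mul1r// gt_eqF.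
apply: ge0_le_integral_any => x Qx; first by rewrite lee_fin mulr_ge0 ?invr_ge0// ltW.
apply: (@le_trans _ _ (average Q (fun y => `|(sg \_ Q) y|))); last first.
  by apply: ereal_sup_ubound; exists Q.
rewrite /average VE inver gt_eqF// EFinM -aE; apply: lee_wpmul2l.
  by rewrite lee_fin invr_ge0 ltW.
apply: ge0_le_integral_any => y Qy; first exact: sg0.
by rewrite /patch mem_set ?gee0_abs.
Qed.

Definition dyadic_dual t i := fine (\int[mu]_(y in dyadic_cube t i) (real_dual y)%:E).

Lemma dyadic_hull_dual t i :
  \int[mu]_(y in dyadic_hull t i) dual_weight r w y = (dyadic_dual t i)%:E.
Proof.
have cH := @dyadic_hull_cubes R n t i; have mH := cubes_measurable cH.
have mD := @measurable_dyadic_cube R n t i.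
have hull_eq : \int[mu]_(y in dyadic_hull t i) dual_weight r w y =
    \int[mu]_(y in dyadic_cube t i) (real_dual y)%:E.
  rewrite -integral_real_dual//.
  rewrite (ge0_negligible_integral _ _ _ _ (dyadic_hull_null t i))//.
  - by rewrite setDD setIidr//; exact: dyadic_cube_hull.
  - exact: measurableD.
  - exact: measurable_funTS measurable_dual_weight.
  - by move=> x _; exact: ltW (dual_weight_gt0 x).
rewrite hull_eq /dyadic_dual fineK// ge0_fin_numE -?hull_eq; first exact: fin.
by apply: integral_ge0 => y _; rewrite ltW ?dual_weight_gt0.
Qed.

Lemma dyadic_dualE t i :
  \int[mu]_(y in dyadic_cube t i) (real_dual y)%:E = (dyadic_dual t i)%:E.
Proof.
rewrite /dyadic_dual fineK// ge0_fin_numE; last first.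
  by apply: integral_ge0 => y _; rewrite lee_fin real_dual_ge0.
rewrite -integral_real_dual; last exact: measurable_dyadic_cube.
apply: le_lt_trans (fin (@dyadic_hull_cubes R n t i)).
apply: ge0_subset_integral_any; last exact: dyadic_cube_hull.
by move=> x; exact: ltW (dual_weight_gt0 x).
Qed.

Lemma dyadic_dual_gt0 t i : (0 < dyadic_dual t i)%R.
Proof. by rewrite -lte_fin -dyadic_hull_dual integral_dual_gt0//; exact: dyadic_hull_cubes. Qed.

(** Take for [H] the maximal function of the dual weight cut off to the closed
    cube: the averages over its subcubes belong to the supremum, and the
    Fujii-Wilson constant bounds its integral. *)
Lemma Ainfty_dominates t (j : int * n.-tuple int) (B : R) :
    Ainfty_const (dual_weight r w) <= B%:E ->
  exists H : Rn R n -> \bar R, [/\ forall x, 0 <= H x,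
    forall i (x : Rn R n), dyadic_cube t i `<=` (dyadic_cube t j : set (Rn R n)) ->
      dyadic_cube t i x -> (dyadic_dual t i / ((2 : R) ^ i.1) ^+ n)%:E <= H x &
    \int[mu]_(x in dyadic_cube t j) H x <= (B * dyadic_dual t j)%:E].
Proof.
move=> AB; pose sg := dual_weight r w.
have sg0 x : 0 <= sg x by exact: ltW (dual_weight_gt0 x).
have cH := @dyadic_hull_cubes R n t j; have mH := cubes_measurable cH.
pose sgj := sg \_ (dyadic_hull t j).
have sgj0 x : 0 <= sgj x by rewrite /sgj /patch; case: ifPn.
exists (HL_maximal_cubes sgj); have M0 x : 0 <= HL_maximal_cubes sgj x.
  apply: (@le_trans _ _ (average (cube x 1) (fun y => `|sgj y|))).
    by apply: average_ge0.
  apply: ereal_sup_ubound; exists (cube x 1) => //; split; first by exists x, 1%R.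
  by move=> i; rewrite lexx lerDl ler01.
split => //.
  move=> i x ij ix; apply: (@le_trans _ _ (average (dyadic_hull t i) (fun y => `|sgj y|))).
    rewrite /average lebesgue_cube ?exprz_gt0// inver gt_eqF ?exprn_gt0 ?exprz_gt0//.
    rewrite mulrC EFinM; apply: lee_wpmul2l.
      by rewrite lee_fin invr_ge0 exprn_ge0// exprz_ge0.
    rewrite -dyadic_dualE -integral_real_dual; last exact: measurable_dyadic_cube.
    apply: (@le_trans _ _ (\int[mu]_(y in dyadic_cube t i) `|sgj y|)).
      apply: ge0_le_integral_any => y iy; first exact: sg0.
      by rewrite /sgj /patch mem_set ?gee0_abs//; exact/dyadic_cube_hull/ij.
    by apply: ge0_subset_integral_any => //; exact: dyadic_cube_hull.
  apply: ereal_sup_ubound; exists (dyadic_hull t i) => //.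
  by split; [exact: dyadic_hull_cubes|exact: dyadic_cube_hull].
apply: (@le_trans _ _ (\int[mu]_(x in dyadic_hull t j) HL_maximal_cubes sgj x)).
  by apply: ge0_subset_integral_any => //; exact: dyadic_cube_hull.
have := le_trans (ereal_sup_ubound _) AB.
move=> /(_ _ (ex_intro2 _ _ _ cH erefl)); rewrite -/sg -/sgj dyadic_hull_dual.
have s0 := dyadic_dual_gt0 t j.
by rewrite inver gt_eqF// lee_pdivrMl// -EFinM mulrC.
Qed.

End dual_weights.

(** * The multilinear weight class *)

Section weight_class.
Context {R : realType} {n m : nat}.
Hypothesis m0 : (0 < m)%N.
Local Notation mu := (lebesgue_Rn R n).
Variables (r : 'I_m -> R) (w : 'I_m -> Rn R n -> R).
Hypothesis r1 : forall k, 1 < r k.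
Hypothesis mw : forall k, measurable_fun setT (w k).
Hypothesis w0 : forall k x, 0 <= w k x.

Lemma sum_inv_exponent_gt0 : 0 < \sum_(k < m) (r k)^-1.
Proof.
have rV k : 0 < (r k)^-1 by rewrite invr_gt0 (lt_trans _ (r1 k)).
by rewrite (bigD1 (Ordinal m0))//= ltr_wpDr// sumr_ge0// => k _; exact: ltW.
Qed.

Lemma sum_exponent_gt0 : 0 < sum_exponent r.
Proof. by rewrite invr_gt0 sum_inv_exponent_gt0. Qed.

Lemma sum_exponent_ratio : \sum_(k < m) sum_exponent r / r k = 1.
Proof. by rewrite -mulr_sumr mulVf// gt_eqF// sum_inv_exponent_gt0. Qed.

Lemma nu_weight_ge0 x : 0 <= nu_weight r w x.
Proof. by rewrite prodr_ge0// => k _; exact: powR_ge0. Qed.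

Lemma measurable_nu_weight : measurable_fun setT (nu_weight r w).
Proof.
apply: measurable_prod => k _; exact: (measurableT_comp (measurable_powR _)).
Qed.

Local Open Scope ereal_scope.

Let e k : R := (sum_exponent r / conj_exponent (r k)%:E)%R.

Let e0 k : (0 < e k)%R.
Proof.
by rewrite divr_gt0 ?sum_exponent_gt0// (lt_trans _ (conj_exponent_gt1 (r1 k))).
Qed.

Hypothesis Aw : A_class r w.

Let A_cube Q : cubes Q ->
  \prod_(k < m) average Q (dual_weight (r k) (w k)) `^ e k *
    average Q (fun x => (nu_weight r w x)%:E) <= A_const r w.
Proof. by move=> cQ; apply: ereal_sup_ubound; exists Q. Qed.

Let dual_average_gt0 Q k : cubes Q ->
  0 < average Q (dual_weight (r k) (w k)) `^ e k.
Proof.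
by move=> cQ; apply: poweR_gt0; apply: average_gt0 => //; exact: integral_dual_gt0.
Qed.

(** The dual averages are positive because a finite weight has a positive
    negative power; so finiteness of the product controls the other factor. *)
Lemma nu_weight_lty Q : cubes Q -> \int[mu]_(x in Q) (nu_weight r w x)%:E < +oo.
Proof.
move=> cQ; rewrite ltey; apply/eqP => nuy.
have := le_lt_trans (A_cube cQ) Aw.
rewrite (average_infinite cQ nuy) gt0_muley ?ltxx//.
by apply: prode_gt0 => k; exact: dual_average_gt0.
Qed.

Variable Q0 : set (Rn R n).
Hypothesis cQ0 : cubes Q0.
Hypothesis nuQ0 : \int[mu]_(x in Q0) (nu_weight r w x)%:E != 0.

(** Every cube lies in one that contains [Q0], where the product weight has
    positive mass; all other factors of the finite product being positive, none
    can be infinite. *)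
Lemma dual_weight_lty k Q : cubes Q ->
  \int[mu]_(x in Q) dual_weight (r k) (w k) x < +oo.
Proof.
move=> cQ; have [Q1 [cQ1 QQ1 Q0Q1]] := cubes_sub_cube cQ cQ0.
have d0 x : 0 <= dual_weight (r k) (w k) x by exact: ltW (dual_weight_gt0 _ _ _).
apply: (le_lt_trans (ge0_subset_integral_any mu d0 QQ1)).
have nu1 : 0 < \int[mu]_(x in Q1) (nu_weight r w x)%:E.
  have nu0 x : 0 <= (nu_weight r w x)%:E by rewrite lee_fin nu_weight_ge0.
  apply: lt_le_trans (ge0_subset_integral_any mu nu0 Q0Q1).
  by rewrite lt_neqAle eq_sym nuQ0 integral_ge0.
rewrite ltey; apply/eqP => dy.
have := le_lt_trans (A_cube cQ1) Aw.
rewrite (@prode_infinite _ _ k); first by rewrite gt0_mulye ?ltxx//; exact: average_gt0.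
- by move=> i; exact: dual_average_gt0.
- by rewrite (average_infinite cQ1 dy); apply: poweRyr; rewrite gt_eqF.
Qed.

End weight_class.

(** * The multilinear maximal function *)

Section multilinear_maximal.
Context {R : realType} {n m : nat}.
Hypothesis m0 : (0 < m)%N.
Local Notation mu := (lebesgue_Rn R n).
Local Open Scope ereal_scope.

Definition multilinear_maximal (g : 'I_m -> Rn R n -> R) (x : Rn R n) : \bar R :=
  ereal_sup [set \prod_(k < m) average Q (fun y => (g k y)%:E) |
    Q in [set Q | cubes Q /\ Q x]].

Lemma multilinear_maximal_ge0 g x : (forall k y, 0 <= g k y)%R ->
  0 <= multilinear_maximal g x.
Proof.
move=> g0; apply: (@le_trans _ _ (\prod_(k < m) average (cube x 1) (fun y => (g k y)%:E))).
  by apply: prode_ge0 => k _; apply: average_ge0 => y; rewrite lee_fin.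
apply: ereal_sup_ubound; exists (cube x 1) => //; split; first by exists x, 1%R.
by move=> i; rewrite lexx lerDl ler01.
Qed.

Variables (r : 'I_m -> R) (w g : 'I_m -> Rn R n -> R).
Hypothesis r1 : forall k, (1 < r k)%R.
Hypothesis mw : forall k, measurable_fun setT (w k).
Hypothesis w0 : forall k x, (0 <= w k x)%R.
Hypothesis mg : forall k, measurable_fun setT (g k).
Hypothesis g0 : forall k x, (0 <= g k x)%R.
Variables (A : R) (B F : 'I_m -> R) (Q0 : set (Rn R n)).
Hypothesis AE : A_const r w = A%:E.
Hypothesis BE : forall k, Ainfty_const (dual_weight (r k) (w k)) = (B k)%:E.
Hypothesis FE : forall k, \int[mu]_x (g k x `^ r k * w k x)%:E = (F k)%:E.
Hypothesis cQ0 : cubes Q0.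
Hypothesis nuQ0 : \int[mu]_(x in Q0) (nu_weight r w x)%:E != 0.

Let rho := sum_exponent r.
Let nu := nu_weight r w.
Let rho0 : (0 < rho)%R. Proof. exact: sum_exponent_gt0. Qed.

Let Aw : A_class r w. Proof. by rewrite /A_class AE ltry. Qed.

Let dual_lty k := @dual_weight_lty R n m m0 r w r1 mw w0 Aw Q0 cQ0 nuQ0 k.

Let g_lty k Q : cubes Q -> \int[mu]_(x in Q) (g k x)%:E < +oo.
Proof.
move=> cQ; have mQ := cubes_measurable cQ.
apply: (le_lt_trans (integral_cube_weighted (r1 k) (mw k) (w0 k) (dual_lty k) cQ (mg k) (g0 k))).
apply: lte_mul_pinfty; first exact: poweR_ge0.
  by rewrite FE fin_num_poweR.
apply: poweR_lty.
by rewrite -(integral_real_dual (r1 k) (mw k) (w0 k) (dual_lty k))//; exact: dual_lty.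
Qed.

Let B0 k : (0 <= B k)%R.
Proof.
rewrite -lee_fin -BE; apply: le_trans (Ainfty_ge1 (r1 k) (mw k) (w0 k) (dual_lty k)).
exact: lee01.
Qed.

Section one_grid.
Variable t : n.-tuple bool.

Let I := (int * n.-tuple int)%type.
Let Q (i : I) : set (Rn R n) := dyadic_cube t i.
Let V (i : I) : R := ((2 ^ i.1) ^+ n)%R.
Let S k (i : I) : R := @dyadic_dual R n (r k) (w k) t i.
Let G k (i : I) : R := fine (\int[mu]_(x in Q i) (g k x)%:E).
Let N (i : I) : R := fine (\int[mu]_(x in Q i) (nu x)%:E).

Let V0 i : (0 < V i)%R. Proof. by rewrite exprn_gt0// exprz_gt0. Qed.

Let Q_hull (f : Rn R n -> \bar R) i : (forall x, 0 <= f x) ->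
  \int[mu]_(x in Q i) f x <= \int[mu]_(x in dyadic_hull t i) f x.
Proof. by move=> f0; apply: ge0_subset_integral_any => //; exact: dyadic_cube_hull. Qed.

Let GE k i : \int[mu]_(x in Q i) (g k x)%:E = (G k i)%:E.
Proof.
have g0' x : 0 <= (g k x)%:E by rewrite lee_fin.
rewrite /G fineK// ge0_fin_numE ?integral_ge0//.
exact: le_lt_trans (Q_hull i g0') (g_lty k (@dyadic_hull_cubes R n t i)).
Qed.

Let nu0 x : (0 <= nu x)%R. Proof. exact: nu_weight_ge0. Qed.

Let NE i : \int[mu]_(x in Q i) (nu x)%:E = (N i)%:E.
Proof.
have nu0' x : 0 <= (nu x)%:E by rewrite lee_fin.
rewrite /N fineK// ge0_fin_numE ?integral_ge0//.
apply: le_lt_trans (Q_hull i nu0') _.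
exact: (nu_weight_lty r1 mw w0 Aw (@dyadic_hull_cubes R n t i)).
Qed.

Let dualE k i : \int[mu]_(x in Q i) (w k x `^ (1 - conj_exponent (r k)%:E))%:E = (S k i)%:E.
Proof. exact: (dyadic_dualE (r1 k) (mw k) (w0 k) (dual_lty k)). Qed.

Let S0 k i : (0 < S k i)%R.
Proof. exact: (dyadic_dual_gt0 (r1 k) (mw k) (w0 k) (dual_lty k)). Qed.

Let Abound i :
  ((\prod_(k < m) (S k i / V i) `^ (rho / conj_exponent (r k)%:E)) * (N i / V i) <= A)%R.
Proof.
have cH := @dyadic_hull_cubes R n t i.
have VE : mu (dyadic_hull t i) = (V i)%:E by rewrite lebesgue_cube// exprz_gt0.
rewrite -lee_fin -AE EFinM.
apply: (@le_trans _ _ (\prod_(k < m) average (dyadic_hull t i) (dual_weight (r k) (w k))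
     `^ (rho / conj_exponent (r k)%:E)%R *
   average (dyadic_hull t i) (fun x => (nu x)%:E))).
  apply: lee_pmul.
  - by rewrite lee_fin prodr_ge0// => k _; exact: powR_ge0.
  - rewrite lee_fin divr_ge0 ?(ltW (V0 i))// /N fine_ge0// integral_ge0// => x _.
    by rewrite lee_fin.
  - rewrite -prodEFin le_eqVlt; apply/orP; left; apply/eqP; apply: eq_bigr => k _.
    rewrite /average VE (dyadic_hull_dual (r1 k) (mw k) (w0 k) (dual_lty k)).
    by rewrite inver gt_eqF// -EFinM poweR_EFin mulrC.
  - rewrite /average VE inver gt_eqF// mulrC EFinM -NE; apply: lee_wpmul2l.
      by rewrite lee_fin invr_ge0 ltW.
    by apply: Q_hull => x; rewrite lee_fin.
by apply: ereal_sup_ubound; exists (dyadic_hull t i).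
Qed.

Let A0 : (0 <= A)%R.
Proof.
apply: le_trans (Abound (0, [tuple 0 | _ < n])%R).
rewrite mulr_ge0//; first by rewrite prodr_ge0// => k _; exact: powR_ge0.
by rewrite divr_ge0 ?(ltW (V0 _))// /N fine_ge0// integral_ge0// => x _; rewrite lee_fin.
Qed.

Definition dyadic_product t (i : I) : R :=
  (\prod_(k < m) (fine (\int[mu]_(x in dyadic_cube t i) (g k x)%:E) / (2 ^ i.1) ^+ n))%R.

Lemma one_grid_bound (L : nat) :
  \int[mu]_x (list_max (dyadic_cube t) (dyadic_list L)
      (fun i => dyadic_product t i `^ rho)%R x * nu x)%:E
  <= (2 `^ (m%:R * rho) * A *
    \prod_(k < m) (average_sum_const (r k) * B k * F k) `^ (rho / r k))%:E.
Proof.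
have mQ i : measurable (Q i) by exact: measurable_dyadic_cube.
have VE i : mu (Q i) = (V i)%:E by exact: lebesgue_dyadic_cube.
have wn0 k : {ae mu, forall x, w k x != 0%R}.
  exact: (weight_neq0_ae (r1 k) (mw k) (dual_lty k)).
have carl k j : exists H : Rn R n -> \bar R, [/\ (forall x, 0 <= H x)%E,
    (forall i x, Q i `<=` Q j -> Q i x -> (S k i / V i)%:E <= H x)%E &
    (\int[mu]_(x in Q j) H x <= (B k * S k j)%:E)%E].
  apply: (Ainfty_dominates (r1 k) (mw k) (w0 k) (dual_lty k) t j).
  by rewrite BE.
have K0 : (0 < #|'I_m|)%N by rewrite card_ord.
have c0 k : (0 < conj_exponent (r k)%:E)%R by rewrite (lt_trans _ (conj_exponent_gt1 (r1 k))).
have := finite_maximal_bound mQ VE V0 K0 mg g0 GE r1 c0 (fun k => conj_exponentD (r1 k))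
  mw w0 wn0 dualE S0 B0 carl FE rho0 (sum_exponent_ratio m0 r1)
  (measurable_nu_weight r mw) nu0 NE A0 Abound (dyadic_list_laminar t L).
by rewrite card_ord.
Qed.

End one_grid.

Let nu0 x : (0 <= nu x)%R. Proof. exact: nu_weight_ge0. Qed.

Let dyadic_product_ge0 t i : (0 <= dyadic_product t i)%R.
Proof.
rewrite prodr_ge0// => k _; rewrite divr_ge0 ?exprn_ge0 ?exprz_ge0//.
by rewrite fine_ge0// integral_ge0// => x _; rewrite lee_fin.
Qed.

(** Enlarging a cube to a dyadic one whose side is at most six times larger
    costs at most a factor [6 ^+ n] in each of the [m] averages. *)
Let average_le_dyadic Q x : cubes Q -> Q x -> exists t (i : int * n.-tuple int),
  dyadic_cube t i x /\
  \prod_(k < m) average Q (fun y => (g k y)%:E) <=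
    ((6 ^+ n) ^+ m * dyadic_product t i)%:E.
Proof.
move=> cQ Qx; have [a [l l0 QE]] := cQ.
have [t [i [Qi i6]]] := dyadic_cover a l0.
have VQ : mu Q = (l ^+ n)%:E by rewrite QE lebesgue_cube.
have V0 : (0 < l ^+ n)%R by rewrite exprn_gt0.
have k0 : (0 < (2 : R) ^ i.1)%R by rewrite exprz_gt0.
exists t, i; split; first by apply: Qi; rewrite -QE.
have -> : ((6 ^+ n) ^+ m = \prod_(k < m) (6 ^+ n) :> R)%R by rewrite prodr_const card_ord.
rewrite /dyadic_product -big_split -prodEFin/=.
have avg k : 0 <= average Q (fun y => (g k y)%:E) <=
    (6 ^+ n * (fine (\int[mu]_(y in dyadic_cube t i) (g k y)%:E) / (2 ^ i.1) ^+ n))%:E.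
  have g0' y : 0 <= (g k y)%:E by rewrite lee_fin.
  rewrite average_ge0//=.
  have gfin : \int[mu]_(y in dyadic_cube t i) (g k y)%:E \is a fin_num.
    rewrite ge0_fin_numE ?integral_ge0//.
    apply: le_lt_trans (g_lty k (@dyadic_hull_cubes R n t i)).
    by apply: ge0_subset_integral_any => //; exact: dyadic_cube_hull.
  rewrite /average VQ inver gt_eqF// lee_pdivrMl//.
  apply: (@le_trans _ _ (\int[mu]_(y in dyadic_cube t i) (g k y)%:E)).
    by apply: ge0_subset_integral_any => //; rewrite QE.
  rewrite -[leLHS]fineK// -EFinM lee_fin.
  set G := fine _; have G0 : (0 <= G)%R by rewrite fine_ge0// integral_ge0.
  rewrite (_ : _ * _ = G * ((6 * l) ^+ n / (2 ^ i.1) ^+ n))%R; last by rewrite exprMn; ring.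
  rewrite ler_peMr// ler_pdivlMr ?exprn_gt0// mul1r.
  by apply: lerXn2r => //; rewrite nnegrE; [exact: ltW|rewrite mulr_ge0// ltW].
by apply: lee_prod.
Qed.

(** The first factor comes from the covering by dyadic cubes, the second counts
    the grids, and the third is the constant for a finite family in one grid. *)
Definition maximal_const : R :=
  (((6 ^+ n) ^+ m) `^ rho * #|{: n.-tuple bool}|%:R *
   (2 `^ (m%:R * rho) * \prod_(k < m) average_sum_const (r k) `^ (rho / r k)))%R.

Let L (N : nat) (t : n.-tuple bool) (x : Rn R n) : R :=
  list_max (dyadic_cube t) (dyadic_list N) (fun i => dyadic_product t i `^ rho)%R x.

Let L0 N t x : (0 <= L N t x)%R. Proof. exact: list_max_ge0. Qed.

Let mL N t : measurable_fun setT (L N t).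
Proof. by apply: measurable_list_max => i; exact: measurable_dyadic_cube. Qed.

Let ndL N N' t x : (N <= N')%N -> (L N t x <= L N' t x)%R.
Proof.
move=> NN'; apply: list_max_le => // i il ix.
by apply: le_list_max ix; exact: dyadic_list_sub il.
Qed.

(** The maximal function is dominated by the sum of the dyadic ones, which are
    limits of maxima over finite families. *)
Lemma multilinear_maximal_bound :
  \int[mu]_x (multilinear_maximal g x `^ rho * (nu x)%:E) <=
  (maximal_const * A * \prod_(k < m) (B k * F k) `^ (rho / r k))%:E.
Proof.
have rhon0 : rho != 0%R by rewrite gt_eqF.
pose c : R := (((6 ^+ n) ^+ m) `^ rho)%R.
have c0 : (0 <= c)%R by exact: powR_ge0.
pose phi N x := (\sum_(t : n.-tuple bool) L N t x)%R.
have phi0 N x : (0 <= phi N x)%R by rewrite sumr_ge0.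
have ndphi x : nondecreasing_seq (fun N => (phi N x)%:E).
  by move=> N N' NN'; rewrite lee_fin; apply: ler_sum => t _; exact: ndL.
pose lam x := limn (fun N => (phi N x)%:E).
have cvgphi x := ereal_nondecreasing_is_cvgn (ndphi x).
have phi_lam N x : (phi N x)%:E <= lam x.
  rewrite /lam (cvg_lim (@ereal_hausdorff R) (ereal_nondecreasing_cvgn (ndphi x))).
  by apply: ereal_sup_ubound; exists N.
have lam0 x : 0 <= lam x by apply: le_trans (phi_lam 0%N x); rewrite lee_fin.
(* A supremum is bounded termwise, so the power [rho] is first moved to the other
   side and then back. *)
have pointwise x : multilinear_maximal g x `^ rho <= c%:E * lam x.
  have clam0 : 0 <= c%:E * lam x by rewrite mule_ge0// lee_fin.
  rewrite -(poweRVK clam0 rhon0).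
  apply: le_poweR; [exact: ltW|exact: multilinear_maximal_ge0|].
  apply: ge_ereal_sup => _ [Q [cQ Qx] <-].
  have [t [i [ix Qi]]] := average_le_dyadic cQ Qx.
  have P0 : 0 <= \prod_(k < m) average Q (fun y => (g k y)%:E).
    by apply: prode_ge0 => k _; apply: average_ge0 => y; rewrite lee_fin.
  rewrite -(poweRK P0 rhon0).
  apply: le_poweR; [by rewrite invr_ge0 ltW|exact: poweR_ge0|].
  apply: (le_trans (le_poweR (ltW rho0) P0 Qi)).
  rewrite poweR_EFin powRM ?exprn_ge0// -/c EFinM.
  apply: lee_wpmul2l; first by rewrite lee_fin.
  apply: le_trans (phi_lam (pickle i).+1 x); rewrite lee_fin.
  apply: (@le_trans _ _ (L (pickle i).+1 t x)).
    by apply: le_list_max ix; exact: mem_dyadic_list.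
  by rewrite /phi (bigD1 t)//= lerDl sumr_ge0.
pose h N x := ((phi N x)%:E * (c * nu x)%:E).
have h0 N x : 0 <= h N x by rewrite mule_ge0// lee_fin// mulr_ge0.
have mh N : measurable_fun setT (h N).
  apply: emeasurable_funM; apply/measurable_EFinP.
    by apply: measurable_sum => t; exact: mL.
  by apply: measurable_funM => //; exact: measurable_nu_weight.
have ndh x : nondecreasing_seq (h ^~ x).
  by move=> N N' NN'; apply: lee_wpmul2r; [rewrite lee_fin mulr_ge0|exact: ndphi].
have limh x : limn (h ^~ x) = lam x * (c * nu x)%:E.
  by apply/cvg_lim => //; apply: cvgeZr => //; exact: cvgphi.
apply: (@le_trans _ _ (\int[mu]_x limn (h ^~ x))).
  apply: ge0_le_integral_any => x _.
    by rewrite mule_ge0 ?poweR_ge0// lee_fin.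
  rewrite limh EFinM muleA [lam x * _]muleC.
  by apply: lee_wpmul2r; [rewrite lee_fin|exact: pointwise].
rewrite (@monotone_convergence _ _ _ mu setT measurableT h)//.
apply: lime_le.
  apply: ereal_nondecreasing_is_cvgn => N N' NN'.
  by apply: ge0_le_integral => // x _; exact: ndh.
apply: nearW => N.
pose b : R := (2 `^ (m%:R * rho) * A *
    \prod_(k < m) (average_sum_const (r k) * B k * F k) `^ (rho / r k))%R.
have -> : \int[mu]_x h N x = c%:E * \sum_(t : n.-tuple bool) \int[mu]_x (L N t x * nu x)%:E.
  rewrite -ge0_integral_sum//.
  - rewrite -ge0_integralZl//.
    + apply: eq_integral => x _; rewrite /h -EFinM /phi sumEFin -EFinM; congr _%:E.
      by rewrite mulrCA mulr_suml.
    + apply: emeasurable_sum => t; apply/measurable_EFinP; apply: measurable_funM => //.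
      exact: measurable_nu_weight.
    + by move=> x _; apply: sume_ge0 => t _; rewrite lee_fin mulr_ge0.
  - move=> t; apply/measurable_EFinP; apply: measurable_funM => //.
    exact: measurable_nu_weight.
  - by move=> t x _; rewrite lee_fin mulr_ge0.
apply: (@le_trans _ _ (c%:E * \sum_(t : n.-tuple bool) b%:E)).
  apply: lee_wpmul2l; first by rewrite lee_fin.
  by apply: lee_sum => t _; exact: one_grid_bound.
rewrite sumEFin sumr_const -EFinM lee_fin le_eqVlt; apply/orP; left; apply/eqP.
have E : (\prod_(k < m) (average_sum_const (r k) * B k * F k) `^ (rho / r k) =
  \prod_(k < m) average_sum_const (r k) `^ (rho / r k) *
  \prod_(k < m) (B k * F k) `^ (rho / r k))%R.
  rewrite -big_split/=; apply: eq_bigr => k _.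
  rewrite -mulrA powRM//.
    by rewrite !mulr_ge0// powR_ge0.
  by rewrite mulr_ge0// -lee_fin -FE integral_ge0// => x _; rewrite lee_fin mulr_ge0// powR_ge0.
by rewrite /maximal_const -/c /b E -mulr_natl; ring.
Qed.

End multilinear_maximal.

(** * The rough maximal operator *)

Section rough_maximal_bound.
Context {R : realType} {n m : nat}.
Hypothesis n0 : (0 < n)%N.
Local Notation mu := (lebesgue_Rn R n).
Local Open Scope ereal_scope.
Implicit Types (Omega : m.-tuple (Rn R n) -> R) (f : 'I_m -> Rn R n -> R).

(** The norm of infinite exponent is an essential supremum, so the case
    [s = +oo] is separate; there the conjugate exponent is one. *)
Lemma rough_average_bound (s : \bar R) : 1 < s -> exists2 K : R, (0 < K)%R &
  forall Omega f (a x : Rn R n) (l : R),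
    function_of_directions Omega -> Ls_sphere s Omega ->
    (forall i, measurable_fun setT (f i)) -> (0 < l)%R -> cube a l x ->
  (mu (cube a l) ^+ m)^-1 *
    \int[tuple_measure mu m]_(v in [set v | forall i, cube a l (tnth v i)])
     (`|Omega (map_tuple (vsub x) v)| * \prod_(i < m) `|f i (tnth v i)|)%:E <=
  K%:E * sphere_norm s Omega *
    \prod_(i < m) average (cube a l) (fun y => (`|f i y| `^ conj_exponent s)%:E)
      `^ (conj_exponent s)^-1.
Proof.
have VE (a : Rn R n) (l : R) (X : \bar R) : (0 < l)%R ->
    (mu (cube a l) ^+ m)^-1 * X = ((l ^+ n) ^+ m)^-1%:E * X.
  move=> l0; rewrite lebesgue_cube// -EFin_expe inver gt_eqF//.
  by rewrite !exprn_gt0.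
case: s => [r|_|]; last by rewrite ltNge leNye.
- rewrite lte_fin => r1; exists (((Num.sqrt n%:R ^+ n) ^+ m) `^ r^-1)%R.
    by rewrite powR_gt0// !exprn_gt0// sqrtr_gt0 ltr0n.
  move=> Omega f a x l dO LO mf l0 ax; rewrite VE//.
  have V0 : (0 < (l ^+ n) ^+ m)%R by rewrite !exprn_gt0.
  rewrite lee_pdivrMl//.
  have r'0 : (0 < conj_exponent r%:E)%R by rewrite (lt_trans _ (conj_exponent_gt1 r1)).
  apply: (le_trans (rough_average_finite n0 r1 r'0 (conj_exponentD r1) dO LO mf l0 ax)).
  by rewrite mulrC EFinM !muleA lexx.
- exists 1%R => // Omega f a x l dO LO mf l0 ax; rewrite VE//.
  have V0 : (0 < (l ^+ n) ^+ m)%R by rewrite !exprn_gt0.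
  rewrite lee_pdivrMl// mul1e conj_exponent_infinite invr1.
  apply: (le_trans (rough_average_infinite n0 dO LO mf l0 ax)).
  rewrite muleA le_eqVlt; apply/orP; left; apply/eqP; congr (_ * _).
  apply: eq_bigr => i _; rewrite poweRe1.
    by congr average; apply/funext => y; rewrite powRr1.
  by apply: average_ge0 => y; rewrite lee_fin powR_ge0.
Qed.

Lemma rough_maximal_ge0 Omega f x : 0 <= rough_maximal Omega f x.
Proof.
have cQ : cubes (cube x 1) by exists x, 1%R.
have Qx : cube x 1 x by move=> i; rewrite lexx lerDl ler01.
apply: le_trans (_ : 0 <= (mu (cube x 1) ^+ m)^-1 *
   \int[tuple_measure mu m]_(v in [set v | forall i, cube x 1 (tnth v i)])
   (`|Omega (map_tuple (vsub x) v)| * \prod_(i < m) `|f i (tnth v i)|)%:E) _.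
  rewrite mule_ge0// ?inve_ge0 ?expe_ge0//.
  by apply: integral_ge0 => v _; rewrite lee_fin mulr_ge0// prodr_ge0.
by apply: ereal_sup_ubound; exists (cube x 1).
Qed.

(** The bound on averages is uniform in the cube, so it passes to the supremum
    that defines the operator. *)
Lemma rough_maximal_le (s : \bar R) : 1 < s -> exists2 K : R, (0 < K)%R &
  forall Omega f (x : Rn R n),
    function_of_directions Omega -> Ls_sphere s Omega ->
    (forall i, measurable_fun setT (f i)) ->
  rough_maximal Omega f x <= K%:E * sphere_norm s Omega *
    multilinear_maximal (fun i y => `|f i y| `^ conj_exponent s)%R x
      `^ (conj_exponent s)^-1.
Proof.
move=> s1; have [K K0 bound] := rough_average_bound s1; exists K => // Omega f x dO LO mf.
have s'1 := conj_exponent_ge1 s1.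
apply: ge_ereal_sup => _ [Q [[a [l l0 ->]] Qx] <-].
apply: (le_trans (bound _ _ _ _ _ dO LO mf l0 Qx)).
apply: lee_wpmul2l; first by rewrite mule_ge0 ?lee_fin ?(ltW K0)//; exact: Lnorm_ge0.
have g0 i (y : Rn R n) : 0 <= (`|f i y| `^ conj_exponent s)%:E by rewrite lee_fin powR_ge0.
rewrite -poweR_prod; last by move=> i; exact: average_ge0.
apply: le_poweR; first by rewrite invr_ge0 (le_trans _ s'1).
  by apply: prode_ge0 => i _; exact: average_ge0.
apply: ereal_sup_ubound; exists (cube a l) => //; split => //.
by exists a, l.
Qed.

End rough_maximal_bound.

Section rough_maximal_theorem.
Context {R : realType} {n m : nat}.
Local Notation mu := (lebesgue_Rn R n).
Local Open Scope ereal_scope.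

Lemma weighted_normE (r : R) (w f : Rn R n -> R) :
  weighted_norm r w (EFin \o f) = (\int[mu]_x (`|f x| `^ r * w x)%:E) `^ r^-1.
Proof. by rewrite /weighted_norm; under eq_integral do rewrite /= -EFinM. Qed.

Lemma sum_exponent_div (P : 'I_m -> R) (c : R) : c != 0%R ->
  sum_exponent (fun i => P i / c)%R = (sum_exponent P / c)%R.
Proof.
move=> c0; rewrite /sum_exponent -invfM; congr (_^-1)%R.
by rewrite mulr_suml; apply: eq_bigr => i _; rewrite invf_div mulrC.
Qed.

Lemma nu_weight_div (P : 'I_m -> R) (c : R) (w : 'I_m -> Rn R n -> R) : c != 0%R ->
  nu_weight (fun i => P i / c)%R w = nu_weight P w.
Proof.
move=> c0; apply/funext => x; apply: eq_bigr => i _; congr (_ `^ _)%R.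
rewrite sum_exponent_div//; move: (sum_exponent P) => S.
by rewrite invf_div mulrA divfK.
Qed.

Lemma A_const_gt0 (r : 'I_m -> R) (w : 'I_m -> Rn R n -> R) Q0 :
  (forall k, 1 < r k)%R -> (forall k, measurable_fun setT (w k)) ->
  (forall k x, 0 <= w k x)%R -> cubes Q0 ->
  \int[mu]_(x in Q0) (nu_weight r w x)%:E != 0 -> 0 < A_const r w.
Proof.
move=> r1 mw w0 cQ0 nuQ0.
apply: (@lt_le_trans _ _ (\prod_(k < m) average Q0 (dual_weight (r k) (w k))
     `^ (sum_exponent r / conj_exponent (r k)%:E)%R *
   average Q0 (fun x => (nu_weight r w x)%:E))); last first.
  by apply: ereal_sup_ubound; exists Q0.
apply: mule_gt0.
  apply: prode_gt0 => k; apply: poweR_gt0; apply: average_gt0 => //.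
  exact: integral_dual_gt0.
apply: average_gt0 => //; rewrite lt_neqAle eq_sym nuQ0 integral_ge0// => x _.
by rewrite lee_fin nu_weight_ge0.
Qed.

End rough_maximal_theorem.

Theorem theorem1p8 (R : realType) (n m : nat) (P : 'I_m -> R) (s : \bar R)
    (n_gt0 : (0 < n)%N) (m_gt0 : (0 < m)%N) (s_gt1 : (1 < s)%E)
    (P_gt : forall i : 'I_m, conj_exponent s < P i) :
  let s' := conj_exponent s in
  let p := sum_exponent P in
  let Ps : 'I_m -> R := fun i => P i / s' in
  exists C : R, 0 < C /\
    forall (Omega : m.-tuple (Rn R n) -> R)
      (w f : 'I_m -> Rn R n -> R),
      homogeneous_degree0 Omega ->
      function_of_directions Omega ->
      Ls_sphere s Omega ->
      (forall i, is_weight (w i)) ->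
      A_class Ps w ->
      (forall i, locally_integrable_Rn (f i)) ->
      (weighted_norm p (nu_weight P w) (rough_maximal Omega f) <=
       C%:E * sphere_norm s Omega * A_const Ps w `^ p^-1 *
       (\prod_(i < m) Ainfty_const (dual_weight (Ps i) (w i)) `^ (P i)^-1) *
       (\prod_(i < m) weighted_norm (P i) (w i) (EFin \o f i)))%E.
Proof.
move=> s' p Ps.
have s'1 : 1 <= s' by exact: conj_exponent_ge1.
have s'0 : 0 < s' by exact: lt_le_trans s'1.
have s'n0 : s' != 0 by rewrite gt_eqF.
have P1 i : 1 < P i by exact: le_lt_trans s'1 (P_gt i).
have P0 i : 0 < P i by exact: lt_trans (P1 i).
have r1 i : 1 < Ps i by rewrite ltr_pdivlMr// mul1r.
have p0 : 0 < p by exact: sum_exponent_gt0.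
have pn0 : p != 0 by rewrite gt_eqF.
have pVn0 : p^-1 != 0 by exact: invr_neq0.
pose rho := sum_exponent Ps.
have rhoE : rho = p / s' by exact: sum_exponent_div.
have [K K0 pointwise] := @rough_maximal_le R n m n_gt0 s s_gt1.
pose c := @maximal_const R n m Ps.
(* Adding one makes the constant positive without computing [c]. *)
exists (K * c `^ p^-1 + 1).
have Cge0 : 0 <= K * c `^ p^-1 by rewrite mulr_ge0 ?powR_ge0// ltW.
have C0 : 0 < K * c `^ p^-1 + 1 by rewrite ltr_wpDl.
split => // Omega w f _ dO LO ww Aw lf.
set C := _ + 1 in C0 *.
have mw i := (ww i).1; have w0 i := (ww i).2; have mf i := (lf i).1.
pose nu := nu_weight P w.
have nuE : nu_weight Ps w = nu by exact: nu_weight_div.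
have nu0 x : 0 <= nu x by exact: nu_weight_ge0.
have mnu : measurable_fun setT nu by exact: measurable_nu_weight.
have M0 x : (0 <= rough_maximal Omega f x)%E by exact: rough_maximal_ge0.
have normE : weighted_norm p nu (rough_maximal Omega f) =
    ((\int[lebesgue_Rn R n]_x (rough_maximal Omega f x `^ p * (nu x)%:E)) `^ p^-1)%E.
  by rewrite /weighted_norm; congr (_ `^ _)%E; apply: eq_integral => x _; rewrite gee0_abs.
rewrite normE.
have zero_norm : (forall x, rough_maximal Omega f x <= 0)%E ->
    ((\int[lebesgue_Rn R n]_x (rough_maximal Omega f x `^ p * (nu x)%:E)) `^ p^-1 = 0)%E.
  move=> Mle; rewrite integral0_eq ?(poweR0r pVn0)// => x _.
  have -> : rough_maximal Omega f x = 0%E by apply/le_anti; rewrite Mle M0.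
  by rewrite (poweR0r pn0) mul0e.
set RHS := (X in (_ <= X)%E).
have Omega0 : (0 <= sphere_norm s Omega)%E by exact: Lnorm_ge0.
have RHS0 : (0 <= RHS)%E.
  rewrite /RHS !mule_ge0 ?poweR_ge0 ?lee_fin ?(ltW C0)//.
    by apply: prode_ge0 => i _; exact: poweR_ge0.
  by apply: prode_ge0 => i _; exact: poweR_ge0.
(* If the product weight has no mass, the left-hand side is zero. *)
have [null|/existsNP[Q0 /not_implyP[cQ0 /eqP nuQ0]]] := pselect (forall Q, @cubes R n Q ->
    (\int[lebesgue_Rn R n]_(x in Q) (nu x)%:E = 0)%E).
  rewrite (integral_null_weight mnu nu0 _ null); last by move=> x; exact: poweR_ge0.
  by rewrite (poweR0r pVn0).
rewrite -nuE in nuQ0.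
have dual_lty k := @dual_weight_lty R n m m_gt0 Ps w r1 mw w0 Aw Q0 cQ0 nuQ0 k.
pose g i (y : Rn R n) := `|f i y| `^ s'.
have g0 i y : 0 <= g i y by exact: powR_ge0.
have mg i : measurable_fun setT (g i).
  by apply: (measurableT_comp (measurable_powR _)); exact: measurableT_comp.
have gPE i x : g i x `^ Ps i = `|f i x| `^ P i.
  by rewrite /g -powRrM /Ps mulrC divfK.
pose F i := (\int[lebesgue_Rn R n]_x (`|f i x| `^ P i * w i x)%:E)%E.
have F0 i : (0 <= F i)%E.
  by apply: integral_ge0 => x _; rewrite lee_fin mulr_ge0 ?powR_ge0.
have NE i : (weighted_norm (P i) (w i) (EFin \o f i) = F i `^ (P i)^-1)%E.
  exact: weighted_normE.
(* A function of zero norm vanishes almost everywhere, by Hoelder's inequality on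
   every cube against the dual weight, and the operator is zero; otherwise a zero
   norm could meet an infinite factor in a product with [0 * +oo = 0]. *)
have [/existsP[k /eqP Fk0]|] := boolP [exists k, F k == 0%E].
  rewrite zero_norm// => x.
  apply: le_trans (pointwise _ _ x dO LO mf) _.
  have -> : multilinear_maximal g x = 0%E.
    apply/le_anti; rewrite multilinear_maximal_ge0// andbT.
    apply: ge_ereal_sup => _ [Q [cQ Qx] <-].
    rewrite (bigD1 k)//= (_ : average Q (fun y => (g k y)%:E) = 0%E) ?mul0e//.
    rewrite /average (_ : \int[lebesgue_Rn R n]_(y in Q) (g k y)%:E = 0)%E ?mule0//.
    apply/le_anti/andP; split; last by apply: integral_ge0 => y _; rewrite lee_fin.
    apply: (le_trans (integral_cube_weighted (r1 k) (mw k) (w0 k) (dual_lty k) cQ (mg k) (g0 k))).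
    under eq_integral do rewrite gPE.
    by rewrite -/(F k) Fk0 poweR0r ?mul0e// invr_neq0// gt_eqF// (lt_trans _ (r1 k)).
  by rewrite poweR0r ?mule0// invr_neq0.
rewrite negb_exists => /forallP Fn0.
have [Om0|Omn0] := eqVneq (sphere_norm s Omega) 0%E.
  rewrite zero_norm// => x.
  by apply: le_trans (pointwise _ _ x dO LO mf) _; rewrite Om0 mule0 mul0e.
(* From here on every factor of the right-hand side is positive, so one infinite
   factor makes it infinite. *)
have Fgt0 i : (0 < F i)%E by rewrite lt_neqAle eq_sym Fn0 F0.
have Bgt0 i : (0 < Ainfty_const (dual_weight (Ps i) (w i)))%E.
  exact: lt_le_trans (Ainfty_ge1 (r1 i) (mw i) (w0 i) (dual_lty i)).
have Omgt0 : (0 < sphere_norm s Omega)%E by rewrite lt_neqAle eq_sym Omn0.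
have Agt0 : (0 < A_const Ps w)%E by exact: A_const_gt0 nuQ0.
have front_gt0 : (0 < C%:E * sphere_norm s Omega * A_const Ps w `^ p^-1)%E.
  by rewrite !mule_gt0 ?lte_fin// poweR_gt0.
have prodB0 : (0 < \prod_(i < m) Ainfty_const (dual_weight (Ps i) (w i)) `^ (P i)^-1)%E.
  by apply: prode_gt0 => i; exact: poweR_gt0.
have prodN0 : (0 < \prod_(i < m) weighted_norm (P i) (w i) (EFin \o f i))%E.
  by apply: prode_gt0 => i; rewrite NE; exact: poweR_gt0.
have PVn0 i : (P i)^-1 != 0 by rewrite invr_neq0// gt_eqF.
have [/existsP[k /eqP Bk]|] :=
    boolP [exists k, Ainfty_const (dual_weight (Ps k) (w k)) == +oo%E].
  rewrite (_ : RHS = +oo%E) ?leey// /RHS (@prode_infinite _ _ k).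
  - by rewrite gt0_muley// gt0_mulye.
  - by move=> i; exact: poweR_gt0.
  - by rewrite Bk poweRyr.
rewrite negb_exists => /forallP Bfin.
have [/existsP[k /eqP Fk]|] := boolP [exists k, F k == +oo%E].
  rewrite (_ : RHS = +oo%E) ?leey// /RHS
    [(\prod_(i < m) weighted_norm (P i) (w i) (EFin \o f i))%E](@prode_infinite _ _ k).
  - by rewrite gt0_muley// mule_gt0.
  - by move=> i; rewrite NE; exact: poweR_gt0.
  - by rewrite NE Fk poweRyr.
rewrite negb_exists => /forallP Ffin.
pose B i := fine (Ainfty_const (dual_weight (Ps i) (w i))).
have BE i : Ainfty_const (dual_weight (Ps i) (w i)) = (B i)%:E.
  by rewrite /B fineK// ge0_fin_numE ?(ltW (Bgt0 i))// ltey.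
pose Fr i := fine (F i).
have FE i : F i = (Fr i)%:E by rewrite /Fr fineK// ge0_fin_numE// ltey.
pose A := fine (A_const Ps w).
have AE : A_const Ps w = A%:E by rewrite /A fineK// ge0_fin_numE ?(ltW Agt0).
pose om := fine (sphere_norm s Omega).
have omE : sphere_norm s Omega = om%:E by rewrite /om fineK// ge0_fin_numE//; exact: LO.2.
have FE' i : (\int[lebesgue_Rn R n]_x (g i x `^ Ps i * w i x)%:E = (Fr i)%:E)%E.
  by under eq_integral do rewrite gPE; exact: FE.
have Br0 i : 0 <= B i by rewrite -lee_fin -BE ltW.
have Fr0 i : 0 <= Fr i by rewrite -lee_fin -FE.
have A0 : 0 <= A by rewrite -lee_fin -AE ltW.
have om0 : 0 <= om by rewrite -lee_fin -omE.
(* All quantities are now real; the bound for the maximal function is raised to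
   the power [p^-1] after inserting the pointwise bound, with [rho = p / s']. *)
have main := multilinear_maximal_bound m_gt0 r1 mw w0 mg g0 AE BE FE' cQ0 nuQ0.
rewrite -/rho nuE in main.
apply: (@le_trans _ _ (((K * om) `^ p *
    (c * A * \prod_(k < m) (B k * Fr k) `^ (rho / Ps k)))%:E `^ p^-1)%E).
  apply: le_poweR; first by rewrite invr_ge0 ltW.
    by apply: integral_ge0 => x _; rewrite mule_ge0 ?poweR_ge0// lee_fin.
  rewrite EFinM; apply: le_trans (lee_wpmul2l _ main); last by rewrite lee_fin powR_ge0.
  have mmnu : (\int[lebesgue_Rn R n]_x (rough_maximal Omega f x `^ p * (nu x)%:E) <=
     \int[lebesgue_Rn R n]_x (((K * om) `^ p)%:E *
       (multilinear_maximal g x `^ rho * (nu x)%:E)))%E.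
    apply: ge0_le_integral_any => x _; first by rewrite mule_ge0 ?poweR_ge0// lee_fin.
    rewrite muleA; apply: lee_wpmul2r; first by rewrite lee_fin.
    have h := pointwise _ _ x dO LO mf; rewrite omE -EFinM in h.
    apply: (le_trans (le_poweR (ltW p0) (M0 x) h)).
    have mm0 : (0 <= multilinear_maximal g x)%E by exact: multilinear_maximal_ge0.
    have Kom0 : (0 <= (K * om)%:E)%E by rewrite lee_fin mulr_ge0// ltW.
    rewrite (poweRM _ Kom0 (poweR_ge0 _ _)) -poweRrM -/s' (mulrC s'^-1) -rhoE.
    exact: lexx.
  apply: (le_trans mmnu).
  apply: ge0_le_integralZl_any => [|x]; first exact: powR_ge0.
  by rewrite mule_ge0 ?poweR_ge0// lee_fin.
rewrite poweR_EFin /RHS omE AE.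
rewrite (eq_bigr (fun i => (B i `^ (P i)^-1)%:E)) => [|i _]; last by rewrite BE.
rewrite [X in (_ <= _ * X)%E](eq_bigr (fun i => (Fr i `^ (P i)^-1)%:E)) => [|i _]; last first.
  by rewrite NE FE.
rewrite !prodEFin poweR_EFin -!EFinM lee_fin.
have c0 : 0 <= c.
  rewrite /c /maximal_const !mulr_ge0 ?powR_ge0// prodr_ge0// => k _; exact: powR_ge0.
have Kom0 : 0 <= K * om by rewrite mulr_ge0// ltW.
have BF0 k : 0 <= (B k * Fr k) `^ (rho / Ps k) by exact: powR_ge0.
have BFp0 : 0 <= \prod_(k < m) (B k * Fr k) `^ (rho / Ps k) by exact: prodr_ge0.
rewrite (powRM _ (powR_ge0 _ _) (mulr_ge0 (mulr_ge0 c0 A0) BFp0)) powRK//.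
rewrite (powRM _ (mulr_ge0 c0 A0) BFp0) (powRM _ c0 A0) powR_prod//.
have -> : \prod_(k < m) ((B k * Fr k) `^ (rho / Ps k)) `^ p^-1 =
    \prod_(k < m) B k `^ (P k)^-1 * \prod_(k < m) Fr k `^ (P k)^-1.
  rewrite -big_split/=; apply: eq_bigr => k _.
  rewrite -powRrM -powRM//; congr (_ `^ _).
  have Pkn0 : P k != 0 by rewrite gt_eqF.
  by rewrite rhoE /Ps; move: (p) pn0 => q qn0; field; rewrite qn0 s'n0 Pkn0.
set PB := \prod_(k < m) B k `^ _; set PF := \prod_(k < m) Fr k `^ _.
have PB0 : 0 <= PB by rewrite prodr_ge0// => k _; exact: powR_ge0.
have PF0 : 0 <= PF by rewrite prodr_ge0// => k _; exact: powR_ge0.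
rewrite (_ : K * om * _ = (K * c `^ p^-1) * (om * A `^ p^-1 * PB * PF)); last by ring.
rewrite (_ : C * om * _ * PB * PF = C * (om * A `^ p^-1 * PB * PF)); last by ring.
by apply: ler_wpM2r; rewrite ?mulr_ge0 ?powR_ge0// lerDl.
Qed.
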